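(* Let $u=(u_{ij})_{(i,j)\in\mathcal{A}_3}\in\mathbb{R}^{\mathcal{A}_3}$ and let $\mathcal{C}\subset\mathbb{R}^2$ be the plane tropical cubic given by the tropical polynomial $\min_{(i,j)\in\mathcal{A}_3}\{u_{ij}+ix+jy\}$. Assume that $\mathcal{C}$ has a cycle. Then the negative of the generic valuation of the $j$-invariant at $u$ equals the cycle length of $\mathcal{C}$, i.e. $$-\operatorname{val}_u(j)=\operatorname{cl}(u).$$ Furthermore, if the marked subdivision of $(Q_3,\mathcal{A}_3)$ dual to $\mathcal{C}$ corresponds to a top-dimensional cone of the secondary fan of $\mathcal{A}_3$ (that is, if it is a triangulation), then $\operatorname{val}_u(j)=\operatorname{val}(j(f))$ for every $f=\sum_{(i,j)\in\mathcal{A}_3}a_{ij}x^iy^j$ defining an elliptic curve over $\mathbb{K}$ whose coefficients satisfy $\operatorname{val}(a_{ij})=u_{ij}$ for all $(i,j)\in\mathcal{A}_3$.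
   Context: $\mathbb{K}=\bigcup_{N\ge1}\mathrm{Quot}(\mathbb{C}[[t^{1/N}]])$ is the field of Puiseux series over $\mathbb{C}$, with valuation $\operatorname{val}:\mathbb{K}^*\to\mathbb{Q}$ the lowest exponent of $t$ occurring with nonzero coefficient. $Q_3\subset\mathbb{R}^2$ is the triangle with vertices $(0,0),(3,0),(0,3)$ and $\mathcal{A}_3=Q_3\cap\mathbb{Z}^2$ (ten points). A polynomial $f=\sum_{(i,j)\in\mathcal{A}_3}a_{ij}x^iy^j$ over $\mathbb{K}$ defines, after homogenizing to degree $3$, a cubic in $\mathbb{P}^2_{\mathbb{K}}$. $j$-invariant: there are homogeneous polynomials $A,\Delta\in\mathbb{Q}[a_{ij}\mid (i,j)\in\mathcal{A}_3]$ of degree $12$, unique up to a common nonzero scalar, with $\Delta$ the discriminant of the generic plane cubic, such that the $j$-invariant of each smooth cubic defined by $f$ is $j(f)=A(a)/\Delta(a)$. Generic valuation: for $0\ne h=\sum_\omega h_\omega \underline{a}^\omega\in\mathbb{Q}[\underline a]$ and $u\in\mathbb{R}^{\mathcal{A}_3}$ put $\operatorname{val}_u(h)=\min\{u\cdot\omega\mid h_\omega\neq0\}$, and $\operatorname{val}_u(j):=\operatorname{val}_u(A)-\operatorname{val}_u(\Delta)$. Dual marked subdivision: the regular marked subdivision of $(Q_3,\mathcal{A}_3)$ induced by $u$ is the family $\{(Q_\theta,\mathcal{A}_\theta)\}$ obtained as follows. Let $\mathrm{LC}(u):Q_3\to\mathbb{R}$ be the convex function whose graph is the lower boundary of the convex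 hull of $\{(\omega,a)\mid\omega\in\mathcal{A}_3,\ a\ge u_\omega\}\subset\mathbb{R}^3$. The $Q_\theta$ are the (two-dimensional) maximal domains of linearity of $\mathrm{LC}(u)$, and $\mathcal{A}_\theta=\{\omega\in Q_\theta\cap\mathcal{A}_3\mid u_\omega=\mathrm{LC}(u)(\omega)\}$. This is the marked subdivision dual to $\mathcal{C}$. The set of all $u$ inducing a given regular marked subdivision is a relatively open polyhedral cone; these cones form the secondary fan of $\mathcal{A}_3$. Top-dimensional cones correspond to the subdivisions in which every $Q_\theta$ is a triangle and $\mathcal{A}_\theta$ is its set of vertices (triangulations). The tropical curve $\mathcal{C}$ is the set of points of $\mathbb{R}^2$ where the minimum is attained at least twice. The cell $(Q_\theta,\mathcal{A}_\theta)$ is dual to the vertex $V_\theta$ of $\mathcal{C}$ at which all terms indexed by $\mathcal{A}_\theta$ attain the minimum, and a common edge $F$ of two cells $Q_\theta,Q_{\theta'}$ is dual to the bounded edge $E$ of $\mathcal{C}$ joining $V_\theta$ and $V_{\theta'}$. The lattice length of $E$ is the Euclidean length of $E$ divided by the Euclidean length of $F$. $\mathcal{C}$ has a cycle if $(1,1)$ is a vertex of some $Q_\theta$. The cycle is then the union of the bounded edges of $\mathcal{C}$ dual to the edges of the cells $Q_\theta$ emanating from $(1,1)$, and the cycle length $\operatorname{cl}(u)$ is the sum of the lattice lengths of these edges (with $\operatorname{cl}(u)=0$ if there is no cycle). *)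

(* Defs.v *)
From HB Require Import structures.
From mathcomp Require Import all_boot all_order all_algebra.
From mathcomp Require Import boolp classical_sets functions fsbigop reals.
From mathcomp Require Import complex mpoly.

Set Implicit Arguments.
Unset Strict Implicit.
Unset Printing Implicit Defensive.

Import Order.TTheory GRing.Theory Num.Theory.

Local Open Scope classical_set_scope.
Local Open Scope ring_scope.

(* A Puiseux series is represented by its coefficient function rat -> F; being
   supported in {k / N : k >= m} means lying in Quot(F[[t^(1/N)]]). *)
Definition puiseux_support (F : fieldType) (f : rat -> F) : Prop :=
  exists (N : nat) (m : int), (0 < N)%N /\
    forall q, f q != 0 -> exists2 k : int, m <= k & q = k%:~R / N%:R.

(* The sum is finite when f and g are Puiseux series. *)
Definition puiseux_mulf (F : fieldType) (f g : rat -> F) (q : rat) : F :=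
  \sum_(r \in [set: rat]) f r * g (q - r).

Definition convolution (F : fieldType) (a b : nat -> F) (n : nat) : F :=
  \sum_(k < n.+1) a k * b (n - k)%N.

(* The series with coefficient a k at the exponent o + k / N. *)
Definition grid_fun (F : fieldType) (N : nat) (o : rat) (a : nat -> F)
    (q : rat) : F :=
  if (q - o) * N%:R \is a Num.nat then a (Num.truncn ((q - o) * N%:R)) else 0.

Section PuiseuxTheory.
Variable F : fieldType.
Implicit Types (f g : rat -> F) (a b c : nat -> F) (N : nat) (o q : rat).

Lemma grid_funE N o a k : (0 < N)%N -> grid_fun N o a (o + k%:R / N%:R) = a k.
Proof.
move=> N0; rewrite /grid_fun addrC addKr divfK ?pnatr_eq0 -?lt0n//.
by rewrite natr_nat Num.Theory.natrK.
Qed.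

Lemma grid_fun0 N o a q : (0 < N)%N ->
  grid_fun N o a q != 0 -> exists k, q = o + k%:R / N%:R.
Proof.
move=> N0; rewrite /grid_fun; case: ifPn => [|_]; last by rewrite eqxx.
case/natrP => k qk _; exists k.
by rewrite -qk mulfK ?pnatr_eq0 -?lt0n// addrC subrK.
Qed.

Lemma grid_fun_support N (m : int) a : (0 < N)%N ->
  puiseux_support (grid_fun N (m%:~R / N%:R) a).
Proof.
move=> N0; exists N, m; split=> // q /(grid_fun0 N0)[k ->].
by exists (m + k%:Z); rewrite ?lerDl// intrD mulrDl.
Qed.

Lemma support_grid f N (m : int) : (0 < N)%N ->
  (forall q, f q != 0 -> exists2 k : int, m <= k & q = k%:~R / N%:R) ->
  f = grid_fun N (m%:~R / N%:R) (fun k => f ((m + k%:Z)%:~R / N%:R)).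
Proof.
move=> N0 sf; apply/funext => q.
have [[k ->]|nq] :=
    pselect (exists k : nat, q = m%:~R / N%:R + k%:R / N%:R).
  by rewrite grid_funE// intrD mulrDl.
have [->|/sf[k mk qE]] := eqVneq (f q) 0.
  by apply/esym; apply: contra_notP nq => /eqP /(grid_fun0 N0).
case: nq; exists `|k - m|%N.
rewrite qE -mulrDl; congr (_ / _).
by rewrite -[_%:R]/((Posz `|k - m|)%:~R) -intrD gez0_abs ?subr_ge0// [m + _]addrC subrK.
Qed.

Lemma support_mulN f N M (m : int) : (0 < N)%N -> (0 < M)%N ->
  (forall q, f q != 0 -> exists2 k : int, m <= k & q = k%:~R / N%:R) ->
  (forall q, f q != 0 -> exists2 k : int, m * M%:Z <= k & q = k%:~R / (N * M)%:R).
Proof.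
move=> N0 M0 sf q /sf[k mk ->]; exists (k * M%:Z); first by rewrite ler_wpM2r.
by rewrite intrM natrM -[M%:Z%:~R]/(M%:R) -mulf_div divff ?mulr1// pnatr_eq0 -lt0n.
Qed.

Lemma support_le f N (m m' : int) : m' <= m ->
  (forall q, f q != 0 -> exists2 k : int, m <= k & q = k%:~R / N%:R) ->
  (forall q, f q != 0 -> exists2 k : int, m' <= k & q = k%:~R / N%:R).
Proof. by move=> mm sf q /sf[k mk ->]; exists k => //; exact: le_trans mk. Qed.

Lemma support_common f g h :
    puiseux_support f -> puiseux_support g -> puiseux_support h ->
  exists (N : nat) (m : int) a b c, [/\ (0 < N)%N,
    f = grid_fun N (m%:~R / N%:R) a, g = grid_fun N (m%:~R / N%:R) b &
    h = grid_fun N (m%:~R / N%:R) c].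
Proof.
move=> [N1 [m1 [N1p sf]]] [N2 [m2 [N2p sg]]] [N3 [m3 [N3p sh]]].
pose N := (N1 * (N2 * N3))%N.
have N23 : (0 < N2 * N3)%N by rewrite muln_gt0 N2p.
have N13 : (0 < N1 * N3)%N by rewrite muln_gt0 N1p.
have N12 : (0 < N1 * N2)%N by rewrite muln_gt0 N1p.
have N0 : (0 < N)%N by rewrite muln_gt0 N1p.
have := support_mulN N1p N23 sf; rewrite -/N => {}sf.
have := support_mulN N2p N13 sg; rewrite mulnCA -/N => {}sg.
have := support_mulN N3p N12 sh; rewrite [(N3 * _)%N]mulnC -mulnA -/N => {}sh.
pose m := Num.min (m1 * (N2 * N3)%:Z)
  (Num.min (m2 * (N1 * N3)%:Z) (m3 * (N1 * N2)%:Z)).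
have /support_le/(_ sf)/(support_grid N0) -> : m <= m1 * (N2 * N3)%:Z.
  by rewrite ge_min lexx.
have /support_le/(_ sg)/(support_grid N0) -> : m <= m2 * (N1 * N3)%:Z.
  by rewrite !ge_min lexx orbT.
have /support_le/(_ sh)/(support_grid N0) -> : m <= m3 * (N1 * N2)%:Z.
  by rewrite !ge_min lexx !orbT.
by exists N, m; do 3!eexists.
Qed.

Lemma grid_funD N o a b :
  grid_fun N o a + grid_fun N o b = grid_fun N o (a + b).
Proof.
apply/funext => q; rewrite -[LHS]/(grid_fun N o a q + grid_fun N o b q).
by rewrite /grid_fun; case: ifP => // _; rewrite addr0.
Qed.

Lemma grid_funB N o a b :
  grid_fun N o a - grid_fun N o b = grid_fun N o (a - b).
Proof.
apply/funext => q; rewrite -[LHS]/(grid_fun N o a q - grid_fun N o b q).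
by rewrite /grid_fun; case: ifP => // _; rewrite subr0.
Qed.

Lemma puiseux_support0 : puiseux_support (0 : rat -> F).
Proof. by exists 1%N, 0; split=> // q; rewrite eqxx. Qed.

Lemma puiseux_supportB f g : puiseux_support f -> puiseux_support g ->
  puiseux_support (f - g).
Proof.
move=> sf sg; have [N [m [a [b [_ [N0 -> -> _]]]]]] := support_common sf sg sf.
by rewrite grid_funB; exact: grid_fun_support.
Qed.

Lemma grid_fun_mul N o o' a b : (0 < N)%N ->
  puiseux_mulf (grid_fun N o a) (grid_fun N o' b) =
  grid_fun N (o + o') (convolution a b).
Proof.
move=> N0; apply/funext => q; rewrite /puiseux_mulf.
have Nn0 : N%:R != 0 :> rat by rewrite pnatr_eq0 -lt0n.
have [[n qn]|qN] := pselect (exists n : nat, q = o + o' + n%:R / N%:R); last first.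
  rewrite fsbig1 => [|r _].
    have [//|/(grid_fun0 N0)//] := eqVneq (grid_fun N (o + o') (convolution a b) q) 0.
  apply/eqP; apply: contra_notT qN; rewrite mulf_eq0 negb_or.
  case/andP => /(grid_fun0 N0)[k ->] /(grid_fun0 N0)[l E].
  exists (k + l)%N.
  rewrite natrD mulrDl addrACA -E addrC subrK//.
have rw_inj : injective (fun k : nat => o + k%:R / N%:R).
  move=> i j /addrI /(mulIf _) E; apply/eqP.
  by rewrite -(eqr_nat rat) E// invr_eq0.
rewrite (fsbigE [seq o + k%:R / N%:R | k <- iota 0 n.+1])//; last first.
- move=> r _ rw; apply/eqP; apply: contraNT rw; rewrite mulf_eq0 negb_or.
  case/andP => /(grid_fun0 N0)[k ->] /(grid_fun0 N0)[l E].
  have kl : (k + l)%N = n.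
    apply/eqP; rewrite -(eqr_nat rat).
    rewrite -(inj_eq (mulIf (_ : N%:R^-1 != 0))) ?invr_eq0//.
    rewrite -(inj_eq (addrI (o + o'))) -qn natrD mulrDl addrACA -E.
    by rewrite addrC subrK.
  apply/mapP; exists k => //.
  by rewrite mem_iota leq0n add0n ltnS -kl leq_addr.
- by rewrite (map_inj_uniq rw_inj) iota_uniq.
rewrite big_map (eq_bigl xpredT); last by move=> i; rewrite in_setT.
rewrite -[iota 0 n.+1]/(index_iota 0 n.+1) big_mkord.
rewrite qn grid_funE// /convolution.
apply: eq_bigr => k _; rewrite grid_funE//; congr (_ * _).
rewrite -(grid_funE o' b (n - k) N0); congr (grid_fun _ _ _ _).
rewrite natrB ?mulrBl -1?ltnS//.
by rewrite opprD addrACA [o + o']addrC addrK.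
Qed.

Lemma conv_comm a b : convolution a b = convolution b a.
Proof.
apply/funext => n; rewrite /convolution (reindex_inj rev_ord_inj)/=.
apply: eq_bigr => k _; rewrite mulrC subSS subKn//.
by rewrite -ltnS.
Qed.

Lemma conv_poly a b n L : (n < L)%N ->
  convolution a b n = ((\poly_(k < L) a k) * (\poly_(k < L) b k))`_n.
Proof.
move=> nL; rewrite coefM; apply: eq_bigr => k _; rewrite !coef_poly.
have kL : (k < L)%N by apply: leq_ltn_trans nL; rewrite -ltnS.
by rewrite kL (leq_ltn_trans (leq_subr _ _) nL).
Qed.

Lemma conv_assoc a b c : convolution a (convolution b c) = convolution (convolution a b) c.
Proof.
apply/funext => n.
pose p d := \poly_(k < n.+1) (d k : F).
transitivity ((p a * (p b * p c))`_n).
  rewrite coefM; apply: eq_bigr => k _; rewrite coef_poly ltn_ord.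
  by rewrite (@conv_poly b c (n - k) n.+1)// ltnS leq_subr.
rewrite mulrA coefM; apply: eq_bigr => k _.
by rewrite coef_poly ltnS leq_subr (@conv_poly a b k n.+1).
Qed.

Fixpoint conv_inv_seq a n : seq F :=
  if n is n'.+1 then
    let s := conv_inv_seq a n' in
    rcons s (- (a 0)^-1 * \sum_(k < n) a k.+1 * s`_(n' - k))
  else [:: (a 0)^-1].

Definition conv_inv a n : F := (conv_inv_seq a n)`_n.

Lemma size_conv_inv_seq a n : size (conv_inv_seq a n) = n.+1.
Proof. by elim: n => //= n IHn; rewrite size_rcons IHn. Qed.

Lemma nth_conv_inv_seq a n k : (k <= n)%N ->
  (conv_inv_seq a n)`_k = conv_inv a k.
Proof.
elim: n => [|n IHn]; first by rewrite leqn0 => /eqP->.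
rewrite leq_eqVlt => /predU1P[->//|]; rewrite ltnS => kn /=.
by rewrite nth_rcons size_conv_inv_seq ltnS kn IHn.
Qed.

Lemma conv_invE a n : a 0 != 0 -> convolution a (conv_inv a) n = (n == 0)%:R.
Proof.
move=> a0; rewrite /convolution big_ord_recl subn0.
case: n => [|n]; first by rewrite big_ord0 addr0 divff.
rewrite {1}/conv_inv /= nth_rcons size_conv_inv_seq ltnn eqxx.
rewrite mulrA mulrN divff// mulN1r addrC; apply/eqP; rewrite subr_eq0; apply/eqP.
apply: eq_bigr => k _; rewrite nth_conv_inv_seq ?leq_subr//.
Qed.

Lemma puiseux_mulf_support f g : puiseux_support f -> puiseux_support g ->
  puiseux_support (puiseux_mulf f g).
Proof.
move=> sf sg; have [N [m [a [b [_ [N0 -> -> _]]]]]] := support_common sf sg sf.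
by rewrite grid_fun_mul// -mulrDl -intrD; exact: grid_fun_support.
Qed.

Lemma puiseux_mulfA f g h :
    puiseux_support f -> puiseux_support g -> puiseux_support h ->
  puiseux_mulf f (puiseux_mulf g h) = puiseux_mulf (puiseux_mulf f g) h.
Proof.
move=> sf sg sh.
have [N [m [a [b [c [N0 -> -> ->]]]]]] := support_common sf sg sh.
by rewrite !grid_fun_mul// conv_assoc addrA.
Qed.

Lemma puiseux_mulfC f g : puiseux_support f -> puiseux_support g ->
  puiseux_mulf f g = puiseux_mulf g f.
Proof.
move=> sf sg; have [N [m [a [b [_ [N0 -> -> _]]]]]] := support_common sf sg sf.
by rewrite !grid_fun_mul// conv_comm.
Qed.

Lemma puiseux_mulfDl f g h :
    puiseux_support f -> puiseux_support g -> puiseux_support h ->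
  puiseux_mulf (f + g) h = puiseux_mulf f h + puiseux_mulf g h.
Proof.
move=> sf sg sh.
have [N [m [a [b [c [N0 -> -> ->]]]]]] := support_common sf sg sh.
rewrite grid_funD !grid_fun_mul// grid_funD; congr (grid_fun _ _ _).
apply/funext => n; rewrite -[RHS]/(convolution a c n + convolution b c n) /convolution -big_split/=.
by apply: eq_bigr => k _; rewrite -mulrDl.
Qed.

Definition puiseux_cstf (x : F) (q : rat) : F := if q == 0 then x else 0.

Lemma puiseux_cstf_support x : puiseux_support (puiseux_cstf x).
Proof.
exists 1%N, 0; split=> // q; rewrite /puiseux_cstf.
have [->|] := eqVneq q 0; last by rewrite eqxx.
by exists 0; rewrite ?mul0r.
Qed.

Lemma puiseux_mul1f f : puiseux_mulf (puiseux_cstf 1) f = f.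
Proof.
apply/funext => q; rewrite /puiseux_mulf (fsbigE [:: 0])//; last first.
  by move=> r _; rewrite inE /puiseux_cstf => /negbTE->; rewrite mul0r.
by rewrite big_cons big_nil in_setT /= addr0 /puiseux_cstf eqxx ?mul1r ?subr0.
Qed.

Lemma support_least f : puiseux_support f -> f != 0 ->
  exists N m a, [/\ (0 < N)%N, f = grid_fun N ((m : int)%:~R / N%:R) a & a 0 != 0].
Proof.
move=> [N [m [N0 sf]]] fn0; have fE := support_grid N0 sf.
pose P k := f ((m + k%:Z)%:~R / N%:R) != 0.
have exP : exists k, P k.
  apply: contrapT => /forallNP nP; case/eqP: fn0; apply/funext => q.
  have [//|/[dup] fq] := eqVneq (f q) 0.
  rewrite {1}fE => /(grid_fun0 N0)[k qE].
  by case: (nP k); rewrite /P intrD mulrDl -qE.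
have [k Pk kmin] := ex_minnP exP.
exists N, (m + k%:Z).
have {}sf q : f q != 0 -> exists2 l : int, m + k%:Z <= l & q = l%:~R / N%:R.
  move=> /[dup] fq /sf[l ml qE]; exists l => //.
  have lE : l = m + `|l - m|%N by rewrite gez0_abs ?subr_ge0// [m + _]addrC subrK.
  by rewrite {1}lE lerD2l; apply: kmin; rewrite /P -lE -qE.
exists (fun l => f ((m + k%:Z + l%:Z)%:~R / N%:R)).
by split=> //; [exact: support_grid|rewrite addr0].
Qed.

Lemma puiseux_mulf_inv f : puiseux_support f -> f != 0 ->
  exists2 g, puiseux_support g & puiseux_mulf f g = puiseux_cstf 1.
Proof.
move=> sf fn0; have [N [m [a [N0 -> a0]]]] := support_least sf fn0.
exists (grid_fun N ((- m)%:~R / N%:R) (conv_inv a)).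
  exact: grid_fun_support.
rewrite grid_fun_mul// -mulrDl -intrD subrr mul0r; apply/funext => q.
have Nn0 : N%:R != 0 :> rat by rewrite pnatr_eq0 -lt0n.
rewrite /grid_fun /puiseux_cstf subr0.
case: ifPn => [/natrP[k qk]|qN]; last first.
  by case: eqP => // q0; move: qN; rewrite q0 mul0r -[0]/(0%:R) natr_nat.
rewrite qk Num.Theory.natrK conv_invE//.
have -> : (q == 0) = (k == 0%N).
  by rewrite -(eqr_nat rat) -qk mulf_eq0 (negbTE Nn0) orbF.
by case: (k == 0%N).
Qed.

End PuiseuxTheory.

Definition puiseux_pred (F : fieldType) : {pred rat -> F} :=
  fun f => `[< puiseux_support f >].

Record puiseux (F : fieldType) := Puiseux {
  pcoef :> rat -> F;
  _ : pcoef \in @puiseux_pred F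
}.

HB.instance Definition _ (F : fieldType) := [isSub for @pcoef F].
HB.instance Definition _ (F : fieldType) := [Choice of puiseux F by <:].

Section PuiseuxField.
Variable F : fieldType.
Implicit Types f g h : puiseux F.

Lemma pcoefP f : puiseux_support f.
Proof. by apply/asboolP; exact: (valP f). Qed.

Fact puiseux_zmod_closed : zmod_closed (@puiseux_pred F).
Proof.
split; first by apply/asboolP; exact: puiseux_support0.
move=> f g; rewrite !unfold_in => /asboolP sf /asboolP sg.
by apply/asboolP; exact: puiseux_supportB.
Qed.

HB.instance Definition _ := GRing.isZmodClosed.Build (rat -> F)
  (@puiseux_pred F) puiseux_zmod_closed.
HB.instance Definition _ := [SubChoice_isSubZmodule of puiseux F by <:].

Definition puiseux_mul f g : puiseux F :=
  Puiseux (asboolT (puiseux_mulf_support (pcoefP f) (pcoefP g))).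

Definition puiseuxC (x : F) : puiseux F :=
  Puiseux (asboolT (puiseux_cstf_support x)).

Fact puiseux_mulA : associative puiseux_mul.
Proof. by move=> f g h; apply/val_inj/puiseux_mulfA; exact: pcoefP. Qed.

Fact puiseux_mulC : commutative puiseux_mul.
Proof. by move=> f g; apply/val_inj/puiseux_mulfC; exact: pcoefP. Qed.

Fact puiseux_mul1 : left_id (puiseuxC 1) puiseux_mul.
Proof. by move=> f; apply/val_inj/puiseux_mul1f. Qed.

Fact puiseux_mulDl : left_distributive puiseux_mul +%R.
Proof. by move=> f g h; apply/val_inj/puiseux_mulfDl; exact: pcoefP. Qed.

Fact puiseux_1_neq0 : puiseuxC 1 != 0.
Proof.
apply/eqP => /(congr1 (fun f : puiseux F => f 0)) /eqP.
by rewrite /= /puiseux_cstf eqxx oner_eq0.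
Qed.

HB.instance Definition _ := GRing.Zmodule_isComNzRing.Build (puiseux F)
  puiseux_mulA puiseux_mulC puiseux_mul1 puiseux_mulDl puiseux_1_neq0.

Definition puiseux_inv f : puiseux F := xget 0 [set g | g * f = 1].

Fact puiseux_mulV f : f != 0 -> puiseux_inv f * f = 1.
Proof.
move=> fn0; rewrite /puiseux_inv; apply: (@xgetPex _ 0 [set g | g * f = 1]).
have [|g sg fg] := puiseux_mulf_inv (pcoefP f); first by [].
exists (Puiseux (asboolT sg)); rewrite /= mulrC; exact/val_inj.
Qed.

Fact puiseux_inv0 : puiseux_inv 0 = 0.
Proof.
by apply: xgetPN => g /eqP; rewrite mulr0 eq_sym oner_eq0.
Qed.

HB.instance Definition _ :=
  GRing.ComNzRing_isField.Build (puiseux F) puiseux_mulV puiseux_inv0.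

Fact puiseuxC_zmod_morphism : zmod_morphism puiseuxC.
Proof.
move=> x y; apply/val_inj/funext => q.
rewrite -[RHS]/(puiseux_cstf x q - puiseux_cstf y q) /= /puiseux_cstf.
by case: ifP => // _; rewrite subr0.
Qed.

Fact puiseuxC_monoid_morphism : monoid_morphism puiseuxC.
Proof.
split=> // x y; apply/val_inj/funext => q.
rewrite -[RHS]/(puiseux_mulf (puiseux_cstf x) (puiseux_cstf y) q).
rewrite /puiseux_mulf (fsbigE [:: 0])//; last first.
  by move=> r _; rewrite inE {1}/puiseux_cstf => /negbTE->; rewrite mul0r.
rewrite big_cons big_nil in_setT /= addr0 /puiseux_cstf eqxx subr0 /= /puiseux_cstf.
by case: ifP; rewrite ?mulr0.
Qed.

HB.instance Definition _ :=
  GRing.isZmodMorphism.Build F (puiseux F) puiseuxC puiseuxC_zmod_morphism.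
HB.instance Definition _ :=
  GRing.isMonoidMorphism.Build F (puiseux F) puiseuxC puiseuxC_monoid_morphism.

(* The lowest exponent; [pval 0] is a junk value. *)
Definition pval f : rat :=
  xget 0 [set q | f q != 0 /\ forall r, f r != 0 -> q <= r].

Lemma pvalP f : f != 0 -> f (pval f) != 0 /\ forall r, f r != 0 -> pval f <= r.
Proof.
move=> fn0; apply: (@xgetPex _ 0 [set q | f q != 0 /\ forall r, f r != 0 -> q <= r]).
have [//|N [m [a [N0 fE a0]]]] := support_least (pcoefP f).
exists (m%:~R / N%:R); rewrite /= fE; split.
  by rewrite -[X in grid_fun _ _ _ X]addr0 -[X in _ + X](mul0r N%:R^-1) (grid_funE _ _ 0).
by move=> r /(grid_fun0 N0)[k ->]; rewrite lerDl mulr_ge0// invr_ge0.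
Qed.

End PuiseuxField.

(* The lattice points (i, j) of the triangle Q3, with i, j >= 0, i + j <= 3. *)
Definition A3 : finType := {ij : 'I_4 * 'I_4 | (ij.1 + ij.2 <= 3)%N}.

Definition xdeg (w : A3) : nat := (val w).1.
Definition ydeg (w : A3) : nat := (val w).2.

Section Subdivision.
Variable R : realType.
Implicit Types (u : A3 -> R) (p q r c V : 'rV[R]_2) (P Q : set 'rV[R]_2).

Definition vec (x y : R) : 'rV[R]_2 := \row_(k < 2) (if k == 0 then x else y).

Definition dot p q : R := \sum_k p 0 k * q 0 k.

Definition enorm p : R := Num.sqrt (dot p p).

Definition pt (w : A3) : 'rV[R]_2 := vec (xdeg w)%:R (ydeg w)%:R.

Definition convex_hull (E : lmodType R) (S : set E) : set E :=
  [set x | exists n (l : 'I_n -> R) (s : 'I_n -> E),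
    [/\ forall i, 0 <= l i, \sum_i l i = 1, forall i, S (s i)
      & x = \sum_i l i *: s i]].

Definition is_convex Q : Prop := convex_hull Q `<=` Q.

Definition Q3 : set 'rV[R]_2 := convex_hull [set vec 0 0; vec 3 0; vec 0 3].

Definition lifted_hull u : set ('rV[R]_2 * R^o) :=
  @convex_hull ('rV[R]_2 * R^o)%type
    [set z | exists w, z.1 = pt w /\ u w <= (z.2 : R)].

(* The function with graph the lower boundary of the lifted hull; meaningful
   on Q3 only. *)
Definition LC u p : R := inf [set h | lifted_hull u (p, h)].

Definition noncollinear p q r : Prop := row_free (col_mx (q - p) (r - p)).

Definition two_dimensional Q : Prop :=
  exists p q r, [/\ Q p, Q q, Q r & noncollinear p q r].

Definition linearity_domain u Q : Prop :=
  [/\ Q `<=` Q3, is_convex Q &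
    exists c b, forall p, Q p -> LC u p = dot c p + b].

Definition cell u Q : Prop :=
  [/\ two_dimensional Q, linearity_domain u Q &
    forall P, linearity_domain u P -> Q `<=` P -> P = Q].

Definition marking u Q : set A3 := [set w | Q (pt w) /\ u w = LC u (pt w)].

Definition is_triangulation u : Prop :=
  forall Q, cell u Q -> exists w1 w2 w3 : A3,
    [/\ noncollinear (pt w1) (pt w2) (pt w3),
      Q = convex_hull [set pt w1; pt w2; pt w3]
      & marking u Q = [set w1; w2; w3]].

Definition is_face Q P : Prop :=
  exists c, P = [set p | Q p /\ forall q, Q q -> dot c p <= dot c q].

Definition is_vertex Q p : Prop := is_face Q [set p].

Definition is_edge Q p q : Prop :=
  p <> q /\ is_face Q (convex_hull [set p; q]).

Definition attains_min u V (w : A3) : Prop :=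
  forall w', u w + dot (pt w) V <= u w' + dot (pt w') V.

Definition tropical_curve u : set 'rV[R]_2 :=
  [set V | exists w w', [/\ w <> w', attains_min u V w & attains_min u V w']].

Definition dual_vertex u Q V : Prop :=
  tropical_curve u V /\ forall w, marking u Q w -> attains_min u V w.

Definition has_cycle u : Prop := exists Q, cell u Q /\ is_vertex Q (vec 1 1).

(* The edges emanating from (1, 1) are indexed by their other endpoint, which
   is a vertex of a cell and hence belongs to A3. *)
Definition spoke u (w : A3) : Prop :=
  exists Q, cell u Q /\ is_edge Q (vec 1 1) (pt w).

(* The lattice length of the edge of the tropical curve dual to the common edge
   from (1, 1) to w of two cells. *)
Definition dual_length u (w : A3) : R :=
  xget 0 [set l | exists Q Q' V V',
    [/\ [/\ cell u Q, cell u Q' & Q <> Q'],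
        is_edge Q (vec 1 1) (pt w) /\ is_edge Q' (vec 1 1) (pt w),
        dual_vertex u Q V /\ dual_vertex u Q' V'
      & l = enorm (V' - V) / enorm (pt w - vec 1 1)]].

Definition cycle_length u : R :=
  if `[< has_cycle u >] then \sum_(w : A3 | `[< spoke u w >]) dual_length u w
  else 0.

(* Monomials in the coefficients a_ij are indexed by 'I_#|A3| through
   [enum_val]. *)
Definition mnm_weight u (m : 'X_{1..#|A3|}) : R :=
  \sum_(k < #|A3|) u (enum_val k) * (m k)%:R.

(* The minimum over the support of h, for h != 0: the default [mlead h] then
   belongs to the support. *)
Definition gval u (h : {mpoly rat[#|A3|]}) : R :=
  \big[Num.min/mnm_weight u (mlead h)]_(m <- msupp h) mnm_weight u m.

End Subdivision.

(* Meant for F algebraically closed of characteristic 0. *)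
Section PlaneCubic.
Variable F : fieldType.
Implicit Types a : A3 -> F.

Definition cubic_form a : {mpoly F[3]} :=
  \sum_(w : A3) a w *:
    ('X_0 ^+ xdeg w * 'X_1 ^+ ydeg w * 'X_2 ^+ (3 - xdeg w - ydeg w)).

Definition smooth_cubic a : Prop :=
  forall v : 'I_3 -> F, (exists k, v k != 0) -> (cubic_form a).@[v] = 0 ->
    exists k, ((cubic_form a)^`M(k)).@[v] != 0.

Definition weierstrass_form (p q : F) : {mpoly F[3]} :=
  'X_1 ^+ 2 * 'X_2 - 'X_0 ^+ 3 - p *: ('X_0 * 'X_2 ^+ 2) - q *: 'X_2 ^+ 3.

Definition linear_change (M : 'M[F]_3) (f : {mpoly F[3]}) : {mpoly F[3]} :=
  f \mPo [tuple \sum_(l < 3) M k l *: 'X_l | k < 3].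

(* j is read off a short Weierstrass equation y^2 = x^3 + p x + q of the cubic
   in suitable projective coordinates, normalized by j(y^2 = x^3 + x) = 1728. *)
Definition is_j_invariant a (j : F) : Prop :=
  exists (M : 'M[F]_3) (c p q : F),
    [/\ M \in unitmx, c != 0, 4 * p ^+ 3 + 27 * q ^+ 2 != 0,
      linear_change M (cubic_form a) = c *: weierstrass_form p q
      & j = 1728 * (4 * p ^+ 3) / (4 * p ^+ 3 + 27 * q ^+ 2)].

Definition eval_coef (h : {mpoly rat[#|A3|]}) a : F :=
  mmap ratr (fun k => a (enum_val k)) h.

(* The singular cubics form an irreducible hypersurface of degree 12, so this
   determines the discriminant up to a nonzero scalar. *)
Definition is_discriminant (D : {mpoly rat[#|A3|]}) : Prop :=
  D \is 12.-homog /\ forall a, eval_coef D a = 0 <-> ~ smooth_cubic a.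

Definition is_j_fraction (A D : {mpoly rat[#|A3|]}) : Prop :=
  [/\ A \is 12.-homog, is_discriminant D &
    forall a, smooth_cubic a ->
      is_j_invariant a (eval_coef A a / eval_coef D a)].

End PlaneCubic.

(* Main.v *)
From Stdlib Require Import ZArith.
From mathcomp Require Import fingroup perm.
Require Import Defs.
From HB Require Import structures.
From mathcomp Require Import all_boot all_order all_algebra.
From mathcomp Require Import boolp classical_sets functions fsbigop reals.
From mathcomp Require Import complex mpoly.
From mathcomp Require Import zify ssrZ ring lra.

Set Implicit Arguments.
Unset Strict Implicit.
Unset Printing Implicit Defensive.

Import Order.TTheory GRing.Theory Num.Theory.

Local Open Scope ring_scope.
Local Open Scope complex_scope.
Delimit Scope Z_scope with ZZ.

(** The invariants of plane cubics turn the statement into one about explicit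
integer polynomials.  Let S and T be the Aronhold invariants, of degrees 4 and
6, normalized to have leading terms a_11^4 and a_11^6.  A linear change of
coordinates M multiplies them by det M ^ 4 and det M ^ 6 (a product of
transvections, permutations and a diagonal matrix, for each of which this is a
polynomial identity), and on a Weierstrass cubic they are explicit
([weierstrass_aronhold]); hence j (S^3 - T^2) = 1728 S^3 on every smooth cubic
([j_invariant_disc]).  Since D does not vanish identically and vanishes on the
singular cubics, A (S^3 - T^2) = 1728 S^3 D as polynomials ([j_fraction_eq]),
so val_u(A) - val_u(D) = 3 val_u(S) - val_u(S^3 - T^2) because the generic
valuation is multiplicative ([gvalM]).

A cycle means that (1,1) is lifted strictly below the hull of the nine other
lifted points ([has_cycle_interior]).  Consequently a product of coefficients
whose exponents average to (1,1) has larger valuation than the power of a_11 of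
the same degree, so val S = 4 u_11.  In S^3 - T^2 the leading terms cancel.
What survives is -1728 times a product of three polynomials, one for each node
of the triangle xyz = 0 which the cubic approaches when a_11 dominates: up to
terms of larger valuation they are the smoothing parameters of the nodes, and
each has six terms.  Every other monomial of S^3 - T^2 is a multiple of a
monomial of that product by a nontrivial one averaging to (1,1), a finite check
([disc_tail_dominated]).  Thus val_u(S^3 - T^2) is a sum of three minima of
six weights ([val_disc]).

On the tropical side, the points V where the term (1,1) attains the minimum
form a polygon cut out by nine inequalities, whose normals d_0, ..., d_8 are the
boundary points of Q_3 minus (1,1), in cyclic order.  The spokes of the
subdivision at (1,1) are the k for which the side with normal d_k has positive
lattice length, and that length is the lattice length of the dual edge
([dual_length_fan]).  As d_(k-1) + d_(k+1) is 2 d_k, except at the three corners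
where it is d_k, the sum of the side lengths telescopes to support function
values in the three corner directions ([perimeter]).  By linear programming
duality these are the same minima of six weights ([corner_le],
[corner_attained]), which proves the first claim.

For the second claim the same computation is made with the valuation of Puiseux
series.  The only difference is that cancellation could raise the valuation of
one of the three factors if its minimum of weights were attained twice.  Such a
tie makes at least three boundary points and (1,1) marked in one cell
([corner_unique]), which does not happen in a triangulation
([triangulation_node]). *)

(** * Sparse integer polynomials *)

(** Exponent vectors and lists of terms are meant to be computed with. Sums
    are merged as if both lists were sorted, which keeps them short; the
    evaluation lemmas hold without sortedness, so it is never proved. *)
Definition monomial := seq nat.
Definition spoly := seq (monomial * Z).

Fixpoint mmul (m n : monomial) : monomial :=
  match m, n with
  | [::], _ => n
  | _, [::] => m
  | a :: m', b :: n' => (a + b)%N :: mmul m' n'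
  end.

Fixpoint mcmp (m n : monomial) : comparison :=
  match m, n with
  | [::], [::] => Eq
  | [::], _ => Lt
  | _, [::] => Gt
  | a :: m', b :: n' =>
      match Nat.compare a b with Eq => mcmp m' n' | c => c end
  end.

Fixpoint padd (p : spoly) : spoly -> spoly :=
  fix padd_p (q : spoly) : spoly :=
    match p, q with
    | [::], _ => q
    | _, [::] => p
    | (m, a) :: p', (n, b) :: q' =>
        match mcmp m n with
        | Lt => (m, a) :: padd p' q
        | Gt => (n, b) :: padd_p q'
        | Eq => let c := Z.add a b in
                if Z.eqb c Z0 then padd p' q' else (m, c) :: padd p' q'
        end
    end.

Definition pterm (t : monomial * Z) (p : spoly) : spoly :=
  [seq (mmul t.1 s.1, Z.mul t.2 s.2) | s <- p].

Definition pscale (c : Z) (p : spoly) : spoly := pterm ([::], c) p.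

Definition pmul (p q : spoly) : spoly :=
  foldr (fun t => padd (pterm t q)) [::] p.

Definition pexp (p : spoly) (e : nat) : spoly :=
  iter e (pmul p) [:: ([::], 1%ZZ)].

(** Insertion sort of the terms, so that tables may be written in any order. *)
Definition pnorm (p : spoly) : spoly := foldr (fun t => padd [:: t]) [::] p.

Fixpoint msubst (s : seq spoly) (m : monomial) : spoly :=
  match s, m with
  | p :: s', e :: m' => pmul (pexp p e) (msubst s' m')
  | _, _ => [:: ([::], 1%ZZ)]
  end.

Definition psubst (s : seq spoly) (p : spoly) : spoly :=
  foldr (fun t => padd (pscale t.2 (msubst s t.1))) [::] p.

Section Eval.
Variable K : comNzRingType.
Implicit Types (x : seq K) (m : monomial) (p q : spoly).

(** Variables beyond the end of [x] are ignored, and missing exponents are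
    zero. *)
Definition evalm x m : K := \prod_(k < size x) x`_k ^+ nth 0%N m k.

Definition evalp x p : K := \sum_(t <- p) (int_of_Z t.2)%:~R * evalm x t.1.

Lemma nth_mmul m n k : nth 0%N (mmul m n) k = (nth 0 m k + nth 0 n k)%N.
Proof.
elim: m n k => [|a m IH] [|b n] [|k] //=; rewrite ?nth_nil ?addn0 //.
Qed.

Lemma evalm_mul x m n : evalm x (mmul m n) = evalm x m * evalm x n.
Proof.
by rewrite -big_split; apply: eq_bigr => k _; rewrite nth_mmul exprD.
Qed.

Lemma evalm_nil x : evalm x [::] = 1.
Proof. by apply: big1 => k _; rewrite nth_nil. Qed.

Lemma mcmp_eq m n : mcmp m n = Eq -> m = n.
Proof.
elim: m n => [|a m IH] [|b n] //=.
case E: (Nat.compare a b) => // /IH ->.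
by congr (_ :: _); apply/PeanoNat.Nat.compare_eq_iff.
Qed.

Lemma evalp_cons x t p :
  evalp x (t :: p) = (int_of_Z t.2)%:~R * evalm x t.1 + evalp x p.
Proof. by rewrite /evalp big_cons. Qed.

Lemma evalp_nil x : evalp x [::] = 0.
Proof. by rewrite /evalp big_nil. Qed.

Lemma int_of_ZD a b : int_of_Z (Z.add a b) = int_of_Z a + int_of_Z b.
Proof. exact: (raddfD int_of_Z). Qed.

Lemma int_of_ZM a b : int_of_Z (Z.mul a b) = int_of_Z a * int_of_Z b.
Proof. exact: (rmorphM int_of_Z). Qed.

Lemma evalp_add x p q : evalp x (padd p q) = evalp x p + evalp x q.
Proof.
elim: p q => [|[m a] p IHp]; first by case=> [|s q]; rewrite evalp_nil add0r.
elim=> [|[n b] q IHq]; first by rewrite evalp_nil addr0.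
rewrite [padd _ _]/=; case E: (mcmp m n).
- have ZE : (int_of_Z (a + b)%ZZ)%:~R = (int_of_Z a)%:~R + (int_of_Z b)%:~R :> K.
    by rewrite int_of_ZD intrD.
  rewrite !evalp_cons /= -(mcmp_eq E) addrACA -mulrDl -ZE -IHp.
  case E0: (Z.eqb _ _); last by rewrite evalp_cons.
  by move/Z.eqb_eq: E0 => ->; rewrite mul0r add0r.
- by rewrite evalp_cons IHp [in RHS]evalp_cons addrA.
- rewrite evalp_cons [X in _ + X]IHq [evalp x ((n, b) :: q)]evalp_cons.
  by rewrite addrCA.
Qed.

Lemma evalp_term x t p :
  evalp x (pterm t p) = (int_of_Z t.2)%:~R * evalm x t.1 * evalp x p.
Proof.
rewrite /evalp big_map mulr_sumr; apply: eq_bigr => s _ /=.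
by rewrite evalm_mul int_of_ZM intrM mulrACA.
Qed.

Lemma evalp_scale x c p : evalp x (pscale c p) = (int_of_Z c)%:~R * evalp x p.
Proof. by rewrite evalp_term evalm_nil mulr1. Qed.

Lemma evalp_mul x p q : evalp x (pmul p q) = evalp x p * evalp x q.
Proof.
elim: p => [|t p IH]; first by rewrite [pmul _ _]/= !evalp_nil mul0r.
by rewrite [pmul _ _]/= evalp_add IH evalp_term evalp_cons mulrDl.
Qed.

Lemma evalp_one x : evalp x [:: ([::], 1%ZZ)] = 1.
Proof. by rewrite evalp_cons evalp_nil evalm_nil mulr1 addr0. Qed.

Lemma evalp_exp x p e : evalp x (pexp p e) = evalp x p ^+ e.
Proof.
elim: e => [|e IH]; first by rewrite evalp_one.
by rewrite /pexp iterS evalp_mul IH exprS.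
Qed.

Lemma evalm_subst x s m : (size m <= size s)%N ->
  evalp x (msubst s m) = evalm [seq evalp x p | p <- s] m.
Proof.
elim: s m => [|p s IH] [|e m] //=; rewrite ?evalp_one ?evalm_nil //.
rewrite ltnS => /IH E; rewrite evalp_mul evalp_exp {}E.
by rewrite [RHS]big_ord_recl.
Qed.

Lemma evalp_subst x s p : all (fun t => (size t.1 <= size s)%N) p ->
  evalp x (psubst s p) = evalp [seq evalp x q | q <- s] p.
Proof.
elim: p => [|t p IH] /=; first by rewrite !evalp_nil.
case/andP => st /IH E; rewrite evalp_add evalp_scale evalm_subst // E.
by rewrite evalp_cons.
Qed.

End Eval.

(** * Invariants of plane cubics *)

(** The coefficients of a cubic are numbered 0, ..., 8 along the boundary of Q_3,
    in the order (0,0), (1,0), (2,0), (3,0), (2,1), (1,2), (0,3), (0,2), (0,1),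
    and 9 for (1,1).  Permuting the homogeneous coordinates then acts by the
    rotation by 3 and by the reflection exchanging (i,j) and (j,i). *)
Definition mrot (m : monomial) : monomial :=
  take 3 (drop 6 m) ++ take 6 m ++ drop 9 m.

Definition mflip (m : monomial) : monomial :=
  head 0%N m :: rev (take 8 (behead m)) ++ drop 9 m.

Definition orbit (m : monomial) : seq monomial :=
  undup (let n := mflip m in
    [:: m; mrot m; mrot (mrot m); n; mrot n; mrot (mrot n)]).

Definition orbit_sum (p : spoly) : spoly :=
  pnorm (flatten [seq [seq (m, t.2) | m <- orbit t.1] | t <- p]).

(** The Aronhold invariants are fixed by permutations of the coordinates, so
    one monomial for each orbit determines them. With this scaling they are,
    up to sign for the second, the covariants c_4 and c_6 of the Jacobian. *)
Definition aronholdS : spoly := orbit_sum [::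
  ([:: 0;0;0;0;0;0;0;0;0;4], 1%ZZ);
  ([:: 0;1;0;0;0;1;0;0;0;2], (-8)%ZZ);
  ([:: 1;0;0;1;0;0;1;0;0;1], (-216)%ZZ);
  ([:: 1;0;0;0;1;1;0;0;0;1], 24%ZZ);
  ([:: 0;1;0;0;1;0;0;1;0;1], 24%ZZ);
  ([:: 1;0;1;0;1;0;1;0;0;0], 144%ZZ);
  ([:: 1;0;1;0;0;2;0;0;0;0], (-48)%ZZ);
  ([:: 0;2;0;0;0;2;0;0;0;0], 16%ZZ);
  ([:: 0;1;1;0;0;1;0;1;0;0], (-16)%ZZ)]%N.

Definition aronholdT : spoly := orbit_sum [::
  ([:: 0;0;0;0;0;0;0;0;0;6], 1%ZZ);
  ([:: 0;1;0;0;0;1;0;0;0;4], (-12)%ZZ);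
  ([:: 1;0;0;1;0;0;1;0;0;3], 540%ZZ);
  ([:: 1;0;0;0;1;1;0;0;0;3], 36%ZZ);
  ([:: 0;1;0;0;1;0;0;1;0;3], 36%ZZ);
  ([:: 1;0;1;0;1;0;1;0;0;2], (-648)%ZZ);
  ([:: 1;0;1;0;0;2;0;0;0;2], (-72)%ZZ);
  ([:: 0;2;0;0;0;2;0;0;0;2], 48%ZZ);
  ([:: 0;1;1;0;0;1;0;1;0;2], 24%ZZ);
  ([:: 1;1;0;1;0;1;1;0;0;1], (-1296)%ZZ);
  ([:: 1;1;0;0;2;0;1;0;0;1], 864%ZZ);
  ([:: 1;1;0;0;1;2;0;0;0;1], (-144)%ZZ);
  ([:: 1;0;1;0;1;1;0;1;0;1], 720%ZZ);
  ([:: 0;2;0;0;1;1;0;1;0;1], (-144)%ZZ);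
  ([:: 2;0;0;2;0;0;2;0;0;0], (-5832)%ZZ);
  ([:: 2;0;0;1;1;1;1;0;0;0], 3888%ZZ);
  ([:: 2;0;0;1;0;3;0;0;0;0], (-864)%ZZ);
  ([:: 2;0;0;0;2;2;0;0;0;0], 216%ZZ);
  ([:: 1;1;1;0;1;1;1;0;0;0], (-1296)%ZZ);
  ([:: 1;1;1;0;0;3;0;0;0;0], 288%ZZ);
  ([:: 1;1;0;1;1;0;1;1;0;0], (-1296)%ZZ);
  ([:: 1;1;0;1;0;2;0;1;0;0], 864%ZZ);
  ([:: 1;1;0;0;2;1;0;1;0;0], (-144)%ZZ);
  ([:: 1;0;2;0;0;2;0;1;0;0], (-576)%ZZ);
  ([:: 0;3;0;0;0;3;0;0;0;0], (-64)%ZZ);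
  ([:: 0;2;1;0;0;2;0;1;0;0], 96%ZZ);
  ([:: 0;2;0;0;2;0;0;2;0;0], 216%ZZ);
  ([:: 0;1;1;0;1;1;0;1;1;0], 48%ZZ)]%N.

Definition cubic_disc : spoly :=
  padd (pexp aronholdS 3) (pscale (-1)%ZZ (pexp aronholdT 2)).

(** When a_11 dominates, the cubic has an approximate critical point near
    [0:0:1], at x = - a_01 / a_11 and y = - a_10 / a_11. The value of the
    cubic there, times a_11^3, has eight terms. Two are left out: they are
    a_10 a_01 a_11^2 times a_21 a_01 / a_11^2 or a_12 a_10 / a_11^2, and these
    factors have positive valuation because (1,1) is the midpoint of the two
    boundary points involved. *)
Definition node0 : spoly := pnorm [::
  ([:: 1;0;0;0;0;0;0;0;0;3], 1%ZZ);
  ([:: 0;1;0;0;0;0;0;0;1;2], (-1)%ZZ);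
  ([:: 0;2;0;0;0;0;0;1;0;1], 1%ZZ);
  ([:: 0;0;1;0;0;0;0;0;2;1], 1%ZZ);
  ([:: 0;3;0;0;0;0;1;0;0;0], (-1)%ZZ);
  ([:: 0;0;0;1;0;0;0;0;3;0], (-1)%ZZ)]%N.
(** Rotation moves the corner (0,0) to (3,0), and (3,0) to (0,3). *)
Definition prot (p : spoly) : spoly := pnorm [seq (mrot t.1, t.2) | t <- p].
Definition node3 := prot node0.
Definition node6 := prot node3.

Definition cubic_disc_tail : spoly :=
  padd cubic_disc (pscale 1728%ZZ (pmul node0 (pmul node3 node6))).

#[global] Opaque aronholdS aronholdT cubic_disc node0 node3 node6 cubic_disc_tail.

(** * Valuations of S and of the discriminant *)

Definition latx (k : nat) : nat := nth 0%N [:: 0; 1; 2; 3; 2; 1; 0; 0; 0; 1]%N k.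
Definition laty (k : nat) : nat := nth 0%N [:: 0; 0; 0; 0; 1; 2; 3; 2; 1; 1]%N k.

(** Monomials of degree [d] whose exponent vectors have barycentre (1,1):
    these are the only ones which occur in an invariant of degree [d]. *)
Definition balanced (d : nat) (m : monomial) : bool :=
  [&& size m == 10, sumn m == d,
    sumn [seq nth 0 m k * latx k | k <- iota 0 10] == d &
    sumn [seq nth 0 m k * laty k | k <- iota 0 10] == d]%N.

(** Divisibility in the nine boundary variables only: the exponent of a_11
    adjusts itself to the degree. *)
Definition submono (m n : monomial) : bool :=
  all (fun k => nth 0 m k <= nth 0 n k)%N (iota 0 9).

Definition proper_submono (m n : monomial) : bool :=
  submono m n && has (fun k => nth 0 m k < nth 0 n k)%N (iota 0 9).

(** The divisibility tests on partial products only prune the search over the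
    6^3 triples of terms. *)
Definition dominated (n : monomial) : bool :=
  has (fun t0 => submono t0.1 n && has (fun t3 =>
    let m := mmul t0.1 t3.1 in submono m n && has (fun t6 =>
      proper_submono (mmul m t6.1) n) node6) node3) node0.

(** The combinatorial core of the valuation of the discriminant: what the
    product of the node polynomials leaves over consists of nontrivial
    multiples of the monomials of that product. *)
Lemma disc_tail_dominated :
  all (fun t => balanced 12 t.1 && dominated t.1) cubic_disc_tail.
Proof. by vm_compute. Qed.

Lemma node_balanced :
  all (fun t0 => all (fun t3 => all (fun t6 =>
    balanced 12 (mmul (mmul t0.1 t3.1) t6.1)) node6) node3) node0.
Proof. by vm_compute. Qed.

Definition center4 : monomial := [:: 0; 0; 0; 0; 0; 0; 0; 0; 0; 4]%N.

Lemma aronholdS_lead :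
  all (fun t => balanced 4 t.1 && proper_submono [::] t.1)
    (padd aronholdS [:: (center4, (-1)%ZZ)]).
Proof. by vm_compute. Qed.

Section Weights.
Variable R : realFieldType.
Implicit Types (u : nat -> R) (m n : monomial).

(** The nine vectors from (1,1) to the boundary points; the index 9 gives 0. *)
Definition dirx (k : nat) : R := (latx k)%:R - 1.
Definition diry (k : nat) : R := (laty k)%:R - 1.

(** This says that (1,1) is lifted strictly below the hull of the other lifted
    points: a nonnegative combination of the boundary points with barycentre
    (1,1) lies strictly above it. *)
Definition interior u : Prop := forall c : nat -> R,
  (forall k, 0 <= c k) ->
  \sum_(0 <= k < 9) c k * dirx k = 0 -> \sum_(0 <= k < 9) c k * diry k = 0 ->
  (exists2 k, (k < 9)%N & c k != 0) ->
  0 < \sum_(0 <= k < 9) c k * (u k - u 9%N).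

Definition weight u m : R := \sum_(0 <= k < 10) (nth 0 m k)%N%:R * u k.

Lemma weight_mul u m n : weight u (mmul m n) = weight u m + weight u n.
Proof.
rewrite -big_split; apply: eq_bigr => k _.
by rewrite nth_mmul natrD mulrDl.
Qed.

Lemma sum_monomial m : size m = 10%N ->
  \sum_(0 <= k < 10) (nth 0 m k)%N%:R = (sumn m)%:R :> R.
Proof. by move=> sm; rewrite -natr_sum sumnE [in RHS](big_nth 0%N) sm. Qed.

Lemma balanced_sums d m : balanced d m ->
  \sum_(0 <= k < 9) (nth 0 m k)%N%:R * dirx k = 0 /\
  \sum_(0 <= k < 9) (nth 0 m k)%N%:R * diry k = 0.
Proof.
case/and4P => /eqP sm /eqP E1 /eqP Ex /eqP Ey.
have S1 : \sum_(0 <= k < 10) (nth 0 m k)%N%:R = d%:R :> R.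
  by rewrite sum_monomial // E1.
have aux f : sumn [seq nth 0 m k * f k | k <- iota 0 10]%N = d -> f 9%N = 1%N ->
    \sum_(0 <= k < 9) (nth 0 m k)%N%:R * ((f k)%:R - 1) = 0 :> R.
  move=> Ef f9.
  transitivity (\sum_(0 <= k < 10) (nth 0 m k)%N%:R * ((f k)%:R - 1) : R).
    by rewrite [RHS]big_nat_recr //= f9 subrr mulr0 addr0.
  transitivity (\sum_(0 <= k < 10) ((nth 0 m k * f k)%N%:R - (nth 0 m k)%:R) : R).
    by apply: eq_bigr => k _; rewrite natrM; ring.
  rewrite sumrB S1 -natr_sum; apply/eqP; rewrite subr_eq0; apply/eqP.
  by congr _%:R; rewrite -Ef sumnE big_map.
by split=> //; exact: aux.
Qed.

(** Measuring weights from that of a_11 isolates the part contributed by the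
    boundary variables. *)
Lemma weight_centered u m : size m = 10%N -> weight u m =
  (sumn m)%:R * u 9%N + \sum_(0 <= k < 9) (nth 0 m k)%N%:R * (u k - u 9%N).
Proof.
move=> sm; rewrite -(sum_monomial sm).
rewrite mulr_suml [X in X + _]big_nat_recr //= [weight u m]big_nat_recr //=.
rewrite addrAC; congr (_ + _); rewrite -big_split; apply: eq_bigr => k _ /=.
by ring.
Qed.

Lemma weight_balanced u d m : balanced d m ->
  weight u m = d%:R * u 9%N + \sum_(0 <= k < 9) (nth 0 m k)%N%:R * (u k - u 9%N).
Proof. by case/and4P => /eqP sm /eqP <- _ _; exact: weight_centered. Qed.

Lemma submono_le m n k : submono m n -> (k < 9)%N -> (nth 0 m k <= nth 0 n k)%N.
Proof. by move=> /allP + k9; apply; rewrite mem_iota. Qed.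

(** The quotient of the two monomials, made of degree zero by a power of a_11,
    is a nontrivial nonnegative combination of boundary points with barycentre
    (1,1). *)
Lemma weight_proper u d e m n : interior u -> balanced d m -> balanced e n ->
  proper_submono m n -> weight u m - d%:R * u 9%N < weight u n - e%:R * u 9%N.
Proof.
move=> hu bm bn /andP[sub /hasP[k]]; rewrite mem_iota => /andP[_ k9] lt_k.
rewrite (weight_balanced u bm) (weight_balanced u bn) ![_ * u _ + _]addrC !addrK.
have [mx my] := balanced_sums bm; have [nx ny] := balanced_sums bn.
rewrite -subr_gt0 -sumrB.
pose c k : R := (nth 0 n k - nth 0 m k)%N%:R.
have cE j f : (j < 9)%N -> c j * f = (nth 0 n j)%N%:R * f - (nth 0 m j)%N%:R * f.
  by move=> j9; rewrite /c natrB ?mulrBl //; apply: submono_le sub j9.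
have sE (f : nat -> R) : \sum_(0 <= j < 9) c j * f j =
    \sum_(0 <= j < 9) (nth 0 n j)%N%:R * f j - \sum_(0 <= j < 9) (nth 0 m j)%N%:R * f j.
  by rewrite -sumrB big_nat [RHS]big_nat; apply: eq_bigr => j /andP[_ j9]; rewrite cE.
rewrite sumrB -sE; apply: hu.
- by move=> j; rewrite ler0n.
- by rewrite sE mx nx subrr.
- by rewrite sE my ny subrr.
- by exists k => //; rewrite pnatr_eq0 subn_eq0 -ltnNge.
Qed.

Lemma weight_dominated u n (r0 r3 r6 : R) : interior u ->
  balanced 12 n -> dominated n ->
  all (fun t => r0 <= weight u t.1) node0 ->
  all (fun t => r3 <= weight u t.1) node3 ->
  all (fun t => r6 <= weight u t.1) node6 ->
  r0 + r3 + r6 < weight u n.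
Proof.
move=> hu bn /hasP[t0 t0P /andP[_ /hasP[t3 t3P /andP[_ /hasP[t6 t6P sub]]]]].
move=> /allP/(_ _ t0P) le0 /allP/(_ _ t3P) le3 /allP/(_ _ t6P) le6.
have bal : balanced 12 (mmul (mmul t0.1 t3.1) t6.1).
  by have /allP/(_ _ t0P)/allP/(_ _ t3P)/allP/(_ _ t6P) := node_balanced.
have := weight_proper hu bal bn sub.
rewrite ltrD2r !weight_mul; apply: le_lt_trans.
by rewrite !lerD.
Qed.

End Weights.

(** The arguments on weights apply to any valuation; it will be the generic
    valuation of polynomials and the valuation of Puiseux series. The value at
    0 is arbitrary, so bounds are stated with 0 set apart. *)
Section Valuation.
Variables (R : realFieldType) (K : idomainType) (v : K -> R).

Record is_valuation : Prop := IsValuation {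
  valM : forall x y, x != 0 -> y != 0 -> v (x * y) = v x + v y;
  valD : forall x y, x != 0 -> y != 0 -> x + y != 0 ->
    Num.min (v x) (v y) <= v (x + y);
  val_int : forall z : int, z != 0 -> z%:~R != 0 :> K /\ v z%:~R = 0 }.

Hypothesis vP : is_valuation.
Implicit Types (x y : K) (r s : R).

Definition val_ge x r : Prop := x = 0 \/ r <= v x.
Definition val_gt x r : Prop := x = 0 \/ r < v x.
Definition val_eq x r : Prop := x != 0 /\ v x = r.

Lemma val_nat n : (0 < n)%N -> n%:R != 0 :> K /\ v n%:R = 0.
Proof. by move=> n0; apply: (val_int vP (z := Posz n)); case: n n0. Qed.

Lemma val1 : v 1 = 0.
Proof. by have [] := val_int vP (z := 1) isT. Qed.

Lemma valN x : v (- x) = v x.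
Proof.
have [->|x0] := eqVneq x 0; first by rewrite oppr0.
have [n10 vn1] : (-1)%:~R != 0 :> K /\ v (-1)%:~R = 0 by apply: (val_int vP).
by rewrite -mulN1r (valM vP) // ?vn1 ?add0r // -[-1]/((-1)%:~R).
Qed.

Lemma val_gtD x y r : val_gt x r -> val_gt y r -> val_gt (x + y) r.
Proof.
have [->|x0] := eqVneq x 0; first by rewrite add0r.
have [->|y0] := eqVneq y 0; first by rewrite addr0.
case=> [/eqP|hx]; first by rewrite (negbTE x0).
case=> [/eqP|hy]; first by rewrite (negbTE y0).
have [->|xy0] := eqVneq (x + y) 0; first by left.
right; apply: lt_le_trans (valD vP x0 y0 xy0).
by rewrite lt_min hx.
Qed.

Lemma val_geD x y r : val_ge x r -> val_ge y r -> val_ge (x + y) r.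
Proof.
have [->|x0] := eqVneq x 0; first by rewrite add0r.
have [->|y0] := eqVneq y 0; first by rewrite addr0.
case=> [/eqP|hx]; first by rewrite (negbTE x0).
case=> [/eqP|hy]; first by rewrite (negbTE y0).
have [->|xy0] := eqVneq (x + y) 0; first by left.
right; apply: le_trans (valD vP x0 y0 xy0).
by rewrite le_min hx.
Qed.

(** A strictly larger term does not change the valuation: otherwise
    subtracting it again would contradict the ultrametric inequality. *)
Lemma val_eqD x y r : val_eq x r -> val_gt y r -> val_eq (x + y) r.
Proof.
move=> [x0 xr] hy; have [y0|y0] := eqVneq y 0; first by rewrite y0 addr0.
case: hy => [/eqP|hy]; first by rewrite (negbTE y0).
have xy0 : x + y != 0.
  apply: contraTneq hy => /eqP; rewrite addr_eq0 => /eqP xE.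
  by rewrite -xr xE valN ltxx.
split=> //; apply/eqP; rewrite eq_le; apply/andP; split; last first.
  apply: le_trans (valD vP x0 y0 xy0).
  by rewrite le_min xr lexx ltW.
have Ny0 : - y != 0 by rewrite oppr_eq0.
have := valD vP xy0 Ny0; rewrite addrK => /(_ x0).
rewrite valN xr; case: (leP (v (x + y)) (v y)) => // _.
by rewrite leNgt hy.
Qed.

Lemma val_eqM x y r s : val_eq x r -> val_eq y s -> val_eq (x * y) (r + s).
Proof.
by move=> [x0 <-] [y0 <-]; split; [rewrite mulf_neq0|rewrite (valM vP)].
Qed.

Lemma val_eqX x r n : val_eq x r -> val_eq (x ^+ n) (n%:R * r).
Proof.
move=> xr; elim: n => [|n IH].
  by rewrite mul0r; split; [exact: oner_neq0|exact: val1].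
by rewrite exprS mulrS mulrDl mul1r; apply: val_eqM.
Qed.

Variables (x : seq K) (u : nat -> R).
Hypothesis sx : size x = 10%N.
Hypothesis xu : forall k, (k < 10)%N -> val_eq x`_k (u k).

Lemma val_evalm m : val_eq (evalm x m) (weight u m).
Proof.
rewrite /evalm /weight sx big_mkord; elim/big_ind2: _ => //.
- by split; [exact: oner_neq0|exact: val1].
- by move=> *; apply: val_eqM.
- by move=> k _; apply: val_eqX; apply: xu.
Qed.

Lemma val_term (z : int) m : z != 0 -> val_eq (z%:~R * evalm x m) (weight u m).
Proof.
move=> z0; have [? vz] := val_int vP z0.
by rewrite -[weight u m]add0r; apply: val_eqM; [split|exact: val_evalm].
Qed.

Lemma val_evalp_gt (p : spoly) r :
  all (fun t => r < weight u t.1) p -> val_gt (evalp x p) r.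
Proof.
elim: p => [|t p IH] /=; first by left; rewrite evalp_nil.
case/andP => tr /IH hp; rewrite evalp_cons; apply: val_gtD => //.
have [->|/(val_term t.1)[_ vt]] := eqVneq (int_of_Z t.2) 0.
  by left; rewrite mul0r.
by right; rewrite vt.
Qed.

Lemma val_evalp_ge (p : spoly) r :
  all (fun t => r <= weight u t.1) p -> val_ge (evalp x p) r.
Proof.
elim: p => [|t p IH] /=; first by left; rewrite evalp_nil.
case/andP => tr /IH hp; rewrite evalp_cons; apply: val_geD => //.
have [->|/(val_term t.1)[_ vt]] := eqVneq (int_of_Z t.2) 0.
  by left; rewrite mul0r.
by right; rewrite vt.
Qed.

Hypothesis hu : interior u.

(** The other monomials of S are balanced and involve a boundary variable,
    hence are larger than a_11^4. *)
Lemma val_aronholdS : val_eq (evalp x aronholdS) (4 * u 9%N).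
Proof.
have -> : evalp x aronholdS = evalm x center4 + evalp x (padd aronholdS [:: (center4, (-1)%ZZ)]).
  by rewrite evalp_add evalp_cons evalp_nil /= -[_%:~R]/(-1) addr0; ring.
have -> : 4 * u 9%N = weight u center4.
  by rewrite /weight /= big_mkord !big_ord_recr big_ord0 /=; ring.
apply: val_eqD; first exact: val_evalm.
apply: val_evalp_gt; apply: sub_all aronholdS_lead => t /andP[bt pt].
have b0 : balanced 0 [:: 0; 0; 0; 0; 0; 0; 0; 0; 0; 0]%N by [].
have b4 : balanced 4 center4 by [].
have pt' : proper_submono [:: 0; 0; 0; 0; 0; 0; 0; 0; 0; 0]%N t.1 by [].
have := weight_proper hu b0 bt pt'.
rewrite (weight_balanced u b0) (weight_balanced u b4) mul0r add0r subr0.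
by rewrite !big_mkord !big_ord_recr !big_ord0 /=; lra.
Qed.

(** Write S^3 - T^2 as -1728 times the product of the node polynomials, plus
    monomials of larger weight. *)
Lemma val_disc r0 r3 r6 :
  all (fun t => r0 <= weight u t.1) node0 ->
  all (fun t => r3 <= weight u t.1) node3 ->
  all (fun t => r6 <= weight u t.1) node6 ->
  val_eq (evalp x node0) r0 -> val_eq (evalp x node3) r3 ->
  val_eq (evalp x node6) r6 ->
  val_eq (evalp x cubic_disc) (r0 + r3 + r6).
Proof.
move=> le0 le3 le6 e0 e3 e6.
pose c : int := - int_of_Z 1728%ZZ.
have -> : evalp x cubic_disc = c%:~R * (evalp x node0 * evalp x node3 * evalp x node6)
    + evalp x cubic_disc_tail.
  have tailE k (d n0 n3 n6 : spoly) :
      evalp x d = (- int_of_Z k)%:~R * (evalp x n0 * evalp x n3 * evalp x n6)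
        + evalp x (padd d (pscale k (pmul n0 (pmul n3 n6)))).
    by rewrite evalp_add evalp_scale !evalp_mul mulrNz mulNr addrC -addrA !mulrA subrr addr0.
  exact: tailE.
apply: val_eqD; last first.
  apply: val_evalp_gt; apply: sub_all disc_tail_dominated => t /andP[bt dt].
  exact: weight_dominated hu bt dt le0 le3 le6.
have c0 : c != 0.
  by rewrite oppr_eq0 -[0]/(int_of_Z Z0) (inj_eq (can_inj int_of_ZK)).
have [z0 vz] := val_int vP c0.
rewrite -[r0 + r3 + r6]add0r; apply: val_eqM; first by split.
by apply: val_eqM => //; apply: val_eqM.
Qed.

End Valuation.

(** * Certified substitutions *)

Section EvalMore.
Variable K : comNzRingType.
Implicit Types (x : seq K) (m : monomial) (p q : spoly).

Lemma evalm_cons (c : K) x e m : evalm (c :: x) (e :: m) = c ^+ e * evalm x m.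
Proof. by rewrite /evalm big_ord_recl. Qed.

Lemma evalm_cat x y m : evalm (x ++ y) m = evalm x m * evalm y (drop (size x) m).
Proof.
elim: x m => [|c x IH] m; first by rewrite drop0 /evalm big_ord0 mul1r.
case: m => [|e m]; first by rewrite !evalm_nil mulr1.
by rewrite cat_cons !evalm_cons IH mulrA.
Qed.

Lemma evalp_cat x y p : all (fun t => size t.1 <= size x)%N p ->
  evalp (x ++ y) p = evalp x p.
Proof.
elim: p => [|t p IH]; first by rewrite !evalp_nil.
case/andP => st /IH E; rewrite !evalp_cons E evalm_cat drop_oversize //.
by rewrite evalm_nil mulr1.
Qed.

(** Multiplying by a monomial in later variables requires exponent vectors
    that reach them. *)
Definition ppad (n : nat) (p : spoly) : spoly :=
  [seq (t.1 ++ nseq n 0%N, t.2) | t <- p].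

Lemma evalp_pad n x p : evalp x (ppad n p) = evalp x p.
Proof.
rewrite /evalp big_map; apply: eq_bigr => t _ /=; congr (_ * _).
apply: eq_bigr => k _; congr (_ ^+ _); rewrite nth_cat; case: ltnP => // h.
by rewrite nth_nseq if_same nth_default.
Qed.

Definition psubst_eq (s : seq spoly) (p q : spoly) : bool :=
  all (fun t => size t.1 <= size s)%N p &&
  nilp (padd (psubst s p) (pscale (-1)%ZZ q)).

Lemma psubst_eqP x s p q : psubst_eq s p q ->
  evalp [seq evalp x r | r <- s] p = evalp x q.
Proof.
case/andP => sp /nilP E; have := congr1 (evalp x) E.
rewrite evalp_add evalp_scale evalp_nil (evalp_subst _ sp).
rewrite -[(int_of_Z (-1))%:~R]/(-1 : K) mulN1r.
by move/eqP; rewrite subr_eq0 => /eqP.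
Qed.

(** The substitution [s] may involve, after the ten coefficients, further
    variables which parametrize a family of linear maps; the monomial [m] by
    which the polynomial [p] is multiplied is then the determinant power, as a
    monomial in these parameters. *)
Definition semi_invariant (s : seq spoly) (m : monomial) (p : spoly) : bool :=
  all (fun t => size t.1 <= 10)%N p &&
  psubst_eq s p (pterm (m, 1%ZZ) (ppad (size m - 10) p)).

Lemma semi_invariantP s m p (a y : seq K) : semi_invariant s m p -> size a = 10%N ->
  evalp [seq evalp (a ++ y) q | q <- s] p = evalm (a ++ y) m * evalp a p.
Proof.
case/andP => sp /psubst_eqP -> sa.
by rewrite evalp_term evalp_pad evalp_cat ?sa // mul1r.
Qed.

Lemma evalp_disc x : evalp x cubic_disc = evalp x aronholdS ^+ 3 - evalp x aronholdT ^+ 2.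
Proof.
have E p q : evalp x (padd (pexp p 3) (pscale (-1)%ZZ (pexp q 2))) =
    evalp x p ^+ 3 - evalp x q ^+ 2.
  by rewrite evalp_add evalp_scale !evalp_exp -[(int_of_Z (-1))%:~R]/(-1 : K) mulN1r.
exact: E.
Qed.

End EvalMore.

(** The coefficients of f(x + t y, y, z), with t the variable of index 10. *)
Definition transv_subst : seq spoly := [::
  [:: ([:: 1;0;0;0;0;0;0;0;0;0;0], 1%ZZ)];
  [:: ([:: 0;1;0;0;0;0;0;0;0;0;0], 1%ZZ)];
  [:: ([:: 0;0;1;0;0;0;0;0;0;0;0], 1%ZZ)];
  [:: ([:: 0;0;0;1;0;0;0;0;0;0;0], 1%ZZ)];
  pnorm [:: ([:: 0;0;0;0;1;0;0;0;0;0;0], 1%ZZ); ([:: 0;0;0;1;0;0;0;0;0;0;1], 3%ZZ)];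
  pnorm [:: ([:: 0;0;0;0;0;1;0;0;0;0;0], 1%ZZ); ([:: 0;0;0;0;1;0;0;0;0;0;1], 2%ZZ);
     ([:: 0;0;0;1;0;0;0;0;0;0;2], 3%ZZ)];
  pnorm [:: ([:: 0;0;0;0;0;0;1;0;0;0;0], 1%ZZ); ([:: 0;0;0;0;0;1;0;0;0;0;1], 1%ZZ);
     ([:: 0;0;0;0;1;0;0;0;0;0;2], 1%ZZ); ([:: 0;0;0;1;0;0;0;0;0;0;3], 1%ZZ)];
  pnorm [:: ([:: 0;0;0;0;0;0;0;1;0;0;0], 1%ZZ); ([:: 0;0;0;0;0;0;0;0;0;1;1], 1%ZZ);
     ([:: 0;0;1;0;0;0;0;0;0;0;2], 1%ZZ)];
  pnorm [:: ([:: 0;0;0;0;0;0;0;0;1;0;0], 1%ZZ); ([:: 0;1;0;0;0;0;0;0;0;0;1], 1%ZZ)];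
  pnorm [:: ([:: 0;0;0;0;0;0;0;0;0;1;0], 1%ZZ); ([:: 0;0;1;0;0;0;0;0;0;0;1], 2%ZZ)]
  ]%N.

Definition unit_mono (n k : nat) : monomial := set_nth 0%N (nseq n 0%N) k 1%N.

(** The coefficients of f(d_0 x, d_1 y, d_2 z), the d_i being the variables of
    index 10, 11 and 12. *)
Definition diag_subst : seq spoly :=
  [seq [:: (unit_mono 10 k ++ [:: latx k; laty k; 3 - latx k - laty k]%N, 1%ZZ)]
  | k <- iota 0 10].

Definition perm_subst (s : seq nat) : seq spoly :=
  [seq [:: (unit_mono 10 k, 1%ZZ)] | k <- s].

Definition swap01 := [:: 0; 8; 7; 6; 5; 4; 3; 2; 1; 9]%N.
Definition swap02 := [:: 3; 2; 1; 0; 8; 7; 6; 5; 4; 9]%N.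
Definition swap12 := [:: 6; 5; 4; 3; 2; 1; 0; 8; 7; 9]%N.

Lemma aronholdS_transv : semi_invariant transv_subst (nseq 11 0%N) aronholdS.
Proof. by vm_compute. Qed.
Lemma aronholdT_transv : semi_invariant transv_subst (nseq 11 0%N) aronholdT.
Proof. by vm_compute. Qed.

Lemma aronholdS_diag : semi_invariant diag_subst (nseq 10 0 ++ [:: 4; 4; 4])%N aronholdS.
Proof. by vm_compute. Qed.
Lemma aronholdT_diag : semi_invariant diag_subst (nseq 10 0 ++ [:: 6; 6; 6])%N aronholdT.
Proof. by vm_compute. Qed.

Lemma aronhold_swap s : s \in [:: swap01; swap02; swap12] ->
  semi_invariant (perm_subst s) (nseq 10 0%N) aronholdS &&
  semi_invariant (perm_subst s) (nseq 10 0%N) aronholdT.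
Proof. by rewrite !inE => /or3P[] /eqP->; vm_compute. Qed.

(** * Covariance under linear changes of coordinates *)

Section Covariance.
Variable K : fieldType.
Implicit Types (a b : seq K) (M N : 'M[K]_3) (v : 'cV[K]_3).

Definition cubic_at a v : K :=
  \sum_(0 <= k < 10) a`_k *
    (v 0 0 ^+ latx k * v 1 0 ^+ laty k * v 2 0 ^+ (3 - latx k - laty k)).

(** Asserting only that transformed coefficients [b] exist makes the property
    stable under products of matrices; they are identified later, from their
    values. *)
Definition covariant M : Prop := forall a, size a = 10%N -> exists b,
  [/\ size b = 10%N, forall v, cubic_at a (M *m v) = cubic_at b v,
      evalp b aronholdS = \det M ^+ 4 * evalp a aronholdS &
      evalp b aronholdT = \det M ^+ 6 * evalp a aronholdT].

Lemma covariantM M N : covariant M -> covariant N -> covariant (M *m N).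
Proof.
move=> cM cN a /cM[b [/cN[c [sc cE cS cT]] bE bS bT]].
exists c; split=> //.
- by move=> v; rewrite -mulmxA bE cE.
- by rewrite cS bS det_mulmx exprMn_comm; [ring|exact: mulrC].
- by rewrite cT bT det_mulmx exprMn_comm; [ring|exact: mulrC].
Qed.

Lemma seq10P a : size a = 10%N -> exists a0 a1 a2 a3 a4 a5 a6 a7 a8 a9 : K,
  a = [:: a0; a1; a2; a3; a4; a5; a6; a7; a8; a9].
Proof.
do 10! [case: a => [//|? a]]; case: a => // _; by do 10!eexists.
Qed.

Lemma ord3P (P : 'I_3 -> Prop) : P 0 -> P 1 -> P 2 -> forall i, P i.
Proof.
move=> P0 P1 P2 [[|[|[|]]] // p].
- by rewrite (_ : Ordinal p = 0) //; apply: val_inj.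
- by rewrite (_ : Ordinal p = 1) //; apply: val_inj.
- by rewrite (_ : Ordinal p = 2) //; apply: val_inj.
Qed.

Lemma mulmx3E M v i :
  (M *m v) i 0 = M i 0 * v 0 0 + M i 1 * v 1 0 + M i 2 * v 2 0.
Proof.
rewrite mxE !big_ord_recr big_ord0 /= add0r.
by congr (M i _ * v _ 0 + M i _ * v _ 0 + M i _ * v _ 0); exact: val_inj.
Qed.

Lemma cubic_atE a v : cubic_at a v =
  a`_0 * v 2 0 ^+ 3 + a`_1 * (v 0 0 * v 2 0 ^+ 2) + a`_2 * (v 0 0 ^+ 2 * v 2 0)
  + a`_3 * v 0 0 ^+ 3 + a`_4 * (v 0 0 ^+ 2 * v 1 0) + a`_5 * (v 0 0 * v 1 0 ^+ 2)
  + a`_6 * v 1 0 ^+ 3 + a`_7 * (v 1 0 ^+ 2 * v 2 0) + a`_8 * (v 1 0 * v 2 0 ^+ 2)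
  + a`_9 * (v 0 0 * v 1 0 * v 2 0).
Proof.
rewrite /cubic_at big_mkord !big_ord_recr big_ord0 /=.
by rewrite !expr0 ?expr1 ?mul1r ?mulr1 add0r.
Qed.

Definition transv (i j : 'I_3) (t : K) : 'M[K]_3 := 1%:M + t *: delta_mx i j.

Lemma det_transv01 t : \det (transv 0 1 t) = 1.
Proof.
rewrite -det_tr det_trig.
  by rewrite big1 // => i _; rewrite !mxE eqxx; case: i => [[|[|[]]]] //= ?; rewrite mulr0 addr0.
apply/is_trig_mxP => i j ij; rewrite !mxE.
have -> : (j == i) = false by rewrite gt_eqF.
case: i ij => [[|[|[]]]] // ?; case: j => [[|[|[]]]] // ? _ /=; rewrite ?mulr0 ?addr0 //.
Qed.

Lemma covariant_transv01 t : covariant (transv 0 1 t).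
Proof.
move=> a sa; exists [seq evalp (a ++ [:: t]) q | q <- transv_subst].
rewrite !det_transv01 (semi_invariantP _ aronholdS_transv sa) (semi_invariantP _
  aronholdT_transv sa).
have one : evalm (a ++ [:: t]) (nseq 11 0%N) = 1.
  by apply: big1 => k _; rewrite nth_nseq if_same.
split=> //; last 2 first.
- by rewrite one expr1n.
- by rewrite one expr1n.
move=> v; rewrite !cubic_atE !mulmx3E !mxE /= !mulr0 !addr0 !mulr1 !add0r !mul1r.
have [a0 [a1 [a2 [a3 [a4 [a5 [a6 [a7 [a8 [a9 ->]]]]]]]]]] := seq10P sa.
rewrite /= !(evalp_cons, evalp_nil, evalm_cons, evalm_nil) /=.
rewrite -[(int_of_Z 1)%:~R]/(1 : K) -[(int_of_Z 2)%:~R]/(2 : K) -[(int_of_Z 3)%:~R]/(3 : K).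
ring.
Qed.

Lemma covariant_diag (d : 'rV[K]_3) : covariant (diag_mx d).
Proof.
move=> a sa; pose y := [:: d 0 0; d 0 1; d 0 2].
exists [seq evalp (a ++ y) q | q <- diag_subst].
have dE : \det (diag_mx d) = d 0 0 * d 0 1 * d 0 2.
  rewrite det_diag !big_ord_recr big_ord0 /= mul1r.
  by congr (d 0 _ * d 0 _ * d 0 _); exact: val_inj.
have mE n : evalm (a ++ y) (nseq 10 0 ++ [:: n; n; n])%N = \det (diag_mx d) ^+ n.
  rewrite evalm_cat sa drop_size_cat ?size_nseq // /y !evalm_cons evalm_nil dE.
  rewrite /evalm big1 => [|k _]; last by rewrite nth_cat size_nseq -sa ltn_ord nth_nseq if_same.
  by rewrite !exprMn; ring.
rewrite (semi_invariantP _ aronholdS_diag sa) (semi_invariantP _ aronholdT_diag sa) !mE.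
split=> // v; rewrite !cubic_atE !mulmx3E !mxE /= !mulr0n !mulr1n !mul0r !addr0 !add0r.
rewrite /y; have [a0 [a1 [a2 [a3 [a4 [a5 [a6 [a7 [a8 [a9 ->]]]]]]]]]] := seq10P sa.
rewrite /= !(evalp_cons, evalp_nil, evalm_cons, evalm_nil) /=.
rewrite -[(int_of_Z 1)%:~R]/(1 : K).
ring.
Qed.

Lemma covariant_swap (i j : 'I_3) s : i != j -> s \in [:: swap01; swap02; swap12] ->
  (forall a v, size a = 10%N ->
    cubic_at a (tperm_mx i j *m v) = cubic_at [seq a`_k | k <- s] v) ->
  covariant (tperm_mx i j : 'M[K]_3).
Proof.
move=> ij hs sE a sa; have /andP[hS hT] := aronhold_swap hs.
have bE : [seq evalp (a ++ [::]) q | q <- perm_subst s] = [seq a`_k | k <- s].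
  rewrite cats0 -map_comp; have s10 : all (fun k => k < 10)%N s.
    by move: hs; rewrite !inE => /or3P[] /eqP->.
  elim: s s10 {hs sE hS hT} => [//|k s IH] /= /andP[k10 /IH->]; congr (_ :: _).
  rewrite evalp_cons evalp_nil addr0 -[(int_of_Z _)%:~R]/(1 : K) mul1r /evalm sa.
  rewrite (bigD1 (Ordinal k10)) //= big1 ?mulr1.
    by rewrite nth_set_nth /= eqxx expr1.
  move=> l; rewrite -val_eqE /= => /negbTE lk.
  by rewrite nth_set_nth /= lk -[_ :: _]/(nseq 10 0%N) nth_nseq if_same.
have one : evalm (a ++ [::]) (nseq 10 0%N) = 1.
  by apply: big1 => k _; rewrite nth_nseq if_same.
exists [seq a`_k | k <- s].
rewrite -{3 4}bE (semi_invariantP _ hS sa) (semi_invariantP _ hT sa) one.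
rewrite det_perm odd_tperm ij expr1 !exprS expr0 !mulN1r !opprK.
split; [|by move=> v; apply: sE|by []|by []].
by rewrite size_map; move: hs; rewrite !inE => /or3P[] /eqP->.
Qed.

Lemma covariant_tperm (i j : 'I_3) : i != j -> covariant (tperm_mx i j : 'M[K]_3).
Proof.
have pE (k l m : 'I_3) v : (tperm_mx k l *m v) m 0 = v (tperm k l m) 0.
  by rewrite -row_permE mxE.
have t (k l m : 'I_3) : tperm k l m = if m == k then l else if m == l then k else m.
  by case: tpermP => [->|->|/eqP/negbTE-> /eqP/negbTE->] //; rewrite ?eqxx //; case: eqP.
have swap (k l : 'I_3) := @covariant_swap k l.
have c01 : covariant (tperm_mx 0 1).
  by apply: (swap _ _ swap01) => // a v sa; rewrite !cubic_atE !pE !t /=; ring.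
have c02 : covariant (tperm_mx 0 2).
  by apply: (swap _ _ swap02) => // a v sa; rewrite !cubic_atE !pE !t /=; ring.
have c12 : covariant (tperm_mx 1 2).
  by apply: (swap _ _ swap12) => // a v sa; rewrite !cubic_atE !pE !t /=; ring.
wlog ij : i j / (i < j)%N => [wl|].
  case: (ltngtP i j) => [/wl//|ji|/val_inj ->]; last by rewrite eqxx.
  by rewrite /tperm_mx tpermC eq_sym; apply: wl.
by move: i j ij; do 2!apply: ord3P => //.
Qed.

Lemma covariant1 : covariant 1%:M.
Proof.
move=> a sa; exists a; rewrite det1 !expr1n !mul1r; split=> // v; by rewrite mul1mx.
Qed.

Lemma covariant_perm (s : 'S_3) : covariant (perm_mx s).
Proof.
have [ts -> /allP ds] := prod_tpermP s.
elim: ts ds => [|t ts IH] ds; first by rewrite big_nil perm_mx1; exact: covariant1.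
rewrite big_cons perm_mxM; apply: covariantM.
  by apply: covariant_tperm; apply: ds; rewrite mem_head.
by apply: IH => x xt; apply: ds; rewrite inE xt orbT.
Qed.

(** Every transvection is conjugate to the one just treated by a permutation
    of the coordinates. *)
Lemma covariant_transv (i j : 'I_3) t : i != j -> covariant (transv i j t).
Proof.
move=> ij.
have [s [si sj]] : exists s : 'S_3, s i = 0 /\ s j = 1.
  exists (tperm i 0%R * tperm (tperm i 0%R j) 1%R)%g; rewrite !permM !tpermL; split=> //.
  apply: tpermD => //.
  by apply: contra_neq ij => E; apply: (@perm_inj _ (tperm i 0)); rewrite tpermL E.
suff -> : transv i j t = perm_mx s *m transv 0 1 t *m perm_mx (s^-1)%g.
  exact: (covariantM (covariantM (covariant_perm _) (covariant_transv01 _))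
    (covariant_perm _)).
rewrite -row_permE -[s in perm_mx s^-1]invgK -col_permE; apply/matrixP => k l.
rewrite !mxE invgK -si -sj !(inj_eq perm_inj) //.
Qed.

Lemma transv_mulE i j t M k l :
  (transv i j t *m M) k l = M k l + (k == i)%:R * (t * M j l).
Proof.
rewrite mulmxDl mul1mx -scalemxAl !mxE (bigD1 j) //= big1 ?addr0 => [|m mj].
  by rewrite mxE eqxx andbT mulrCA.
by rewrite mxE (negbTE mj) andbF mul0r.
Qed.

Lemma lup_decomposition n (A : 'M[K]_n.+1) : exists P L U : 'M[K]_n.+1,
  [/\ is_perm_mx P, P *m A = L *m U,
      forall i j : 'I_n.+1, (i <= j)%N -> L i j = (i == j)%:R &
      forall i j : 'I_n.+1, (j < i)%N -> U i j = 0].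
Proof.
exists (cormen_lup A).1.1, (cormen_lup A).1.2, (cormen_lup A).2.
split; [exact: cormen_lup_perm| |exact: cormen_lup_lower|exact: cormen_lup_upper].
by have := cormen_lup_correct A; case: (cormen_lup A) => [[P L] U].
Qed.

(** By the LUP decomposition, the invertible matrices are generated by
    permutation matrices, transvections and diagonal matrices. *)
Lemma covariant_unit M : M \in unitmx -> covariant M.
Proof.
move=> uM.
have [P [L [U [/is_perm_mxP[s Ps] PLU lowL upU]]]] := lup_decomposition M.
have ME : M = perm_mx (s^-1)%g *m (L *m U).
  rewrite -PLU Ps mulmxA -perm_mxM mulVg perm_mx1 mul1mx //.
rewrite ME; apply: covariantM; first exact: covariant_perm.
have uU : forall j, U j j != 0.
  have : \det (L *m U) != 0.
    by rewrite -PLU det_mulmx mulf_neq0 //; [rewrite Ps det_perm signr_eq0|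
      rewrite -unitfE -unitmxE].
  rewrite det_mulmx mulf_eq0 negb_or => /andP[_].
  rewrite -det_tr det_trig.
    by move/prodf_neq0 => H j; have := H j isT; rewrite mxE.
  by apply/is_trig_mxP => i j ij; rewrite mxE upU.
have [L00 L11 L22] : [/\ L 0 0 = 1, L 1 1 = 1 & L 2 2 = 1] by rewrite !lowL.
have [L01 L02 L12] : [/\ L 0 1 = 0, L 0 2 = 0 & L 1 2 = 0] by rewrite !lowL.
have [U10 U20 U21] : [/\ U 1 0 = 0, U 2 0 = 0 & U 2 1 = 0] by rewrite !upU.
apply: covariantM.
  have -> : L = transv 1 0 (L 1 0) *m (transv 2 0 (L 2 0) *m transv 2 1 (L 2 1)).
    by apply/matrixP; do 2!apply: ord3P;
      rewrite !transv_mulE !mxE /= ?L00 ?L11 ?L22 ?L01 ?L02 ?L12; ring.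
  apply: covariantM; first exact: covariant_transv.
  by apply: covariantM; exact: covariant_transv.
have [x xE] : exists x, U 1 2 = x * U 2 2 by exists (U 1 2 / U 2 2); rewrite divfK.
have [y yE] : exists y, U 0 2 = y * U 2 2 by exists (U 0 2 / U 2 2); rewrite divfK.
have [z zE] : exists z, U 0 1 = z * U 1 1 by exists (U 0 1 / U 1 1); rewrite divfK.
have -> : U = transv 1 2 x *m (transv 0 2 y *m (transv 0 1 z *m diag_mx (\row_j U j j))).
  by apply/matrixP; do 2!apply: ord3P;
    rewrite !transv_mulE !mxE /= ?U10 ?U20 ?U21 ?xE ?yE ?zE; ring.
do 2!(apply: covariantM; first exact: covariant_transv).
by apply: covariantM; [exact: covariant_transv|exact: covariant_diag].
Qed.

End Covariance.

(** * The j-invariant in terms of S and T *)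

Definition A3pt (i j : nat) (hi : (i < 4)%N) (hj : (j < 4)%N)
  (hij : (i + j <= 3)%N) : A3 := exist _ (Ordinal hi, Ordinal hj) hij.

Definition lattice_points : seq A3 :=
  [:: @A3pt 0 0 isT isT isT; @A3pt 1 0 isT isT isT; @A3pt 2 0 isT isT isT;
      @A3pt 3 0 isT isT isT; @A3pt 2 1 isT isT isT; @A3pt 1 2 isT isT isT;
      @A3pt 0 3 isT isT isT; @A3pt 0 2 isT isT isT; @A3pt 0 1 isT isT isT;
      @A3pt 1 1 isT isT isT].

Definition latpt (k : nat) : A3 := nth (@A3pt 1 1 isT isT isT) lattice_points k.

Lemma latptE k : (k < 10)%N -> xdeg (latpt k) = latx k /\ ydeg (latpt k) = laty k.
Proof. by do 10! [case: k => [|k] //]. Qed.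

Lemma mem_lattice_points w : w \in lattice_points.
Proof.
case: w => -[[i hi] [j hj]] /= hij.
have -> : exist _ (Ordinal hi, Ordinal hj) hij = A3pt hi hj hij :> A3 by [].
case: i hi hij => [|[|[|[|]]]] //; case: j hj => [|[|[|[|]]]] // hj hi hij;
  by rewrite !inE -!val_eqE /= -!(inj_eq val_inj) /= ?eqxx ?orbT.
Qed.

Lemma latpt_surj w : exists2 k, (k < 10)%N & w = latpt k.
Proof.
exists (index w lattice_points); first by rewrite -[10%N]/(size lattice_points) index_mem
  mem_lattice_points.
by rewrite /latpt nth_index // mem_lattice_points.
Qed.

Lemma latpt_inj k l : (k < 10)%N -> (l < 10)%N -> latpt k = latpt l -> k = l.
Proof. by move=> hk hl /eqP; rewrite nth_uniq // => /eqP. Qed.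

Lemma sum_lattice (V : nmodType) (F : A3 -> V) (P : pred A3) :
  \sum_(w | P w) F w = \sum_(0 <= k < 10 | P (latpt k)) F (latpt k).
Proof.
rewrite -(big_map latpt P F) -[LHS]big_filter -[RHS]big_filter.
apply: perm_big; apply: uniq_perm; rewrite ?filter_uniq ?index_enum_uniq //.
by move=> w; rewrite !mem_filter mem_index_enum -[map _ _]/lattice_points mem_lattice_points.
Qed.

Definition coefs (V : nmodType) (a : A3 -> V) : seq V :=
  [seq a (latpt k) | k <- iota 0 10].

Lemma coefsE (V : nmodType) (a : A3 -> V) k : (k < 10)%N ->
  (coefs a)`_k = a (latpt k).
Proof. by move=> k10; rewrite (nth_map 0%N) ?size_iota // nth_iota. Qed.

Lemma size_coefs (V : nmodType) (a : A3 -> V) : size (coefs a) = 10%N.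
Proof. by rewrite size_map size_iota. Qed.

Section Cubic.
Variable F : fieldType.
Implicit Types (a : A3 -> F) (v : 'I_3 -> F).

Definition col3 v : 'cV[F]_3 := \col_i v i.

Lemma cubic_form_eval a v : (cubic_form a).@[v] = cubic_at (coefs a) (col3 v).
Proof.
rewrite /cubic_form raddf_sum sum_lattice /cubic_at big_nat [RHS]big_nat.
apply: eq_bigr => k /andP[_ k10]; have [-> ->] := latptE k10.
rewrite coefsE //= mevalZ !mevalM !rmorphXn /= !mevalXU !mxE.
by congr (_ * (_ * _ * _)).
Qed.

Lemma linear_change_eval (M : 'M[F]_3) f v :
  (linear_change M f).@[v] = f.@[fun i => (M *m col3 v) i 0].
Proof.
rewrite /linear_change comp_mpoly_meval; apply: meval_eq => i.
rewrite tnth_mktuple raddf_sum mxE; apply: eq_bigr => l _.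
by rewrite /= mevalZ mevalXU mxE.
Qed.

Definition weierstrass_coefs (c p q : F) : seq F :=
  [:: - c * q; - c * p; 0; - c; 0; 0; 0; c; 0; 0].

Lemma weierstrass_eval c p q v :
  (c *: weierstrass_form p q).@[v] = cubic_at (weierstrass_coefs c p q) (col3 v).
Proof.
rewrite /weierstrass_form cubic_atE /= !mxE.
rewrite mevalZ !mevalB !mevalZ !mevalM ?rmorphXn /= !mevalXU.
by ring.
Qed.

Hypothesis char0 : [pchar F] =i pred0.

(** The ten coefficients can be recovered from the values at points with
    coordinates 0, 1 or -1, since 2 is invertible. *)
Lemma cubic_at_inj (a b : seq F) : size a = 10%N -> size b = 10%N ->
  (forall v, cubic_at a (col3 v) = cubic_at b (col3 v)) -> a = b.
Proof.
move=> sa sb ab.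
have two : 2 != 0 :> F by rewrite (pcharf0P _).1.
have [a0 [a1 [a2 [a3 [a4 [a5 [a6 [a7 [a8 [a9 aE]]]]]]]]]] := seq10P sa.
have [b0 [b1 [b2 [b3 [b4 [b5 [b6 [b7 [b8 [b9 bE]]]]]]]]]] := seq10P sb.
pose v (x y z : F) (i : 'I_3) : F := if i == 0 then x else if i == 1 then y else z.
pose f (x y z : F) : F := (a0 - b0) * z ^+ 3 + (a1 - b1) * (x * z ^+ 2) +
  (a2 - b2) * (x ^+ 2 * z) + (a3 - b3) * x ^+ 3 + (a4 - b4) * (x ^+ 2 * y) +
  (a5 - b5) * (x * y ^+ 2) + (a6 - b6) * y ^+ 3 + (a7 - b7) * (y ^+ 2 * z) +
  (a8 - b8) * (y * z ^+ 2) + (a9 - b9) * (x * y * z).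
have f0 x y z : f x y z = 0.
  have /eqP := ab (v x y z); rewrite -subr_eq0 => /eqP <-.
  by rewrite !cubic_atE !mxE /v /= aE bE /= /f; ring.
have z3 : a3 - b3 = 0 by rewrite -(f0 1 0 0) /f; ring.
have z6 : a6 - b6 = 0 by rewrite -(f0 0 1 0) /f; ring.
have z0 : a0 - b0 = 0 by rewrite -(f0 0 0 1) /f; ring.
have half (x : F) : 2 * x = 0 -> x = 0.
  by move/eqP; rewrite mulf_eq0 (negbTE two) => /eqP.
have z4 : a4 - b4 = 0.
  by apply: half; rewrite -[RHS](_ : f 1 1 0 - f 1 (-1) 0 = 0);
    last (by rewrite !f0 subrr); rewrite /f z3 z6; ring.
have z8 : a8 - b8 = 0.
  by apply: half; rewrite -[RHS](_ : f 0 1 1 - f 0 (-1) 1 = 0);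
    last (by rewrite !f0 subrr); rewrite /f z0 z6; ring.
have z1 : a1 - b1 = 0.
  by apply: half; rewrite -[RHS](_ : f 1 0 1 - f (-1) 0 1 = 0);
    last (by rewrite !f0 subrr); rewrite /f z0 z3; ring.
have z5 : a5 - b5 = 0 by rewrite -(f0 1 1 0) /f z3 z6 z4; ring.
have z7 : a7 - b7 = 0 by rewrite -(f0 0 1 1) /f z0 z6 z8; ring.
have z2 : a2 - b2 = 0 by rewrite -(f0 1 0 1) /f z0 z3 z1; ring.
have z9 : a9 - b9 = 0.
  by rewrite -(f0 1 1 1) /f z0 z1 z2 z3 z4 z5 z6 z7 z8; ring.
rewrite aE bE (subr0_eq z0) (subr0_eq z1) (subr0_eq z2) (subr0_eq z3) (subr0_eq z4).
by rewrite (subr0_eq z5) (subr0_eq z6) (subr0_eq z7) (subr0_eq z8) (subr0_eq z9).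
Qed.

Definition weierstrass_subst : seq spoly :=
  [:: [:: ([:: 1; 0; 1]%N, (-1)%ZZ)]; [:: ([:: 1; 1; 0]%N, (-1)%ZZ)]; [::];
      [:: ([:: 1; 0; 0]%N, (-1)%ZZ)]; [::]; [::]; [::];
      [:: ([:: 1; 0; 0]%N, 1%ZZ)]; [::]; [::]].

(** These are the classical c_4 = -48 p and c_6 = -864 q of y^2 = x^3 + p x +
    q, up to the sign of the latter. *)
Lemma weierstrass_aronhold c p q :
  evalp (weierstrass_coefs c p q) aronholdS = - (48 * (c ^+ 4 * p)) /\
  evalp (weierstrass_coefs c p q) aronholdT = 864 * (c ^+ 6 * q).
Proof.
have -> : weierstrass_coefs c p q = [seq evalp [:: c; p; q] r | r <- weierstrass_subst].
  rewrite /= !(evalp_cons, evalp_nil, evalm_cons, evalm_nil) /=.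
  rewrite -[(int_of_Z 1)%:~R]/(1 : F) -[(int_of_Z (-1))%:~R]/(-1 : F).
  by rewrite /weierstrass_coefs; congr [:: _; _; _; _; _; _; _; _; _; _]; ring.
rewrite (@psubst_eqP _ _ _ _ [:: ([:: 4; 1; 0]%N, (-48)%ZZ)]) //.
rewrite (@psubst_eqP _ _ _ _ [:: ([:: 6; 0; 1]%N, 864%ZZ)]) //.
rewrite !(evalp_cons, evalp_nil, evalm_cons, evalm_nil) /=.
rewrite -[(int_of_Z (-48))%:~R]/(-(48) : F) -[(int_of_Z 864)%:~R]/(864 : F).
by split; ring.
Qed.

(** Covariance transports S and T to the Weierstrass form, where S^3 - T^2 is
    -(16 * 1728) (4 p^3 + 27 q^2) and S^3 is -(48 p)^3, up to powers of c; the
    determinant enters both with exponent 12 and cancels. *)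
Lemma j_invariant_disc a j : is_j_invariant a j ->
  evalp (coefs a) cubic_disc != 0 /\
  j * evalp (coefs a) cubic_disc = 1728 * evalp (coefs a) aronholdS ^+ 3.
Proof.
case=> M [c [p [q [uM c0 d0 chg ->]]]].
have sa := size_coefs a.
have [b [sb bE bS bT]] := covariant_unit uM sa.
have {bE}bW : b = weierstrass_coefs c p q.
  apply: cubic_at_inj => // v; rewrite -bE -weierstrass_eval -chg.
  rewrite linear_change_eval cubic_form_eval; congr cubic_at.
  by apply/matrixP => i k; rewrite [RHS]mxE ord1.
have [wS wT] := weierstrass_aronhold c p q.
move: bS bT; rewrite bW wS wT => bS bT.
have dM : \det M != 0 by rewrite -unitfE -unitmxE.
have nat0 n : (n.+1%:R : F) != 0 by rewrite (pcharf0P _).1.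
move: (evalp_disc (coefs a)) bS bT dM.
(* From here on only the values of S, T and S^3 - T^2 matter. *)
generalize (evalp (coefs a) cubic_disc) (evalp (coefs a) aronholdS) (evalp (coefs a)
  aronholdT) (\det M).
move=> dd s t d ddE bS bT dM.
have discE : d ^+ 12 * dd = - (16 * 1728) * (c ^+ 12 * (4 * p ^+ 3 + 27 * q ^+ 2)).
  transitivity ((d ^+ 4 * s) ^+ 3 - (d ^+ 6 * t) ^+ 2); first by rewrite ddE; ring.
  by rewrite -bS -bT; ring.
have d12 : d ^+ 12 != 0 by rewrite expf_neq0.
have dd0 : dd != 0.
  have : d ^+ 12 * dd != 0.
    by rewrite discE !mulf_neq0 // ?expf_neq0 // oppr_eq0 mulf_neq0.
  by rewrite mulf_eq0 negb_or => /andP[].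
split=> //; apply: (mulfI d12); rewrite mulrCA discE.
have -> : d ^+ 12 * (1728 * s ^+ 3) = 1728 * (d ^+ 4 * s) ^+ 3 by ring.
by rewrite -bS; field.
Qed.

End Cubic.

(** * Generic and Puiseux valuations *)

Lemma digits_inj B n (f g : nat -> nat) :
  (forall i, (i < n)%N -> (f i < B)%N) -> (forall i, (i < n)%N -> (g i < B)%N) ->
  (\sum_(i < n) f i * B ^ i = \sum_(i < n) g i * B ^ i)%N ->
  forall i, (i < n)%N -> f i = g i.
Proof.
elim: n f g => [//|n IH] f g fB gB.
have step (h : nat -> nat) : (\sum_(i < n.+1) h i * B ^ i =
    (\sum_(i < n) h i.+1 * B ^ i) * B + h 0)%N.
  rewrite big_ord_recl expn0 muln1 addnC; congr (_ + _)%N.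
  by rewrite big_distrl; apply: eq_bigr => i _; rewrite /= expnSr mulnA.
rewrite !step => E; have B0 : (0 < B)%N by apply: leq_ltn_trans (fB 0%N isT).
have E0 : f 0%N = g 0%N.
  by have := congr1 (modn^~ B) E; rewrite !modnMDl !modn_small ?fB ?gB.
move/eqP: E; rewrite E0 eqn_add2r eqn_pmul2r // => /eqP E.
case=> [//|i]; rewrite ltnS => hi; apply: (IH (fun i => f i.+1) (fun i => g i.+1)) => //.
- by move=> k kn; apply: fB.
- by move=> k kn; apply: gB.
Qed.

Lemma poly_rat_eq0 (p : {poly rat}) : (forall q, p.[q] = 0) -> p = 0.
Proof.
move=> p0; apply/eqP; apply: contraT => pn0.
have := @max_poly_roots _ p [seq n%:R | n <- iota 0 (size p)] pn0.
rewrite size_map size_iota ltnn; apply.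
  by apply/allP => x _; rewrite /root p0.
by rewrite map_inj_uniq ?iota_uniq // => i j /eqP; rewrite eqr_nat => /eqP.
Qed.

Lemma kronecker_inj B n (m m' : 'X_{1..n}) :
  (forall i, m i < B)%N -> (forall i, m' i < B)%N ->
  (\sum_(i < n) m i * B ^ i = \sum_(i < n) m' i * B ^ i)%N -> m = m'.
Proof.
case: n m m' => [|n] m m' mB m'B E; apply/mnmP => i; first by case: i.
have := @digits_inj B n.+1 (fun j => m (inord j)) (fun j => m' (inord j)).
have inE (k : 'X_{1..n.+1}) :
    (\sum_(j < n.+1) k (inord j) * B ^ j = \sum_(j < n.+1) k j * B ^ j)%N.
  by apply: eq_bigr => j _; rewrite inord_val.
by rewrite !inE => /(_ _ _ E i); rewrite inord_val; apply=> // j _.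
Qed.

(** Kronecker substitution a_i = q^(B^i), with [B] larger than all exponents,
    sends distinct monomials to distinct powers of q. The resulting univariate
    polynomial vanishes at every rational number. *)
Lemma mpoly_eval0 (K : fieldType) (f : {rmorphism rat -> K}) n (h : {mpoly rat[n]}) :
  (forall a : 'I_n -> K, mmap f a h = 0) -> h = 0.
Proof.
move=> h0; apply: contrapT => /eqP hn0.
pose B := msize h; pose e (m : 'X_{1..n}) := (\sum_(i < n) m i * B ^ i)%N.
pose P : {poly rat} := \sum_(m <- msupp h) h@_m *: 'X^(e m).
have : P = 0.
  apply: poly_rat_eq0 => q.
  apply: (fmorph_inj f); rewrite rmorph0 -(h0 (fun i => f (q ^+ (B ^ i)))) /mmap.
  rewrite /P horner_sum rmorph_sum; apply: eq_bigr => m _.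
  rewrite hornerZ hornerXn rmorphM; congr (_ * _).
  rewrite /e expr_sum rmorph_prod; apply: eq_bigr => i _.
  by rewrite mulnC exprM rmorphXn.
move/polyP/(_ (e (mlead h))); rewrite coef0 coef_sum (bigD1_seq (mlead h)) ?mlead_supp //=.
rewrite coefZ coefXn eqxx mulr1 big1_seq ?addr0 => [|m /andP[mh ms]].
  by move/eqP; rewrite mleadc_eq0 (negbTE hn0).
rewrite coefZ coefXn; case: eqP; rewrite ?mulr0 // => /esym E; case/eqP: mh.
have lt (m' : 'X_{1..n}) : m' \in msupp h -> forall j, (m' j < B)%N.
  move=> /msize_mdeg_lt; rewrite -/B => lt j; apply: leq_ltn_trans lt.
  by rewrite mdegE (bigD1 j) //= leq_addr.
by apply: (kronecker_inj (B := B)) => //; apply: lt; rewrite ?mlead_supp.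
Qed.

Section Gval.
Variables (R : realType) (u : A3 -> R).
Implicit Types (p q : {mpoly rat[#|A3|]}) (m : 'X_{1..#|A3|}).
Local Notation wt := (mnm_weight u).

Lemma mnm_weightD m1 m2 : wt (m1 + m2)%MM = wt m1 + wt m2.
Proof.
by rewrite -big_split; apply: eq_bigr => k _; rewrite mnmDE natrD mulrDr.
Qed.

Lemma bigmin_seq (T : eqType) (F : T -> R) x0 (s : seq T) :
  let b := \big[Num.min/x0]_(t <- s) F t in
  (b = x0 \/ exists2 t, t \in s & b = F t) /\ (forall t, t \in s -> b <= F t).
Proof.
elim: s => [|t s [IHe IHle]] /=; first by rewrite big_nil; split; [left|].
rewrite big_cons; move: IHe IHle; set b := \big[_/_]_(t <- s) F t => IHe IHle; split.
  have [_|_] := leP (F t) b; first by right; exists t; rewrite ?mem_head.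
  by case: IHe => [->|[s' s's ->]]; [left|right; exists s'; rewrite ?inE ?s's ?orbT].
move=> s'; rewrite inE => /predU1P[->|/IHle]; first by rewrite ge_min lexx.
by rewrite ge_min => ->; rewrite orbT.
Qed.

Lemma gval_le p m : m \in msupp p -> gval u p <= wt m.
Proof. by move=> mp; apply: (bigmin_seq wt (wt (mlead p)) (msupp p)).2. Qed.

Lemma gval_attained p : p != 0 -> exists2 m, m \in msupp p & gval u p = wt m.
Proof.
move=> p0; have [+ _] := bigmin_seq wt (wt (mlead p)) (msupp p).
by case=> [E|//]; exists (mlead p); rewrite ?mlead_supp.
Qed.

Lemma le_gval p r : p != 0 -> (forall m, m \in msupp p -> r <= wt m) -> r <= gval u p.
Proof. by move=> /gval_attained[m mp ->]; apply. Qed.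

Definition initial_form p : {mpoly rat[#|A3|]} :=
  \sum_(m <- msupp p | wt m == gval u p) p@_m *: 'X_[m].

Lemma initial_form_coef p m :
  (initial_form p)@_m = if wt m == gval u p then p@_m else 0.
Proof.
rewrite /initial_form raddf_sum /=.
under eq_bigr do rewrite mcoeffZ mcoeffX.
have [mp|/memN_msupp_eq0 mp] := boolP (m \in msupp p); last first.
  rewrite mp if_same big1 // => m' _; case: eqP => [->|]; rewrite ?mulr0 //.
  by rewrite mp mul0r.
rewrite big_mkcond (bigD1_seq m) //= big1 ?addr0 ?eqxx ?mulr1 // => m' /negbTE->.
by rewrite mulr0 if_same.
Qed.

Lemma initial_form_supp p m : m \in msupp (initial_form p) -> wt m = gval u p.
Proof.
by rewrite mcoeff_msupp initial_form_coef; case: (wt m =P gval u p) => // _; rewrite eqxx.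
Qed.

Lemma initial_form_neq0 p : p != 0 -> initial_form p != 0.
Proof.
move=> /gval_attained[m mp E]; apply/eqP => /(congr1 (mcoeff m)).
rewrite initial_form_coef E eqxx mcoeff0 => /eqP.
by rewrite mcoeff_eq0 mp.
Qed.

Lemma rest_supp p m : m \in msupp (p - initial_form p) -> gval u p < wt m.
Proof.
rewrite mcoeff_msupp mcoeffB initial_form_coef lt_neqAle [gval u p == _]eq_sym.
case: (wt m =P gval u p) => _; rewrite ?subrr ?eqxx // subr0 => h /=.
by apply: gval_le; rewrite mcoeff_msupp.
Qed.

Lemma msuppM_ex p q m : (p * q)@_m != 0 ->
  exists m1 m2, [/\ m1 \in msupp p, m2 \in msupp q & m = (m1 + m2)%MM].
Proof.
rewrite -mcoeff_msupp => /msuppM_le /allpairsP[[m1 m2] [? ? ->]].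
by exists m1, m2.
Qed.

(** The initial forms have a nonzero product, and each of its monomials
    survives in the product of the two polynomials since all other
    contributions have larger weight. *)
Lemma gvalM p q : p != 0 -> q != 0 -> gval u (p * q) = gval u p + gval u q.
Proof.
move=> p0 q0; have pq0 : p * q != 0 by rewrite mulf_neq0.
apply/eqP; rewrite eq_le; apply/andP; split; last first.
  apply: le_gval => // m; rewrite mcoeff_msupp => /msuppM_ex[m1 [m2 [s1 s2 ->]]].
  by rewrite mnm_weightD lerD // gval_le.
pose f := initial_form p; pose g := initial_form q.
have fg0 : f * g != 0 by rewrite mulf_neq0 // initial_form_neq0.
have := mlead_supp fg0; set m := mlead _; rewrite mcoeff_msupp => fgm.
have [m1 [m2 [s1 s2 mE]]] := msuppM_ex fgm.
have wE : wt m = gval u p + gval u q.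
  by rewrite mE mnm_weightD (initial_form_supp s1) (initial_form_supp s2).
rewrite -wE; apply: gval_le; rewrite mcoeff_msupp.
have -> : p * q = f * g + f * (q - g) + (p - f) * q by ring.
have z1 : (f * (q - g))@_m = 0.
  apply/eqP; apply: contraT => /msuppM_ex[a [b [sa sb E]]].
  by have := rest_supp sb; rewrite -(ltrD2l (wt a)) -mnm_weightD -E wE
    (initial_form_supp sa) ltxx.
have z2 : ((p - f) * q)@_m = 0.
  apply/eqP; apply: contraT => /msuppM_ex[a [b [sa sb E]]].
  have := ltr_leD (rest_supp sa) (gval_le sb).
  by rewrite -mnm_weightD -E wE ltxx.
by rewrite !mcoeffD z1 z2 !addr0.
Qed.

Lemma gval_valuation : is_valuation (gval u).
Proof.
split; first exact: gvalM.
- move=> p q p0 q0 pq0; apply: le_gval => // m /msuppD_le.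
  by rewrite mem_cat ge_min => /orP[] /gval_le ->; rewrite ?orbT.
- move=> z z0; have zE : z%:~R = (z%:~R)%:MP :> {mpoly rat[#|A3|]} by rewrite rmorph_int.
  have zn0 : z%:~R != 0 :> rat by rewrite intr_eq0.
  have s0 : msupp (z%:~R : {mpoly rat[#|A3|]}) = [:: 0%MM] by rewrite zE msuppC (negbTE zn0).
  have n0 : z%:~R != 0 :> {mpoly rat[#|A3|]} by rewrite -msupp_eq0 s0.
  split=> //; have [m] := gval_attained n0; rewrite s0 inE => /eqP-> ->.
  by apply: big1 => k _; rewrite mnm0E mulr0.
Qed.

End Gval.

Section Pval.
Variable F : fieldType.
Hypothesis char0 : [pchar F] =i pred0.
Variable R : realType.

Definition rpval (f : puiseux F) : R := ratr (pval f).

Lemma pvalE (f : puiseux F) q : f q != 0 -> (forall r, f r != 0 -> q <= r) -> pval f = q.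
Proof.
move=> fq hq; have fn0 : f != 0 by apply: contraNneq fq => ->.
have [fp hp] := pvalP fn0.
by apply/eqP; rewrite eq_le hp // hq.
Qed.

Lemma puiseux_mulE (f g : puiseux F) q : (f * g) q = puiseux_mulf f g q.
Proof. by []. Qed.

(** In a product of series, the coefficient at the sum of the two lowest
    exponents is a single product of nonzero coefficients. *)
Lemma rpval_valuation : is_valuation rpval.
Proof.
have aux1 (T : Type) (a b r : rat) : b <= a + b - r -> a < r -> T.
  by move=> h1 h2; exfalso; lra.
have aux2 (T : Type) (a b q r : rat) : b <= q - r -> a <= r -> q < a + b -> T.
  by move=> h1 h2 h3; exfalso; lra.
split.
- move=> f g f0 g0; rewrite /rpval -rmorphD; congr ratr.
  have [fp hf] := pvalP f0; have [gp hg] := pvalP g0.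
  apply: pvalE.
    rewrite puiseux_mulE /puiseux_mulf (fsbigE [:: pval f]) //.
      rewrite big_cons big_nil in_setT /= addr0 addrC addKr mulf_neq0 //.
    move=> r _; rewrite inE => rf.
    have [->|fr] := eqVneq (f r) 0; first by rewrite mul0r.
    have lt_r : pval f < r by rewrite lt_neqAle eq_sym rf hf.
    have [->|gr] := eqVneq (g (pval f + pval g - r)) 0; first by rewrite mulr0.
    by move: (hg _ gr) lt_r; apply: aux1.
  move=> q; apply: contraR; rewrite -ltNge puiseux_mulE /puiseux_mulf => lt_q.
  apply/eqP; apply: fsbig1 => r _.
  have [->|fr] := eqVneq (f r) 0; first by rewrite mul0r.
  have [->|gr] := eqVneq (g (q - r)) 0; first by rewrite mulr0.
  by move: (hg _ gr) (hf _ fr) lt_q; apply: aux2.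
- move=> f g f0 g0 fg0; rewrite /rpval -minr_rat ler_rat.
  have [fg _] := pvalP fg0.
  have : f (pval (f + g)) != 0 \/ g (pval (f + g)) != 0.
    apply: contrapT => /not_orP[/negP/negPn/eqP E1 /negP/negPn/eqP E2].
    case/negP: fg; apply/eqP; rewrite -[LHS]/(f (pval (f + g)) + g (pval (f + g))).
    by rewrite E1 E2 addr0.
  have [_ hf] := pvalP f0; have [_ hg] := pvalP g0.
  by case=> [/hf|/hg]; rewrite ge_min => ->; rewrite ?orbT.
- move=> z z0.
  have zE : z%:~R = puiseuxC (z%:~R : F) by rewrite rmorph_int.
  have zn0 : z%:~R != 0 :> F .
    clear zE; case: z z0 => n n0; first by rewrite -pmulrn ((pcharf0P F).1 char0).
    by rewrite NegzE mulrNz oppr_eq0 -[_%:~R]/(n.+1%:R) ((pcharf0P F).1 char0).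
  have c0 : (z%:~R : puiseux F) 0 != 0 by rewrite zE /= /puiseux_cstf eqxx.
  split; first by apply: contraNneq c0 => ->.
  rewrite /rpval (@pvalE _ 0) ?rmorph0 //.
  by move=> r; rewrite zE /= /puiseux_cstf; have [->|_] := eqVneq r 0; rewrite ?eqxx.
Qed.

End Pval.

(** * The j-fraction as an identity of polynomials *)

Lemma rmorph_evalp (K L : comNzRingType) (f : {rmorphism K -> L}) x p :
  f (evalp x p) = evalp [seq f y | y <- x] p.
Proof.
rewrite /evalp rmorph_sum; apply: eq_bigr => t _.
rewrite rmorphM rmorph_int /evalm size_map rmorph_prod; congr (_ * _).
by apply: eq_bigr => k _; rewrite rmorphXn (nth_map 0).
Qed.

(** The coefficients of the generic cubic, so that evaluating at them turns a
    table into a polynomial in the a_ij. *)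
Definition generic_coefs : seq {mpoly rat[#|A3|]} :=
  coefs (fun w => 'X_(enum_rank w)).

Lemma generic_coefsE k : (k < 10)%N ->
  generic_coefs`_k = 'X_(enum_rank (latpt k)).
Proof. exact: coefsE. Qed.

Section GenericNode.
Variables (R : realType) (u : A3 -> R).
Local Notation w := (fun k => u (latpt k)).

Lemma gvalX m : gval u ('X_[m] : {mpoly rat[#|A3|]}) = mnm_weight u m.
Proof.
have X0 : 'X_[m] != 0 :> {mpoly rat[#|A3|]} by rewrite -msupp_eq0 msuppX.
by have [m'] := gval_attained u X0; rewrite msuppX inE => /eqP->.
Qed.

Lemma gval_generic k : (k < 10)%N -> val_eq (gval u) generic_coefs`_k (w k).
Proof.
move=> k10; rewrite generic_coefsE //; split; first by rewrite -msupp_eq0 msuppX.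
rewrite gvalX /mnm_weight (bigD1 (enum_rank (latpt k))) //= big1.
  by rewrite mnm1E eqxx enum_rankK mulr1 addr0.
by move=> i ne; rewrite mnm1E eq_sym (negbTE ne) mulr0.
Qed.

Definition to_mnm (m : monomial) : 'X_{1..#|A3|} :=
  (\sum_(k < 10) U_(enum_rank (latpt k)) *+ nth 0%N m k)%MM.

Lemma size_generic : size generic_coefs = 10%N.
Proof. exact: size_coefs. Qed.

Lemma evalm_generic m : evalm generic_coefs m = 'X_[to_mnm m].
Proof.
rewrite /to_mnm -mprodXnE /evalm size_generic.
by apply: eq_bigr => k _; rewrite generic_coefsE.
Qed.

Lemma to_mnmE m k : (k < 10)%N -> to_mnm m (enum_rank (latpt k)) = nth 0%N m k.
Proof.
move=> k10; rewrite /to_mnm mnm_sumE (bigD1 (Ordinal k10)) //= big1.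
  by rewrite mulmnE mnm1E eqxx mul1n addn0.
move=> l; rewrite -val_eqE /= => lk; rewrite mulmnE mnm1E.
case: eqP => [/enum_rank_inj /latpt_inj E|//].
by rewrite E ?eqxx // in lk.
Qed.

Lemma to_mnm_inj m n : size m = 10%N -> size n = 10%N -> to_mnm m = to_mnm n -> m = n.
Proof.
move=> sm sn E; apply: (@eq_from_nth _ 0%N) => [|k]; rewrite ?sm ?sn // => k10.
by rewrite -!to_mnmE // E.
Qed.

(** Distinct monomials and nonzero coefficients: no cancellation occurs in the
    generic evaluation, so that the valuation is the minimum of all weights. *)
Definition reduced (p : spoly) : bool :=
  [&& uniq [seq t.1 | t <- p], all (fun t => size t.1 == 10%N) p &
      all (fun t => ~~ Z.eqb t.2 Z0) p].

Lemma gval_evalp p t0 : reduced p -> t0 \in p ->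
  all (fun t => weight w t0.1 <= weight w t.1) p ->
  val_eq (gval u) (evalp generic_coefs p) (weight w t0.1).
Proof.
case/and3P => up sp cp t0p min.
have coef : (evalp generic_coefs p)@_(to_mnm t0.1) != 0.
  rewrite /evalp raddf_sum /=.
  rewrite (eq_bigr (fun t => (int_of_Z t.2)%:~R * (to_mnm t.1 == to_mnm t0.1)%:R)); last first.
    move=> t _; rewrite evalm_generic.
    have -> : (int_of_Z t.2)%:~R = ((int_of_Z t.2)%:~R)%:MP :> {mpoly rat[#|A3|]}.
      by rewrite rmorph_int.
    by rewrite mcoeffCM mcoeffX.
  rewrite (bigD1_seq t0) ?(map_uniq up) //= eqxx mulr1 big1_seq ?addr0.
    rewrite intr_eq0; apply: contra (allP cp _ t0p) => /eqP E.
    by apply/Z.eqb_eq; apply: (can_inj int_of_ZK).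
  move=> t /andP[tt0 tp]; case: eqP => [E|]; rewrite ?mulr0 //.
  have E1 : t.1 = t0.1 by apply: to_mnm_inj E; apply/eqP; apply: (allP sp).
  case/eqP: tt0.
  have := uniqP (t.1) up (index t p) (index t0 p); rewrite !inE size_map !index_mem tp t0p.
  rewrite !(nth_map t) ?index_mem // !nth_index // => /(_ isT isT E1) I.
  by rewrite -(nth_index t tp) I nth_index.
have wt : mnm_weight u (to_mnm t0.1) = weight w t0.1.
  by rewrite -gvalX -evalm_generic; apply: (val_evalm (gval_valuation u) size_generic
    gval_generic _).2.
have n0 : evalp generic_coefs p != 0 by apply: contraNneq coef => ->; rewrite mcoeff0.
split=> //; apply/eqP; rewrite eq_le; apply/andP; split.
  by rewrite -wt; apply: gval_le; rewrite mcoeff_msupp.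
case: (val_evalp_ge (gval_valuation u) size_generic gval_generic min) => // /eqP.
by rewrite (negbTE n0).
Qed.

End GenericNode.

Lemma nodes_reduced : [&& reduced node0, reduced node3 & reduced node6].
Proof. by vm_compute. Qed.

Section Fermat.
Variable F : fieldType.
Hypothesis char0 : [pchar F] =i pred0.

(** A smooth cubic is needed to see that the discriminant is not the zero
    polynomial; x^3 + y^3 + z^3 = 0 is the simplest. *)
Definition fermat (w : A3) : F :=
  (w \in [:: latpt 0; latpt 3; latpt 6])%:R.

Lemma fermat_form : cubic_form fermat = 'X_0 ^+ 3 + 'X_1 ^+ 3 + 'X_2 ^+ 3.
Proof.
rewrite /cubic_form sum_lattice big_mkord !big_ord_recr big_ord0 /= /fermat.
rewrite !(scale0r, scale1r) /= !(expr0, mulr1, mul1r, addr0, add0r).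
by rewrite -addrA addrC.
Qed.

Lemma mderiv_cube (k l : 'I_3) (v : 'I_3 -> F) :
  (('X_l ^+ 3)^`M(k)).@[v] = if k == l then 3 * v k ^+ 2 else 0.
Proof.
have U0 (j : 'I_3) : (U_(j) - U_(j) = 0)%MM by apply/mnmP => i; rewrite mnmBE mnm0E subnn.
have dX : (('X_l : {mpoly F[3]})^`M(k)).@[v] = (k == l)%:R.
  rewrite mderivX mevalZ mnm1E eq_sym; case: eqP => [->|_]; last by rewrite mul0r.
  by rewrite U0 mpolyX0 meval1 mulr1.
rewrite !exprS expr0 mulr1 !mderivM !(mevalD, mevalM) dX mevalXU.
by case: eqP => [->|_] /=; ring.
Qed.

Lemma fermat_smooth : smooth_cubic fermat.
Proof.
have three : 3 != 0 :> F by rewrite ((pcharf0P F).1 char0).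
move=> v [k vk] _; exists k; rewrite fermat_form !mderivD !mevalD !mderiv_cube.
have -> : (if k == 0 then 3 * v k ^+ 2 else 0) + (if k == 1 then 3 * v k ^+ 2 else 0)
    + (if k == 2 then 3 * v k ^+ 2 else 0) = 3 * v k ^+ 2.
  by move: k {vk}; apply: ord3P; rewrite /= ?addr0 ?add0r.
by rewrite mulf_neq0 ?expf_neq0.
Qed.

End Fermat.

Section Algebra.
Variable R : realType.
Local Notation K := (puiseux R[i]).

(** The map [ratr] is multiplicative only in characteristic zero; factoring it
    through the constants makes it a ring morphism. *)
Definition puiseux_ratr : rat -> K := @puiseuxC R[i] \o ratr.
HB.instance Definition _ := GRing.RMorphism.on puiseux_ratr.

Lemma pchar_complex : [pchar R[i]] =i pred0.
Proof. exact: pchar_num. Qed.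

Lemma pchar_puiseux : [pchar K] =i pred0.
Proof. by move=> p; rewrite (fmorph_pchar (@puiseuxC R[i])) pchar_complex. Qed.

Lemma eval_coefE h (a : A3 -> K) :
  eval_coef h a = mmap puiseux_ratr (fun k => a (enum_val k)) h.
Proof.
by apply: eq_bigr => m _; rewrite -(fmorph_eq_rat puiseux_ratr).
Qed.

Lemma eval_coef_generic p (a : A3 -> K) :
  eval_coef (evalp generic_coefs p) a = evalp (coefs a) p.
Proof.
rewrite eval_coefE rmorph_evalp -map_comp; congr evalp; apply: eq_map => k /=.
by rewrite mmapX mmap1U enum_rankK.
Qed.

Variables (A D : {mpoly rat[#|A3|]}).
Hypothesis hAD : is_j_fraction K A D.

Lemma discriminant_neq0 : D != 0.
Proof.
have [_ [_ Dz] _] := hAD; apply/eqP => D0.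
have /Dz : eval_coef D (@fermat K) = 0 by rewrite D0 eval_coefE rmorph0.
by apply; apply: fermat_smooth pchar_puiseux.
Qed.

(** At smooth cubics the identity is the formula for the j-invariant.
    Multiplied by D it also holds at the singular ones, hence identically, and
    D is not zero. *)
Lemma j_fraction_eq :
  A * evalp generic_coefs cubic_disc = 1728 * evalp generic_coefs aronholdS ^+ 3 * D.
Proof.
have [_ [_ Dz] jAD] := hAD; apply/eqP; rewrite -subr_eq0.
rewrite -(inj_eq (mulfI discriminant_neq0)) mulr0; apply/eqP.
apply: (@mpoly_eval0 K puiseux_ratr) => a.
pose a' w := a (enum_rank w).
have aE h : mmap puiseux_ratr a h = eval_coef h a'.
  rewrite eval_coefE; apply: eq_bigr => m _; congr (_ * _); apply: mmap1_eq => k.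
  by rewrite /a' enum_valK.
have [smooth|/Dz Da0] := pselect (smooth_cubic a'); last first.
  by rewrite rmorphM /= aE Da0 mul0r.
have Da0 : eval_coef D a' != 0 by apply/eqP => /Dz.
have [_] := j_invariant_disc pchar_puiseux (jAD _ smooth).
rewrite -!eval_coef_generic -!aE => E.
rewrite rmorphM rmorphB (rmorphM _ A) (rmorphM _ _ D) (rmorphM _ 1728) rmorphXn.
rewrite rmorph_nat /=.
apply/eqP; rewrite mulf_eq0; apply/orP; right; rewrite subr_eq0; apply/eqP.
rewrite -E.
have Da0' : mmap puiseux_ratr a D != 0 by rewrite aE.
by rewrite mulrAC; congr (_ * _); exact: esym (divfK Da0' _).
Qed.

Lemma gval_j_fraction (u : A3 -> R) r s :
  val_eq (gval u) (evalp generic_coefs aronholdS) r ->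
  val_eq (gval u) (evalp generic_coefs cubic_disc) s ->
  gval u A - gval u D = 3 * r - s.
Proof.
move=> [S0 Sr] [d0 ds].
have V := gval_valuation u; have D0 := discriminant_neq0.
have k0 : 1728 != 0 :> {mpoly rat[#|A3|]} /\ gval u (1728 : {mpoly rat[#|A3|]}) = 0.
  exact: (val_nat V (n := 1728) isT).
have S3 : val_eq (gval u) (evalp generic_coefs aronholdS ^+ 3) (3 * r).
  exact: val_eqX.
have rhs : val_eq (gval u) (1728 * evalp generic_coefs aronholdS ^+ 3 * D) (0 + 3 * r + gval u D).
  by do 2?apply: val_eqM.
have A0 : A != 0.
  by case: rhs; rewrite -j_fraction_eq mulf_eq0 negb_or => /andP[].
have [_] := rhs; rewrite -j_fraction_eq (valM V) // ds add0r => E;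
  move: (gval u A) (gval u D) E => x y; clear; lra.
Qed.

End Algebra.

(** * The polygon dual to the star of (1,1) *)

Definition cyc_next (k : nat) : nat := if k == 8 then 0%N else k.+1.
Definition cyc_prev (k : nat) : nat := if k is k'.+1 then k' else 8%N.

(** Integer versions of the directions d_k and of their determinants, on which
    statements about all pairs or triples of directions are decided by
    enumeration. *)
Definition zdir (k : nat) : Z * Z :=
  (Z.sub (Z.of_nat (latx k)) 1, Z.sub (Z.of_nat (laty k)) 1).

Definition zdet (i j : nat) : Z :=
  Z.sub (Z.mul (zdir i).1 (zdir j).2) (Z.mul (zdir i).2 (zdir j).1).

(** The directions d_i and d_j are positively oriented and d_k + d_(k+1) lies
    in the interior of the cone that they span. *)
Definition straddles (k i j : nat) : bool :=
  [&& Z.ltb 0 (zdet i j), Z.ltb 0 (Z.add (zdet i k) (zdet i (cyc_next k))) &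
      Z.ltb 0 (Z.add (zdet k j) (zdet (cyc_next k) j))].

Definition all9 (p : nat -> bool) : bool := all p (iota 0 9).

Lemma all9P p : all9 p -> forall k, (k < 9)%N -> p k.
Proof. by move=> /allP h k k9; apply: h; rewrite mem_iota. Qed.

(** The pivot step of the simplex method: a new direction d_l can replace one
    of d_i, d_j unless it lies in the opposite cone, in which case 0 is a
    positive combination of the three. *)
Lemma straddles_pivot : all9 (fun k => all9 (fun i => all9 (fun j => all9 (fun l =>
  straddles k i j ==> [|| straddles k i l, straddles k l j |
    Z.leb 0 (zdet j l) && Z.leb 0 (zdet l i)])))).
Proof. by vm_compute. Qed.

(** No d_l lies strictly between d_k and d_(k+1), so a cone containing their
    sum in its interior contains both of them. *)
Lemma straddles_cone : all9 (fun k => all9 (fun i => all9 (fun j =>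
  straddles k i j ==> [&& Z.leb 0 (zdet i k), Z.ltb 0 (zdet k j),
    Z.ltb 0 (zdet i (cyc_next k)) & Z.leb 0 (zdet (cyc_next k) j)]))).
Proof. by vm_compute. Qed.

Lemma straddles_degenerate : all9 (fun k => all9 (fun i => all9 (fun j =>
  straddles k i j && Z.eqb (zdet i k) 0 ==> (i == k)))).
Proof. by vm_compute. Qed.

Lemma straddles_self : all9 (fun k => straddles k k (cyc_next k)).
Proof. by vm_compute. Qed.

Lemma zdet_next : all9 (fun k => Z.eqb (zdet k (cyc_next k)) 1).
Proof. by vm_compute. Qed.

Definition mdir (m : monomial) : Z * Z :=
  foldr (fun k s => let: (x, y) := zdir k in let c := Z.of_nat (nth 0%N m k) in
    (Z.add (Z.mul c x) s.1, Z.add (Z.mul c y) s.2)) (Z0, Z0) (iota 0 9).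

Definition node (c : nat) : spoly :=
  if c == 0%N then node0 else if c == 3 then node3 else node6.

(** What makes a node polynomial the dual of a support function: its terms are
    expressions of d_c as sums of directions, every cone straddling d_c +
    d_(c+1) carries one of them, and two distinct terms together involve at
    least three directions. *)
Definition node_ok (c : nat) : bool :=
  [&& all (fun t => let: (x, y) := mdir t.1 in
        [&& Z.eqb x (zdir c).1, Z.eqb y (zdir c).2 & sumn t.1 == 4] && (size t.1 == 10)) (node c),
      all9 (fun i => all9 (fun j => straddles c i j ==>
        has (fun t => all9 (fun k => (nth 0%N t.1 k == 0%N) || (k \in [:: i; j]))) (node c))) &
      all (fun t => all (fun t' => (t == t') ||
        (2 < count (fun k => 0 < nth 0%N t.1 k + nth 0%N t'.1 k) (iota 0 9))%N)
        (node c)) (node c)].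

Lemma nodes_ok : all node_ok [:: 0; 3; 6]%N.
Proof. by vm_compute. Qed.

Lemma seq_argmin (R : realFieldType) (T : eqType) (F : T -> R) (s : seq T) t0 : t0 \in s ->
  exists2 t, t \in s & forall t', t' \in s -> F t <= F t'.
Proof.
elim: s t0 => [//|t [|t1 s] IH] t0 _.
  by exists t; rewrite ?mem_head // => t'; rewrite inE => /eqP->.
have [t2 t2s min] := IH t1 (mem_head _ _).
have [le|/ltW le] := leP (F t) (F t2).
  exists t; rewrite ?mem_head // => t'; rewrite inE => /predU1P[->//|/min].
  exact: le_trans.
exists t2; first by rewrite inE t2s orbT.
by move=> t'; rewrite inE => /predU1P[->//|/min].
Qed.

Section Fan.
Variables (R : realFieldType) (w : nat -> R).
Hypothesis hw : interior w.
Local Notation dx := (dirx R).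
Local Notation dy := (diry R).

(** At the point V = (x, y), the amount by which the term of index [k] of the
    tropical polynomial exceeds the term of (1,1). *)
Definition slack (k : nat) (x y : R) : R := w k - w 9%N + dx k * x + dy k * y.

Definition feasible (x y : R) : Prop := forall k, (k < 9)%N -> 0 <= slack k x y.

Definition dirdet (i j : nat) : R := dx i * dy j - dy i * dx j.

Lemma zdirE k : (int_of_Z (zdir k).1)%:~R = dx k /\ (int_of_Z (zdir k).2)%:~R = dy k.
Proof.
have E (n : nat) : (int_of_Z (Z.sub (Z.of_nat n) 1))%:~R = n%:R - 1 :> R.
  have -> : int_of_Z (Z.sub (Z.of_nat n) 1) = n%:Z - 1 by lia.
  by rewrite intrB.
by split; apply: E.
Qed.

Lemma zdetE i j : (int_of_Z (zdet i j))%:~R = dirdet i j.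
Proof.
have -> : int_of_Z (zdet i j) = int_of_Z (zdir i).1 * int_of_Z (zdir j).2 -
   int_of_Z (zdir i).2 * int_of_Z (zdir j).1 by rewrite /zdet; lia.
by rewrite intrB !intrM !(zdirE _).1 !(zdirE _).2.
Qed.

Lemma Zltb_real z : Z.ltb 0 z -> 0 < (int_of_Z z)%:~R :> R.
Proof. by move=> h; rewrite ltr0z; lia. Qed.

Lemma Zleb_real z : Z.leb 0 z -> 0 <= (int_of_Z z)%:~R :> R.
Proof. by move=> h; rewrite ler0z; lia. Qed.

Lemma straddlesP k i j : straddles k i j ->
  [/\ 0 < dirdet i j, 0 < dirdet i k + dirdet i (cyc_next k) & 0 < dirdet k j + dirdet
    (cyc_next k) j].
Proof.
case/and3P => /Zltb_real h1 /Zltb_real h2 /Zltb_real h3; move: h1 h2 h3.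
by rewrite (int_of_ZD (zdet i k)) (int_of_ZD (zdet k j)) !intrD !zdetE.
Qed.

(** The hypothesis on (1,1) is used for relations between three directions;
    the position (x, y) does not matter as its contribution to a relation is
    zero. *)
Lemma interior3 i j l (a b c x y : R) : (i < 9)%N -> (j < 9)%N -> (l < 9)%N ->
  0 <= a -> 0 <= b -> 0 < c ->
  a * dx i + b * dx j + c * dx l = 0 -> a * dy i + b * dy j + c * dy l = 0 ->
  0 < a * slack i x y + b * slack j x y + c * slack l x y.
Proof.
move=> i9 j9 l9 a0 b0 c0 ex ey.
pose f k : R := a * (k == i)%:R + b * (k == j)%:R + c * (k == l)%:R.
have pick (m : nat) (g : nat -> R) : (m < 9)%N ->
    \sum_(0 <= k < 9) (k == m)%:R * g k = g m.
  move=> m9; rewrite (bigD1_seq m) ?mem_index_iota ?iota_uniq //= eqxx mul1r.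
  by rewrite big1 ?addr0 // => k /negbTE->; rewrite mul0r.
have fE (g : nat -> R) : \sum_(0 <= k < 9) f k * g k = a * g i + b * g j + c * g l.
  transitivity (\sum_(0 <= k < 9) (a * ((k == i)%:R * g k) + b * ((k == j)%:R * g k)
     + c * ((k == l)%:R * g k))); first by apply: eq_bigr => k _; rewrite /f; ring.
  by rewrite !big_split -!mulr_sumr !pick.
have f0 k : 0 <= f k by rewrite /f !addr_ge0 // mulr_ge0 // ltW.
have := hw f0; rewrite !fE => /(_ ex ey) H.
have -> : a * slack i x y + b * slack j x y + c * slack l x y =
    a * (w i - w 9%N) + b * (w j - w 9%N) + c * (w l - w 9%N) +
    (a * dx i + b * dx j + c * dx l) * x + (a * dy i + b * dy j + c * dy l) * y.
  by rewrite /slack; ring.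
rewrite ex ey !mul0r !addr0; apply: H; exists l => //.
have : 0 < f l by rewrite /f eqxx mulr1 ltr_wpDl // addr_ge0 // mulr_ge0.
by case: ltgtP.
Qed.

Definition tight (k : nat) (x y : R) : Prop := slack k x y = 0.

(** The polygon has a vertex minimizing the linear form d_k + d_(k+1). It is
    found through the dual linear program: among the straddling pairs, that is
    the ways to write the form with two nonnegative coefficients, the cheapest
    one is feasible, since a violated constraint would allow a pivot to a
    cheaper pair or contradict the position of (1,1). *)
Lemma fan_vertex k : (k < 9)%N -> exists x y, feasible x y /\
  exists i j, [/\ (i < 9)%N, (j < 9)%N, straddles k i j, tight i x y & tight j x y].
Proof.
move=> k9; pose X := dx k + dx (cyc_next k); pose Y := dy k + dy (cyc_next k).
pose cost (p : nat * nat) : R :=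
  ((X * dy p.2 - Y * dx p.2) * (w p.1 - w 9%N) +
   (dx p.1 * Y - dy p.1 * X) * (w p.2 - w 9%N)) / dirdet p.1 p.2.
pose s := [seq p <- [seq (a, b) | a <- iota 0 9, b <- iota 0 9] | straddles k p.1 p.2].
have ins i j : (i < 9)%N -> (j < 9)%N -> straddles k i j -> (i, j) \in s.
  by move=> i9 j9 ij; rewrite mem_filter ij allpairs_f // mem_iota.
have next9 : (cyc_next k < 9)%N by rewrite /cyc_next; case: eqP => // h; lia.
have [[i j]] := seq_argmin cost (ins _ _ k9 next9 (all9P straddles_self k9)).
rewrite mem_filter => /andP[/= ij ijs] min.
have /andP[i9 j9] : (i < 9)%N && (j < 9)%N.
  have all_lt : all (fun p => (p.1 < 9)%N && (p.2 < 9)%N)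
    [seq (a, b) | a <- iota 0 9, b <- iota 0 9] by [].
  exact: (allP all_lt _ ijs).
have [dij dik dkj] := straddlesP ij.
have dij0 : dirdet i j != 0 by rewrite gt_eqF.
pose si := w i - w 9%N; pose sj := w j - w 9%N.
pose x := (sj * dy i - si * dy j) / dirdet i j.
pose y := (si * dx j - sj * dx i) / dirdet i j.
have ti : slack i x y = 0 by rewrite /slack -/si /x /y /dirdet; field.
have tj : slack j x y = 0 by rewrite /slack -/sj /x /y /dirdet; field.
(* Translating the origin to (x, y) replaces the weights by the slacks. *)
have costE a b : dirdet a b != 0 -> cost (a, b) + X * x + Y * y =
   ((X * dy b - Y * dx b) * slack a x y + (dx a * Y - dy a * X) * slack b x y) / dirdet a b.
  by move=> ab0; rewrite /cost /slack /dirdet /=; field; exact: ab0.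
have c0 : cost (i, j) + X * x + Y * y = 0 by rewrite costE // ti tj !mulr0 addr0 mul0r.
exists x, y; split; last by exists i, j.
move=> l l9; rewrite leNgt; apply/negP => tl.
have := all9P (all9P (all9P (all9P straddles_pivot k9) i9) j9) l9; rewrite ij /=.
case/or3P => [il|lj|/andP[/Zleb_real djl /Zleb_real dli]].
- have [dil _ dkl] := straddlesP il.
  have := min _ (ins _ _ i9 l9 il); rewrite -(lerD2r (X * x)) -(lerD2r (Y * y)) c0.
  rewrite costE ?gt_eqF // ti mulr0 add0r leNgt pmulr_llt0 ?invr_gt0 //.
  rewrite pmulr_rlt0 ?tl //.
  by have -> : dx i * Y - dy i * X = dirdet i k + dirdet i (cyc_next k);
    rewrite // /dirdet /X /Y; ring.
- have [dlj dlk dkj'] := straddlesP lj.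
  have := min _ (ins _ _ l9 j9 lj); rewrite -(lerD2r (X * x)) -(lerD2r (Y * y)) c0.
  rewrite costE ?gt_eqF // tj mulr0 addr0 leNgt pmulr_llt0 ?invr_gt0 //.
  rewrite pmulr_rlt0 ?tl //.
  by have -> : X * dy j - Y * dx j = dirdet k j + dirdet (cyc_next k) j;
    rewrite // /dirdet /X /Y; ring.
- rewrite !zdetE in djl dli.
  have := @interior3 i j l _ _ _ x y i9 j9 l9 djl dli dij.
  rewrite ti tj !mulr0 !add0r pmulr_rgt0 // => H.
  by have := H ltac:(rewrite /dirdet; ring) ltac:(rewrite /dirdet; ring); rewrite ltNge (ltW tl).
Qed.

(** The point [v] is the vertex of the polygon between the sides (possibly of
    length zero) with normals d_k and d_(k+1). *)
Definition fan_spec (k : nat) (v : R * R) : Prop := feasible v.1 v.2 /\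
  exists i j, [/\ (i < 9)%N, (j < 9)%N, straddles k i j,
    tight i v.1 v.2 & tight j v.1 v.2].

Definition pairing (k : nat) (v : R * R) : R := dx k * v.1 + dy k * v.2.

(** Cramer's rule: d_k is a combination of d_i and d_j, whose slacks vanish at
    [v]. *)
Lemma cone_pairing i j k (v v' : R * R) : tight i v.1 v.2 -> tight j v.1 v.2 ->
  dirdet i j * (pairing k v' - pairing k v) =
  dirdet k j * slack i v'.1 v'.2 + dirdet i k * slack j v'.1 v'.2.
Proof.
move=> ti tj.
have -> : slack i v'.1 v'.2 = slack i v'.1 v'.2 - slack i v.1 v.2 by rewrite ti subr0.
have -> : slack j v'.1 v'.2 = slack j v'.1 v'.2 - slack j v.1 v.2 by rewrite tj subr0.
by rewrite /slack /dirdet /pairing; ring.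
Qed.

Lemma fan_min k v v' : (k < 9)%N -> fan_spec k v -> feasible v'.1 v'.2 ->
  pairing k v <= pairing k v' /\ pairing (cyc_next k) v <= pairing (cyc_next k) v'.
Proof.
move=> k9 [_ [i [j [i9 j9 ij ti tj]]]] fv'.
have [dij _ _] := straddlesP ij.
have := all9P (all9P (all9P straddles_cone k9) i9) j9; rewrite ij.
case/and4P => /Zleb_real + /Zltb_real/ltW + /Zltb_real/ltW + /Zleb_real.
rewrite !zdetE => c1 c2 c3 c4.
by split; rewrite -subr_ge0 -(pmulr_rge0 _ dij) (cone_pairing _ _ ti tj);
  rewrite addr_ge0 // mulr_ge0 // fv'.
Qed.

Lemma fan_vertices : exists V : nat -> R * R, forall k, (k < 9)%N -> fan_spec k (V k).
Proof.
have spec k : exists v, (k < 9)%N -> fan_spec k v.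
  have [k9|k9] := boolP (k < 9)%N; last by exists 0.
  by have [x [y h]] := fan_vertex k9; exists (x, y).
by have [V hV] := choice spec; exists V.
Qed.

Variable V : nat -> R * R.
Hypothesis hV : forall k, (k < 9)%N -> fan_spec k (V k).

Lemma prevP k : (k < 9)%N -> (cyc_prev k < 9)%N /\ cyc_next (cyc_prev k) = k.
Proof. by do 9! [case: k => [//|k]]. Qed.

Lemma next9 k : (k < 9)%N -> (cyc_next k < 9)%N.
Proof. by rewrite /cyc_next; case: eqP => // h; lia. Qed.

(** Both vertices adjacent to the side with normal d_k minimize d_k. *)
Lemma pairing_prev k : (k < 9)%N -> pairing k (V k) = pairing k (V (cyc_prev k)).
Proof.
move=> k9; have [p9 nE] := prevP k9.
apply/eqP; rewrite eq_le (fan_min k9 (hV k9) (hV p9).1).1 /=.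
by have := (fan_min p9 (hV p9) (hV k9).1).2; rewrite nE.
Qed.

(** Consecutive normals have determinant 1, so along the side with normal d_k
    the form d_(k+1) measures lattice length. *)
Definition edge_len (k : nat) : R :=
  pairing (cyc_next k) (V (cyc_prev k)) - pairing (cyc_next k) (V k).

Lemma edge_len_ge0 k : (k < 9)%N -> 0 <= edge_len k.
Proof.
move=> k9; rewrite subr_ge0; have [p9 _] := prevP k9.
exact: (fan_min k9 (hV k9) (hV p9).1).2.
Qed.

Lemma edge_vec k : (k < 9)%N ->
  (V k).1 - (V (cyc_prev k)).1 = edge_len k * dy k /\
  (V k).2 - (V (cyc_prev k)).2 = - edge_len k * dx k.
Proof.
move=> k9; have d1 : dirdet k (cyc_next k) = 1.
  by rewrite -zdetE; have /Z.eqb_eq -> := all9P zdet_next k9.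
have := pairing_prev k9; rewrite /edge_len; move: (V k) (V (cyc_prev k)) => v v'.
move: d1; rewrite /dirdet /pairing => d1 E.
have E0 : dx k * v.1 + dy k * v.2 - (dx k * v'.1 + dy k * v'.2) = 0 by rewrite E subrr.
pose L := dx (cyc_next k) * v'.1 + dy (cyc_next k) * v'.2 - (dx (cyc_next k) * v.1 + dy
  (cyc_next k) * v.2).
have K1 : (dx k * dy (cyc_next k) - dy k * dx (cyc_next k)) * (v.1 - v'.1) - L * dy k =
    dy (cyc_next k) * (dx k * v.1 + dy k * v.2 - (dx k * v'.1 + dy k * v'.2)).
  by rewrite /L; ring.
have K2 : (dx k * dy (cyc_next k) - dy k * dx (cyc_next k)) * (v.2 - v'.2) - (- L) * dx k =
    - dx (cyc_next k) * (dx k * v.1 + dy k * v.2 - (dx k * v'.1 + dy k * v'.2)).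
  by rewrite /L; ring.
rewrite d1 mul1r E0 mulr0 in K1; rewrite d1 mul1r E0 mulr0 in K2.
split; [exact: subr0_eq K1|exact: subr0_eq K2].
Qed.

(** A side of nonzero length lies on the line of its own constraint: if d_k is
    interior to the cone of tight normals at V_k, then the minimum of d_k is
    attained at V_k only. *)
Lemma edge_tight k : (k < 9)%N -> edge_len k != 0 ->
  tight k (V k).1 (V k).2 /\ tight k (V (cyc_prev k)).1 (V (cyc_prev k)).2.
Proof.
move=> k9 ek; have [p9 _] := prevP k9.
have [fk [i [j [i9 j9 ij ti tj]]]] := hV k9.
have [dij _ _] := straddlesP ij.
have := cone_pairing k (V (cyc_prev k)) ti tj.
rewrite -(pairing_prev k9) subrr mulr0.
have := all9P (all9P (all9P straddles_cone k9) i9) j9; rewrite ij.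
case/and4P => /Zleb_real + /Zltb_real + _ _; rewrite !zdetE => dik dkj.
have si := (hV p9).1 _ i9; have sj := (hV p9).1 _ j9.
move/esym/eqP; rewrite paddr_eq0 ?mulr_ge0 ?(ltW dkj) //.
rewrite !mulf_eq0 (gt_eqF dkj) /= => /andP[/eqP ti' /orP[/eqP dik0|/eqP tj']].
  have z0 : Z.eqb (zdet i k) 0.
    apply/Z.eqb_eq; apply: (can_inj int_of_ZK).
    by apply/eqP; rewrite -(eqr_int R) zdetE dik0.
  have := all9P (all9P (all9P straddles_degenerate k9) i9) j9.
  by rewrite ij z0 => /eqP E; rewrite E in ti ti'; split.
case/eqP: ek; apply: (mulfI (lt0r_neq0 dij)); rewrite mulr0 /edge_len.
by rewrite (cone_pairing _ _ ti tj) ti' tj' !mulr0 addr0.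
Qed.

(** Substituting d_(k+1) = 2 d_k - d_(k-1), or d_k - d_(k-1) at a corner,
    makes the side of index k the second difference of the minima of the forms
    d_k. *)
Lemma perimeter : \sum_(0 <= k < 9) edge_len k =
  - pairing 0 (V 0%N) - pairing 3 (V 3%N) - pairing 6 (V 6%N).
Proof.
have E k := @pairing_prev k.
have := (E 0 isT, E 1 isT, E 2 isT, E 3 isT, E 4 isT, E 5 isT, E 6 isT, E 7 isT, E 8 isT)%N.
rewrite big_mkord !big_ord_recr big_ord0 /= /edge_len /pairing /dirx /diry /cyc_next /latx /laty /=.
case=> [[[[[[[[e0 e1] e2] e3] e4] e5] e6] e7] e8].
lra.
Qed.

Lemma mdirE m : \sum_(0 <= k < 9) (nth 0%N m k)%:R * dx k = (int_of_Z (mdir m).1)%:~R /\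
  \sum_(0 <= k < 9) (nth 0%N m k)%:R * dy k = (int_of_Z (mdir m).2)%:~R.
Proof.
rewrite /mdir -[index_iota 0 9]/(iota 0 9); elim: (iota 0 9) => [|k s [IH1 IH2]].
  by rewrite !big_nil.
rewrite !big_cons {}IH1 {}IH2 -(zdirE k).1 -(zdirE k).2 /=; case: (zdir k) => a b /=.
have ZofN n : n%:R = (int_of_Z (Z.of_nat n))%:~R :> R by rewrite pmulrn; congr _%:~R; lia.
by rewrite !int_of_ZD !int_of_ZM !intrD !intrM -!ZofN !int_of_ZD !intrD -!ZofN.
Qed.

(** The boundary part of each term of the node polynomial at [c] sums to d_c,
    so its weight differs from that of a feasible point by a combination of
    slacks: this is weak duality. *)
Lemma node_weight c t v : c \in [:: 0; 3; 6]%N -> t \in node c ->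
  weight w t.1 = 4 * w 9%N - pairing c v +
    \sum_(0 <= k < 9) (nth 0%N t.1 k)%:R * slack k v.1 v.2.
Proof.
move=> cP tc; have /and3P[/allP/(_ _ tc) + _ _] := allP nodes_ok _ cP.
have [] := mdirE t.1; case: (mdir t.1) => X Y /= EX EY.
case/andP => /and3P[/Z.eqb_eq XE /Z.eqb_eq YE /eqP sE] /eqP sz.
rewrite XE (zdirE c).1 in EX; rewrite YE (zdirE c).2 in EY.
have -> : \sum_(0 <= k < 9) (nth 0%N t.1 k)%:R * slack k v.1 v.2 =
    \sum_(0 <= k < 9) (nth 0%N t.1 k)%:R * (w k - w 9%N) + pairing c v.
  rewrite /pairing -EX -EY !mulr_suml -!big_split /=.
  by apply: eq_bigr => k _; rewrite /slack; ring.
by rewrite (weight_centered _ sz) sE; ring.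
Qed.

Lemma corner_le c t v : c \in [:: 0; 3; 6]%N -> t \in node c -> feasible v.1 v.2 ->
  4 * w 9%N - pairing c v <= weight w t.1.
Proof.
move=> cP tc fv; rewrite (node_weight v cP tc) lerDl big_nat.
by apply: sumr_ge0 => k /andP[_ k9]; rewrite mulr_ge0 // fv.
Qed.

(** Strong duality: the vertex V_c has tight constraints i and j straddling
    d_c, and the term supported on them has zero slack. *)
Lemma corner_attained c : c \in [:: 0; 3; 6]%N ->
  exists2 t, t \in node c & weight w t.1 = 4 * w 9%N - pairing c (V c).
Proof.
move=> cP; have c9 : (c < 9)%N by move: c cP; apply/allP.
have [_ [i [j [i9 j9 ij ti tj]]]] := hV c9.
have /and3P[_ + _] := allP nodes_ok _ cP.
move=> /all9P/(_ _ i9)/all9P/(_ _ j9); rewrite ij => /hasP[t tc supp].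
exists t => //; rewrite (node_weight (V c) cP tc) big_nat big1 ?addr0 // => k /andP[_ k9].
have /orP[/eqP->|] := all9P supp k9; first by rewrite mul0r.
by rewrite !inE => /orP[] /eqP->; rewrite ?ti ?tj mulr0.
Qed.

Lemma corner_tight c t v k : c \in [:: 0; 3; 6]%N -> t \in node c ->
  feasible v.1 v.2 -> weight w t.1 = 4 * w 9%N - pairing c v ->
  (k < 9)%N -> (0 < nth 0%N t.1 k)%N -> tight k v.1 v.2.
Proof.
move=> cP tc fv; rewrite (node_weight v cP tc) -[RHS]addr0 => /addrI S0 k9 tk.
have nn l : (l < 9)%N -> 0 <= (nth 0%N t.1 l)%:R * slack l v.1 v.2.
  by move=> l9; rewrite mulr_ge0 // fv.
move: S0; rewrite (bigD1_seq k) ?mem_index_iota ?iota_uniq //= => /eqP.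
rewrite paddr_eq0 ?nn //; last first.
  by rewrite big_seq_cond sumr_ge0 // => l /andP[]; rewrite mem_index_iota => /andP[_ /nn].
by case/andP; rewrite mulf_eq0 pnatr_eq0 -leqn0 leqNgt tk => /eqP.
Qed.

(** Complementary slackness: every boundary variable of a minimal term is
    tight, and two distinct terms involve at least three boundary variables. *)
Lemma corner_unique c t t' v : c \in [:: 0; 3; 6]%N -> t \in node c -> t' \in node c ->
  t != t' -> feasible v.1 v.2 ->
  weight w t.1 = 4 * w 9%N - pairing c v -> weight w t'.1 = 4 * w 9%N - pairing c v ->
  exists s : seq nat, [/\ uniq s, (2 < size s)%N &
    forall k, k \in s -> (k < 9)%N /\ tight k v.1 v.2].
Proof.
move=> cP tc t'c tt' fv Et Et'.
have /and3P[_ _ /allP/(_ _ tc)/allP/(_ _ t'c)] := allP nodes_ok _ cP.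
rewrite (negbTE tt') /= => cnt.
exists [seq k <- iota 0 9 | 0 < nth 0%N t.1 k + nth 0%N t'.1 k]%N.
rewrite filter_uniq ?iota_uniq // size_filter; split=> // k.
rewrite mem_filter mem_iota addn_gt0 => /andP[+ /andP[_ k9]].
by case/orP => h; split=> //; [apply: corner_tight tc fv Et _ h|
  apply: corner_tight t'c fv Et' _ h].
Qed.

End Fan.

(** * Attainment of the lower hull *)

Lemma det_col2 (F : fieldType) (p q : 'rV[F]_2) :
  \det (col_mx p q : 'M_2) = p 0 0 * q 0 1 - p 0 1 * q 0 0.
Proof.
have E (A : 'M[F]_2) : \det A = A 0 0 * A 1 1 - A 0 1 * A 1 0.
  rewrite (expand_det_row _ 0) !big_ord_recr big_ord0 /cofactor /= !det_mx11 !mxE add0r.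
  rewrite addn0 expr0 mul1r addn1 expr1 mulN1r mulrN.
  by congr (A _ _ * A _ _ - A _ _ * A _ _); apply: val_inj.
rewrite E.
have -> : (0 : 'I_2) = lshift 1 (0 : 'I_1) by apply: val_inj.
have -> : (1 : 'I_2) = rshift 1 (0 : 'I_1) by apply: val_inj.
by rewrite !(@col_mxEu F 1 1) !(@col_mxEd F 1 1).
Qed.

Section LowerHull.
Variables (R : realType) (u : A3 -> R).
Implicit Types (p q r c : 'rV[R]_2) (l m : A3 -> R) (Q P : set 'rV[R]_2).
Local Notation pt := (@pt R).

Lemma ord2P (T : 'I_2 -> Prop) : T 0 -> T 1 -> forall i, T i.
Proof.
move=> T0 T1 [[|[|]] // h]; first by rewrite (_ : Ordinal h = 0) //; apply: val_inj.
by rewrite (_ : Ordinal h = 1) //; apply: val_inj.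
Qed.

Lemma dotE p q : dot p q = p 0 0 * q 0 0 + p 0 1 * q 0 1.
Proof.
rewrite /dot !big_ord_recr big_ord0 /= add0r.
by congr (p 0 _ * q 0 _ + p 0 _ * q 0 _); exact: val_inj.
Qed.

Lemma row2P p q : p 0 0 = q 0 0 -> p 0 1 = q 0 1 -> p = q.
Proof. by move=> h0 h1; apply/rowP; apply: ord2P. Qed.

Lemma vecE (x y : R) : vec x y 0 0 = x /\ vec x y 0 1 = y.
Proof. by rewrite !mxE. Qed.

(** The points of Q_3 are treated as barycentres of the ten lattice points, so
    that the lower hull becomes the value function of a linear program. *)
Definition combines l p : Prop :=
  [/\ forall w, 0 <= l w, \sum_w l w = 1 & p = \sum_w l w *: pt w].

Definition cost l : R := \sum_w l w * u w.

Lemma combines_coord l p i : combines l p -> p 0 i = \sum_w l w * pt w 0 i.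
Proof. by case=> _ _ ->; rewrite summxE; apply: eq_bigr => w _; rewrite mxE. Qed.

Lemma combines_dot l p c : combines l p -> dot c p = \sum_w l w * dot c (pt w).
Proof.
move=> lp; rewrite dotE !(combines_coord _ lp) !mulr_sumr -big_split /=.
by apply: eq_bigr => w _; rewrite dotE; ring.
Qed.

Lemma combines_aff l p c (b : R) : combines l p ->
  dot c p + b = \sum_w l w * (dot c (pt w) + b).
Proof.
move=> lp; rewrite (combines_dot c lp).
under [RHS]eq_bigr do rewrite mulrDr.
by rewrite big_split /= -mulr_suml; case: lp => _ -> _; rewrite mul1r.
Qed.

Lemma combines_pt w : combines (fun w' => (w' == w)%:R) (pt w).
Proof.
split=> [w'||]; first by rewrite ler0n.
  by rewrite (bigD1 w) //= eqxx big1 ?addr0 // => i /negbTE->.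
by rewrite (bigD1 w) //= eqxx scale1r big1 ?addr0 // => i /negbTE->; rewrite scale0r.
Qed.

(** Collecting the weights by the lattice point they sit at. *)
Lemma push_weights n (t : 'I_n -> R) (f : 'I_n -> A3) (V : lmodType R) (g : A3 -> V) :
  \sum_i t i *: g (f i) = \sum_w (\sum_(i | f i == w) t i) *: g w.
Proof.
rewrite (partition_big f xpredT) //=; apply: eq_bigr => w _.
by rewrite scaler_suml; apply: eq_bigr => i /eqP->.
Qed.

Lemma hull_combines (S : set 'rV[R]_2) (T : A3 -> Prop) p :
  (forall q, S q -> exists2 w, T w & q = pt w) -> convex_hull S p ->
  exists2 l, combines l p & forall w, ~ T w -> l w = 0.
Proof.
move=> ST [n [t [s [t0 t1 sS ->]]]].
have spec i : exists w, T w /\ s i = pt w by have [w ? ?] := ST _ (sS i); exists w.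
have [f fE] := choice spec.
exists (fun w => \sum_(i | f i == w) t i); last first.
  by move=> w Tw; apply: big1 => i /eqP fi; case: Tw; rewrite -fi; apply: (fE i).1.
split.
- by move=> w; apply: sumr_ge0.
- by rewrite -t1 [RHS](partition_big f xpredT).
- by rewrite -push_weights; apply: eq_bigr => i _; rewrite (fE i).2.
Qed.

Lemma sum_enum_A3 (V : nmodType) (F : A3 -> V) :
  \sum_w F w = \sum_(i < #|A3|) F (enum_val i).
Proof. by rewrite -big_enum_val; apply: eq_bigl => w; rewrite inE. Qed.

Lemma combines_hull (S : set 'rV[R]_2) l p : combines l p ->
  (forall w, l w != 0 -> S (pt w)) -> convex_hull S p.
Proof.
case=> l0 l1 pE lS.
have [w0 lw0] : exists w, l w != 0.
  apply: contrapT => /forallNP H; have : \sum_w l w = 0.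
    by apply: big1 => w _; apply/eqP/negPn/negP/H.
  by rewrite l1 => /eqP; rewrite oner_eq0.
exists #|A3|, (fun i => l (enum_val i)),
  (fun i => if l (enum_val i) == 0 then pt w0 else pt (enum_val i)).
split.
- by move=> i; apply: l0.
- by rewrite -l1 [RHS]sum_enum_A3.
- by move=> i; case: ifPn => // ?; apply: lS.
- rewrite pE sum_enum_A3.
  by apply: eq_bigr => i _; case: eqP => [->|//]; rewrite !scale0r.
Qed.

Lemma lifted_hullP p (h : R) : lifted_hull u (p, h) <->
  exists2 l, combines l p & cost l <= h.
Proof.
split.
  case=> n [t [s [t0 t1 sS E]]].
  have [f fE] := choice sS.
  exists (fun w => \sum_(i | f i == w) t i).
    split.
    - by move=> w; apply: sumr_ge0.
    - by rewrite -t1 [RHS](partition_big f xpredT).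
    - rewrite -push_weights -[LHS]/((p, h).1) E (big_morph fst (fun _ _ => erefl) erefl).
      by apply: eq_bigr => i _; rewrite /= (fE i).1.
  rewrite /cost -(@push_weights _ _ _ R^o u) -[h]/((p, h).2) E.
  rewrite (big_morph snd (fun _ _ => erefl) erefl).
  by apply: ler_sum => i _ /=; apply: ler_wpM2l; [exact: t0|exact: (fE i).2].
case=> l [l0 l1 pE] lh.
exists #|A3|, (fun i => l (enum_val i)),
  (fun i => (pt (enum_val i), u (enum_val i) + (h - cost l))).
split.
- by move=> i; apply: l0.
- by rewrite -l1 [RHS]sum_enum_A3.
- by move=> i; exists (enum_val i); split=> //=; rewrite lerDl subr_ge0.
- rewrite [RHS]surjective_pairing; congr pair.
    by rewrite (big_morph fst (fun _ _ => erefl) erefl) pE sum_enum_A3.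
  rewrite (big_morph snd (fun _ _ => erefl) erefl) /=.
  transitivity (\sum_w l w * (u w + (h - cost l))); last by rewrite sum_enum_A3.
  under eq_bigr do rewrite mulrDr.
  by rewrite big_split /= -mulr_suml l1 -/(cost l); ring.
Qed.

(** A linear program on a simplex attains its minimum; this is proved by
    induction on the set [X] which supports the weights, without topology. If
    some weight function on [X] is strictly cheaper than all those with a
    smaller support, it is optimal: moving from it towards a cheaper one, and
    beyond, one would reach a smaller support at no higher cost. Otherwise the
    optimum is the best of the finitely many optima for smaller supports. *)
Lemma cheapest_on (X : {set A3}) p :
  (exists l, combines l p /\ forall w, w \notin X -> l w = 0) ->
  exists l, [/\ combines l p, forall w, w \notin X -> l w = 0 &
    forall m, combines m p -> (forall w, w \notin X -> m w = 0) -> cost l <= cost m].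
Proof.
have [n] := ubnP #|X|; elim: n X => [//|n IH] X; rewrite ltnS => Xn [l1 [l1p l1X]].
pose on (Y : {set A3}) l := combines l p /\ forall w, w \notin Y -> l w = 0.
have [[l [[lp lX] lt_l]]|H] := pselect (exists l, on X l /\
    forall x m, x \in X -> on (X :\ x)%SET m -> cost l < cost m).
  exists l; split=> // m mp mX; rewrite leNgt; apply/negP => ml.
  pose d w := m w - l w.
  have dsum : \sum_w d w = 0.
    by rewrite sumrB; case: mp => _ -> _; case: lp => _ -> _; rewrite subrr.
  have [w0 dw0] : exists w, d w < 0.
    apply: contrapT => /forallNP H.
    have d0 w : 0 <= d w by rewrite leNgt; apply/negP/H.
    have dz w : d w = 0.
      by move/eqP: dsum; rewrite psumr_eq0 // => /allP/(_ w (mem_index_enum _))/eqP.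
    move: ml; rewrite (_ : cost m = cost l) ?ltxx //.
    by apply: eq_bigr => w _; rewrite (subr0_eq (dz w)).
  (* The first weight that vanishes on the ray from [l] through [m]. *)
  pose s := [seq w <- enum A3 | d w < 0].
  have w0s : w0 \in s by rewrite mem_filter dw0 mem_enum.
  have [x] := seq_argmin (fun w => l w / - d w) w0s.
  rewrite mem_filter => /andP[dx _] tmin; pose t := l x / - d x.
  have ndx : 0 < - d x by rewrite oppr_gt0.
  have t0 : 0 <= t by apply: divr_ge0; [case: lp|apply: ltW].
  pose nu w := l w + t * d w.
  have xX : x \in X.
    by apply: contraLR dx => xX; rewrite /d mX // lX // subrr ltxx.
  have nuE (g : A3 -> R) : \sum_w nu w * g w =
      \sum_w l w * g w + t * (\sum_w m w * g w - \sum_w l w * g w).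
    rewrite -sumrB mulr_sumr -big_split; apply: eq_bigr => w _ /=.
    by rewrite /nu /d; ring.
  have nup : combines nu p.
    split.
    - move=> w; rewrite /nu; have [dw|dw] := ltP (d w) 0.
        have ws : w \in s by rewrite mem_filter dw mem_enum.
        have := tmin _ ws; rewrite -/t ler_pdivlMr ?oppr_gt0 // => h; lra.
      by apply: addr_ge0; [case: lp|apply: mulr_ge0].
    - by rewrite big_split /= -mulr_sumr dsum mulr0 addr0; case: lp.
    - apply/rowP => i; rewrite summxE.
      under eq_bigr do rewrite mxE.
      by rewrite nuE -(combines_coord _ lp) -(combines_coord _ mp) subrr mulr0 addr0.
  have : cost l < cost nu.
    apply: (lt_l x) => //; split=> // w; rewrite !inE negb_and negbK => /orP[/eqP->|wX].
      by rewrite /nu /t invrN mulrN mulNr divfK ?subrr // lt_eqF.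
    by rewrite /nu /d lX // mX // subrr mulr0 addr0.
  rewrite /cost nuE -/(cost l) -/(cost m) ltrDl ltNge mulr_ge0_le0 // subr_le0.
  exact: ltW.
have {}H l : on X l -> exists x m, [/\ x \in X, on (X :\ x)%SET m & cost m <= cost l].
  move=> lX; apply: contrapT => N; apply: H; exists l; split=> // x m xX mx.
  by rewrite ltNge; apply/negP => ml; apply: N; exists x, m.
have spec x : exists m, x \in X -> (exists m, on (X :\ x)%SET m) ->
    on (X :\ x)%SET m /\ forall m', on (X :\ x)%SET m' -> cost m <= cost m'.
  have [[xX ex]|no] := pselect (x \in X /\ exists m, on (X :\ x)%SET m).
    have cx : (#|X :\ x| < n)%N by apply: leq_trans Xn; rewrite (cardsD1 x X) xX.
    have [m [mp mX mm]] := IH _ cx ex.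
    by exists m => _ _; split=> // m' [m'p m'X]; apply: mm.
  by exists l1 => xX ex; case: no.
have [f fP] := choice spec.
pose s := [seq x <- enum X | `[< exists m, on (X :\ x)%SET m >]].
have ins x m : x \in X -> on (X :\ x)%SET m -> x \in s.
  by move=> xX mx; rewrite mem_filter mem_enum xX andbT; apply/asboolP; exists m.
have [x0 [m0 [x0X m0x _]]] := H _ (conj l1p l1X).
have [x] := seq_argmin (fun x => cost (f x)) (ins _ _ x0X m0x).
rewrite mem_filter mem_enum => /andP[/asboolP ex xX] xmin.
have [[fp fX] fmin] := fP x xX ex.
exists (f x); split=> // [w wX|m mp mX].
  by apply: fX; rewrite !inE (negbTE wX) andbF.
have [y [m' [yX m'y m'm]]] := H m (conj mp mX).
apply: le_trans m'm; apply: le_trans (xmin _ (ins _ _ yX m'y)) _.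
by apply: (fP y yX _).2 => //; exists m'.
Qed.

Lemma LC_attained p : (exists l, combines l p) ->
  exists l, [/\ combines l p, cost l = LC u p &
    forall m, combines m p -> LC u p <= cost m].
Proof.
case=> l0 l0p.
have [|l [lp _ lmin]] := @cheapest_on [set: A3]%SET p.
  by exists l0; split=> // w; rewrite inE.
have {}lmin m : combines m p -> cost l <= cost m.
  by move=> mp; apply: lmin => // w; rewrite inE.
have lE : LC u p = cost l.
  rewrite /LC; set H := [set h | _]%classic.
  have lb : lbound H (cost l).
    by move=> h /lifted_hullP[m mp]; apply: le_trans; apply: lmin.
  have Hl : H (cost l) by apply/lifted_hullP; exists l.
  apply/eqP; rewrite eq_le; apply/andP; split.
    by apply: ge_inf => //; exists (cost l).
  by apply: lb_le_inf => //; exists (cost l).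
by exists l; split=> // m; rewrite lE; apply: lmin.
Qed.

End LowerHull.

(** * Cells as contact sets *)

Section Triangle.
Variable R : realType.
Implicit Types p q : 'rV[R]_2.

Lemma Q3_combines p : Q3 p -> exists l, combines l p.
Proof.
case/(@hull_combines _ _ (fun=> True)) => [q|l lp _]; last by exists l.
by case=> [[->|->]|->]; [exists (latpt 0)|exists (latpt 3)|exists (latpt 6)].
Qed.

Lemma combines_Q3 l p : combines l p -> Q3 p.
Proof.
move=> lp; pose t (i : 'I_3) : R :=
  if i == 0 then 1 - p 0 0 / 3 - p 0 1 / 3 else if i == 1 then p 0 0 / 3 else p 0 1 / 3.
pose s (i : 'I_3) : 'rV[R]_2 :=
  if i == 0 then vec 0 0 else if i == 1 then vec 3 0 else vec 0 3.
have [l0 l1 _] := lp.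
have bound (c : 'rV[R]_2) (b : R) : (forall w, 0 <= dot c (pt R w) + b) -> 0 <= dot c p + b.
  move=> H; rewrite (combines_aff c b lp); apply: sumr_ge0 => w _.
  by rewrite mulr_ge0.
have p0 : 0 <= p 0 0.
  have := bound (vec 1 0) 0; rewrite !dotE !(vecE _ _).1 !(vecE _ _).2.
  rewrite mul1r mul0r !addr0; apply=> w.
  by rewrite !dotE !(vecE _ _).1 !(vecE _ _).2 mul1r mul0r !addr0 ler0n.
have p1 : 0 <= p 0 1.
  have := bound (vec 0 1) 0; rewrite !dotE !(vecE _ _).1 !(vecE _ _).2.
  rewrite mul1r mul0r !addr0 add0r; apply=> w.
  by rewrite !dotE !(vecE _ _).1 !(vecE _ _).2 mul1r mul0r !addr0 add0r ler0n.
have p2 : 0 <= - p 0 0 - p 0 1 + 3.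
  have := bound (vec (-1) (-1)) 3; rewrite !dotE !(vecE _ _).1 !(vecE _ _).2.
  rewrite !mulN1r; apply=> w.
  rewrite !dotE !(vecE _ _).1 !(vecE _ _).2 !mulN1r.
  rewrite -opprD addrC subr_ge0 -natrD ler_nat; exact: (valP w).
exists 3%N, t, s; split.
- by apply: ord3P; rewrite /t /= ?divr_ge0 //; lra.
- by rewrite !big_ord_recr big_ord0 /t /=; lra.
- by apply: ord3P; rewrite /s /=; [left; left|left; right|right].
- apply: row2P; rewrite summxE !big_ord_recr big_ord0 /t /s /= !mxE /=; lra.
Qed.

End Triangle.

Section Contact.
Variables (R : realType) (u : A3 -> R).
Implicit Types (p q r c : 'rV[R]_2) (l m : A3 -> R) (Q P : set 'rV[R]_2) (b : R).
Local Notation pt := (@pt R).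

Definition below c b : Prop := forall w, dot c (pt w) + b <= u w.

(** The set where an affine function below all lifted points touches the lower
    hull. *)
Definition contact c b : set 'rV[R]_2 :=
  [set p | Q3 p /\ LC u p = dot c p + b].

Lemma LC_le l p : combines l p -> LC u p <= cost u l.
Proof.
by move=> lp; have [|m [_ _]] := @LC_attained _ u p; [exists l|apply].
Qed.

Lemma LC_pt_le w : LC u (pt w) <= u w.
Proof.
apply: le_trans (LC_le (combines_pt R w)) _; rewrite /cost (bigD1 w) //= eqxx mul1r.
by rewrite big1 ?addr0 // => i /negbTE->; rewrite mul0r.
Qed.

Lemma below_LC c b p : below c b -> Q3 p -> dot c p + b <= LC u p.
Proof.
move=> cb /Q3_combines/(LC_attained u)[l [lp <- _]].
rewrite (combines_aff c b lp); apply: ler_sum => w _.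
by apply: ler_wpM2l => //; case: lp.
Qed.

(** A barycentre whose cost equals the value of the affine function puts no
    weight on points lifted strictly above that function. *)
Lemma contactP c b p : below c b -> contact c b p <->
  exists2 l, combines l p & forall w, l w != 0 -> u w = dot c (pt w) + b.
Proof.
move=> cb; split.
  case=> /Q3_combines/(LC_attained u)[l [lp <- _]] E; exists l => // w lw.
  have nn w' : 0 <= l w' * (u w' - (dot c (pt w') + b)).
    by rewrite mulr_ge0 ?subr_ge0 //; case: lp.
  have S0 : \sum_w' l w' * (u w' - (dot c (pt w') + b)) = 0.
    under eq_bigr do rewrite mulrBr.
    by rewrite sumrB -(combines_aff c b lp) -E subrr.
  move/eqP: S0; rewrite psumr_eq0 // => /allP/(_ w (mem_index_enum _)) /=.
  by rewrite mulf_eq0 (negbTE lw) subr_eq0 => /eqP.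
case=> l lp ul; have Q3p := combines_Q3 lp; split=> //.
apply/eqP; rewrite eq_le below_LC // andbT (le_trans (LC_le lp)) //.
rewrite (combines_aff c b lp); apply: ler_sum => w _.
by have [->|/ul->] := eqVneq (l w) 0; rewrite ?mul0r.
Qed.

Lemma contact_pt c b w : below c b -> u w = dot c (pt w) + b -> contact c b (pt w).
Proof.
move=> cb uw; apply/contactP => //; exists (fun w' => (w' == w)%:R); first exact: combines_pt.
by move=> w'; have [->|_] := eqVneq w' w; rewrite ?eqxx.
Qed.

Lemma contact_marking c b w : below c b -> marking u (contact c b) w <-> u w = dot c (pt w) + b.
Proof.
move=> cb; split; first by case=> -[_ <-] ->.
move=> uw; have := contact_pt cb uw; move=> cw; split=> //.
by case: cw => _ ->.
Qed.

Lemma contact_convex c b : below c b -> is_convex (contact c b).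
Proof.
move=> cb p [n [t [s [t0 t1 sc ->]]]].
have spec i : exists l, combines l (s i) /\ forall w, l w != 0 -> u w = dot c (pt w) + b.
  by have [l ? ?] := (contactP (s i) cb).1 (sc i); exists l.
have [f fP] := choice spec.
apply/contactP => //; exists (fun w => \sum_i t i * f i w).
  split.
  - by move=> w; apply: sumr_ge0 => i _; rewrite mulr_ge0 //; case: (fP i) => -[].
  - rewrite exchange_big -t1; apply: eq_bigr => i _; rewrite -mulr_sumr.
    by case: (fP i) => -[_ -> _] _; rewrite mulr1.
  - under [RHS]eq_bigr do rewrite scaler_suml.
    rewrite exchange_big; apply: eq_bigr => i _.
    have [[_ _ sE] _] := fP i; rewrite {1}sE scaler_sumr.
    by apply: eq_bigr => w _; rewrite scalerA.
move=> w nz; apply: contrapT => N; case/eqP: nz; apply: big1 => i _.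
have [->|fi] := eqVneq (f i w) 0; first by rewrite mulr0.
by case: N; apply: (fP i).2.
Qed.

Lemma noncollinearE p q r : noncollinear p q r <->
  (q 0 0 - p 0 0) * (r 0 1 - p 0 1) - (q 0 1 - p 0 1) * (r 0 0 - p 0 0) != 0.
Proof.
by rewrite /noncollinear row_free_unit unitmxE unitfE (@det_col2 R) !mxE.
Qed.

Lemma aff_unique c b c' b' p q r : noncollinear p q r ->
  dot c p + b = dot c' p + b' -> dot c q + b = dot c' q + b' ->
  dot c r + b = dot c' r + b' -> c = c' /\ b = b'.
Proof.
move=> /noncollinearE; set D := (X in X != 0) => D0; rewrite !dotE => Ep Eq Er.
have E0 : D * (c 0 0 - c' 0 0) = 0.
  transitivity ((r 0 1 - p 0 1) * ((c 0 0 * q 0 0 + c 0 1 * q 0 1 + b) - (c 0 0 * p 0 0 +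
    c 0 1 * p 0 1 + b)
    - ((c' 0 0 * q 0 0 + c' 0 1 * q 0 1 + b') - (c' 0 0 * p 0 0 + c' 0 1 * p 0 1 + b')))
    - (q 0 1 - p 0 1) * ((c 0 0 * r 0 0 + c 0 1 * r 0 1 + b) - (c 0 0 * p 0 0 + c 0 1 * p 0 1 + b)
    - ((c' 0 0 * r 0 0 + c' 0 1 * r 0 1 + b') - (c' 0 0 * p 0 0 + c' 0 1 * p 0 1 + b')))).
    by rewrite /D; ring.
  by rewrite Ep Eq Er; ring.
have E1 : D * (c 0 1 - c' 0 1) = 0.
  transitivity ((q 0 0 - p 0 0) * ((c 0 0 * r 0 0 + c 0 1 * r 0 1 + b) - (c 0 0 * p 0 0 +
    c 0 1 * p 0 1 + b)
    - ((c' 0 0 * r 0 0 + c' 0 1 * r 0 1 + b') - (c' 0 0 * p 0 0 + c' 0 1 * p 0 1 + b')))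
    - (r 0 0 - p 0 0) * ((c 0 0 * q 0 0 + c 0 1 * q 0 1 + b) - (c 0 0 * p 0 0 + c 0 1 * p 0 1 + b)
    - ((c' 0 0 * q 0 0 + c' 0 1 * q 0 1 + b') - (c' 0 0 * p 0 0 + c' 0 1 * p 0 1 + b')))).
    by rewrite /D; ring.
  by rewrite Ep Eq Er; ring.
have cc : c = c'.
  apply: row2P; apply: subr0_eq; apply: (mulfI D0); rewrite mulr0 //.
by split=> //; move: Ep; rewrite cc => /addrI.
Qed.

(** An affine function is determined by its values on a two-dimensional set,
    so a larger domain of linearity carries the same one. *)
Lemma contact_cell c b : below c b -> two_dimensional (contact c b) ->
  cell u (contact c b).
Proof.
move=> cb dim2; split=> //.
  split; [by move=> p []|exact: contact_convex|by exists c, b => p []].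
move=> P [PQ3 _ [c' [b' PE]]] sub.
apply/seteqP; split=> // p Pp; split; first exact: PQ3.
have [q1 [q2 [q3 [h1 h2 h3 nc]]]] := dim2.
have E q : contact c b q -> dot c' q + b' = dot c q + b.
  by move=> cq; rewrite -(PE _ (sub _ cq)); case: cq.
have [<- <-] := aff_unique nc (E _ h1) (E _ h2) (E _ h3).
exact: PE.
Qed.

Lemma combines_mix l m p q (t : R) : 0 <= t <= 1 -> combines l p -> combines m q ->
  combines (fun w => (1 - t) * l w + t * m w) ((1 - t) *: p + t *: q).
Proof.
case/andP => t0 t1 [l0 l1 ->] [m0 m1 ->]; split.
- by move=> w; rewrite addr_ge0 // mulr_ge0 // subr_ge0.
- by rewrite big_split /= -!mulr_sumr l1 m1 !mulr1 subrK.
- rewrite !scaler_sumr -big_split; apply: eq_bigr => w _ /=.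
  by rewrite [RHS]scalerDl !scalerA.
Qed.

Lemma LC_mix p q (t : R) : 0 <= t <= 1 -> Q3 p -> Q3 q ->
  LC u ((1 - t) *: p + t *: q) <= (1 - t) * LC u p + t * LC u q.
Proof.
move=> t01 /Q3_combines/(LC_attained u)[l [lp <- _]] /Q3_combines/(LC_attained u)[m [mq <- _]].
apply: le_trans (LC_le (combines_mix t01 lp mq)) _.
rewrite /cost !mulr_sumr -big_split; apply: ler_sum => w _.
by rewrite mulrDl !mulrA.
Qed.

Lemma dotDr c p q : dot c (p + q) = dot c p + dot c q.
Proof. by rewrite !dotE !mxE; ring. Qed.

Lemma dotZr c p (t : R) : dot c (t *: p) = t * dot c p.
Proof. by rewrite !dotE !mxE; ring. Qed.

Lemma convex3 Q p q r (x y z : R) : is_convex Q -> Q p -> Q q -> Q r ->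
  0 <= x -> 0 <= y -> 0 <= z -> x + y + z = 1 -> Q (x *: p + y *: q + z *: r).
Proof.
move=> Qconv Qp Qq Qr x0 y0 z0 xyz; apply: Qconv.
exists 3%N, (fun i : 'I_3 => if i == 0 then x else if i == 1 then y else z),
  (fun i : 'I_3 => if i == 0 then p else if i == 1 then q else r).
by split; [apply: ord3P|rewrite !big_ord_recr big_ord0 /= add0r|apply: ord3P|
  rewrite !big_ord_recr big_ord0 /= add0r].
Qed.

(** A convex function which is affine on a two-dimensional set lies above that
    affine function everywhere, because an interior point of the set lies
    strictly between any given point and another point of the set. The contact
    set is then a domain of linearity containing the cell, and equals it by
    maximality. *)
Lemma cell_contact Q : cell u Q -> exists c b, below c b /\ Q = contact c b.
Proof.
case=> -[p [q [r [Qp Qq Qr nc]]]] [QQ3 Qconv [c [b QE]]] Qmax.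
have LCge x : Q3 x -> dot c x + b <= LC u x.
  move=> Q3x.
  have [s [t xE]] : exists s t, x = p + s *: (q - p) + t *: (r - p).
    have D0 := nc; move/noncollinearE: D0; set D := (X in X != 0) => D0.
    exists (((x 0 0 - p 0 0) * (r 0 1 - p 0 1) - (x 0 1 - p 0 1) * (r 0 0 - p 0 0)) / D).
    exists (((q 0 0 - p 0 0) * (x 0 1 - p 0 1) - (q 0 1 - p 0 1) * (x 0 0 - p 0 0)) / D).
    by apply: row2P; rewrite !mxE /D; field.
  (* The centroid g of the triangle p, q, r lies on the segment from x to
     the point y = g + e (g - x), which belongs to the triangle when e is
     this small. *)
  pose e : R := (3 * (1 + `|s| + `|t|))^-1.
  have K0 : 0 < 3 * (1 + `|s| + `|t|) by rewrite mulr_gt0 // -addrA ltr_pwDl // addr_ge0.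
  have e0 : 0 < e by rewrite invr_gt0.
  have es : e * (1 + `|s| + `|t|) = 1 / 3.
    by rewrite /e; field; rewrite gt_eqF // -addrA ltr_pwDl // addr_ge0.
  have [s1 s2] : e * s <= e * `|s| /\ - (e * s) <= e * `|s|.
    by rewrite -mulrN !ler_pM2l // ler_norm -normrN ler_norm.
  have [t1 t2] : e * t <= e * `|t| /\ - (e * t) <= e * `|t|.
    by rewrite -mulrN !ler_pM2l // ler_norm -normrN ler_norm.
  rewrite !mulrDr mulr1 in es.
  pose g := (1 / 3) *: p + (1 / 3) *: q + (1 / 3) *: r.
  pose y := ((1 + e) / 3 - e + e * s + e * t) *: p + ((1 + e) / 3 - e * s) *: q
    + ((1 + e) / 3 - e * t) *: r.
  have Qg : Q g by apply: convex3 => //; lra.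
  have Qy : Q y by apply: convex3 => //; move: s1 s2 t1 t2 es e0; clear; move=> *; lra.
  pose k := e / (1 + e).
  have e1 : 1 + e != 0 by rewrite gt_eqF // addr_gt0.
  have k0 : 0 < k by rewrite divr_gt0 // addr_gt0.
  have k1 : k <= 1 by rewrite ler_pdivrMr ?addr_gt0 // mul1r lerDr.
  have gE : g = (1 - k) *: y + k *: x.
    by apply: row2P; rewrite /g /y /k xE !mxE; field.
  have := @LC_mix y x k; rewrite -gE (ltW k0) k1 => /(_ isT (QQ3 _ Qy) Q3x).
  rewrite (QE _ Qg) (QE _ Qy) {1}gE dotDr !dotZr => ineq.
  rewrite -(ler_pM2l k0); move: ineq; move: (dot c x) (dot c y) (LC u x); clear; move=> *; lra.
have cb : below c b.
  move=> w; apply: le_trans (LC_pt_le w); apply: LCge.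
  exact: combines_Q3 (combines_pt R w).
exists c, b; split=> //; apply/esym; apply: Qmax.
  by split; [move=> x []|exact: contact_convex|exists c, b => x []].
by move=> x Qx; split; [exact: QQ3|exact: QE].
Qed.

End Contact.

(** * Cells around (1,1) *)

Lemma same_ray_finite : all9 (fun j => all9 (fun k =>
  Z.eqb (zdet j k) 0 && Z.leb 0 (Z.add (Z.mul (zdir j).1 (zdir k).1)
    (Z.mul (zdir j).2 (zdir k).2)) ==> (j == k))).
Proof. by vm_compute. Qed.

Section SameRay.
Variable R : realFieldType.
Local Notation dx := (dirx R).
Local Notation dy := (diry R).

Lemma same_ray j k (t : R) : (j < 9)%N -> (k < 9)%N -> 0 <= t ->
  dx j = t * dx k -> dy j = t * dy k -> j = k.
Proof.
move=> j9 k9 t0 ex ey.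
have := all9P (all9P same_ray_finite j9) k9.
have -> : Z.eqb (zdet j k) 0.
  apply/Z.eqb_eq; apply: (can_inj int_of_ZK); apply/eqP.
  by rewrite -(eqr_int R) zdetE /dirdet ex ey; apply/eqP; ring.
suff -> : Z.leb 0 (Z.add (Z.mul (zdir j).1 (zdir k).1) (Z.mul (zdir j).2 (zdir k).2)).
  by move/eqP.
have h : 0 <= (int_of_Z (Z.add (Z.mul (zdir j).1 (zdir k).1)
    (Z.mul (zdir j).2 (zdir k).2)))%:~R :> R.
  rewrite int_of_ZD !int_of_ZM intrD !intrM (zdirE R j).1 (zdirE R j).2.
  rewrite (zdirE R k).1 (zdirE R k).2 ex ey -!mulrA -mulrDr mulr_ge0 //.
  by rewrite addr_ge0 // -expr2 sqr_ge0.
by rewrite ler0z in h; lia.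
Qed.

(** A zero direction would lie on every ray. *)
Lemma dir_neq0 k : (k < 9)%N -> 0 < dx k ^+ 2 + dy k ^+ 2.
Proof.
move=> k9; rewrite lt_neqAle addr_ge0 ?sqr_ge0 // andbT eq_sym.
rewrite paddr_eq0 ?sqr_ge0 // !sqrf_eq0; apply/negP => /andP[/eqP x0 /eqP y0].
have k0 : k = 0%N by apply: (@same_ray k 0 0); rewrite ?x0 ?y0 ?mul0r.
have k1 : k = 1%N by apply: (@same_ray k 1 0); rewrite ?x0 ?y0 ?mul0r.
by rewrite k0 in k1.
Qed.

End SameRay.

Section FanCells.
Variables (R : realType) (u : A3 -> R).
Implicit Types (p q c : 'rV[R]_2) (v : R * R) (Q : set 'rV[R]_2).
Local Notation pt := (@pt R).
Local Notation w := (fun k => u (latpt k)).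
Local Notation dx := (dirx R).
Local Notation dy := (diry R).
Local Notation center := (vec 1 1 : 'rV[R]_2).

Lemma pt_latpt k : (k < 10)%N -> pt (latpt k) = vec (1 + dx k) (1 + dy k).
Proof.
move=> k10; have [ex ey] := latptE k10.
by rewrite /pt ex ey /dirx /diry; congr vec; rewrite addrC subrK.
Qed.

Lemma dx9 : dx 9 = 0. Proof. by rewrite /dirx /= subrr. Qed.
Lemma dy9 : dy 9 = 0. Proof. by rewrite /diry /= subrr. Qed.

Lemma pt_center : pt (latpt 9) = center.
Proof. by rewrite pt_latpt // dx9 dy9 !addr0. Qed.

Lemma pt_center_neq k : (k < 9)%N -> pt (latpt k) <> center.
Proof.
move=> k9; rewrite pt_latpt 1?ltnW // => E.
have [e0 e1] : dx k = 0 /\ dy k = 0.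
  have := (congr1 (fun p => p 0 0) E, congr1 (fun p => p 0 1) E).
  rewrite /= !(vecE _ _).1 !(vecE _ _).2 => -[h0 h1]; split; lra.
by have := dir_neq0 R k9; rewrite e0 e1 expr0n addr0 ltxx.
Qed.

Lemma dot_pt c k : (k < 10)%N ->
  dot c (pt (latpt k)) = dot c center + (c 0 0 * dx k + c 0 1 * dy k).
Proof.
by move=> k10; rewrite pt_latpt // !dotE !(vecE _ _).1 !(vecE _ _).2; ring.
Qed.

Lemma sum_boundary (f : A3 -> R) : \sum_x f x = \sum_(0 <= k < 9) f (latpt k) + f (latpt 9).
Proof. by rewrite sum_lattice big_nat_recr. Qed.

Lemma combines_dir l p c : combines l p ->
  dot c p - dot c center = \sum_(0 <= k < 9) l (latpt k) * (c 0 0 * dx k + c 0 1 * dy k).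
Proof.
move=> lp; rewrite (combines_aff c (- dot c center) lp) sum_boundary pt_center subrr.
rewrite mulr0 addr0; apply: eq_big_nat => k /andP[_ k9].
by rewrite dot_pt 1?ltnW //; ring.
Qed.

(** At a cell with vertex (1,1) subtract the affine function: all gaps become
    nonnegative and the gap at (1,1) becomes zero. The linear form exposing
    the vertex is positive in every boundary direction marked in the cell, so
    a relation between directions cannot involve marked ones only, and its
    total gap is positive. *)
Lemma has_cycle_interior : has_cycle u -> interior w.
Proof.
case=> Q [cQ [c' fE]].
have [c [b [cb QE]]] := cell_contact cQ.
have [Qc minc] : Q center /\ forall q, Q q -> dot c' center <= dot c' q.
  by have : [set center]%classic center by []; rewrite fE.
have face p : Q p -> dot c' p <= dot c' center -> p = center.
  move=> Qp pc; have : [set center]%classic p; last by [].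
  by rewrite fE; split=> // q /minc; apply: le_trans.
have gap_ge0 k : 0 <= u (latpt k) - (dot c (pt (latpt k)) + b) by rewrite subr_ge0 cb.
have markQ k : u (latpt k) = dot c (pt (latpt k)) + b -> Q (pt (latpt k)).
  by move=> h; rewrite QE; apply: contact_pt.
have tight_dir k : (k < 9)%N -> u (latpt k) = dot c (pt (latpt k)) + b ->
    0 < c' 0 0 * dx k + c' 0 1 * dy k.
  move=> k9 /markQ Qk; have k10 : (k < 10)%N by apply: ltnW.
  rewrite ltNge; apply/negP => h; apply: (pt_center_neq k9); apply: face => //.
  by rewrite dot_pt // gerDl.
have center_tight : u (latpt 9) = dot c center + b.
  have [l lp lu] := (contactP center cb).1 (eq_ind _ (fun S : set _ => S center) Qc _ QE).
  have [l9|l9] := eqVneq (l (latpt 9)) 0; last by rewrite (lu _ l9) pt_center.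
  have := combines_dir c' lp; rewrite subrr => S0.
  have nn k : (k < 9)%N -> 0 <= l (latpt k) * (c' 0 0 * dx k + c' 0 1 * dy k).
    move=> k9; have [->|/lu tk] := eqVneq (l (latpt k)) 0; first by rewrite mul0r.
    by apply: mulr_ge0; [case: lp|apply/ltW/tight_dir].
  have lz k : (k < 9)%N -> l (latpt k) = 0.
    move=> k9; apply/eqP; apply: contraT => lk.
    have : l (latpt k) * (c' 0 0 * dx k + c' 0 1 * dy k) = 0.
      move/esym/eqP: S0; rewrite big_mkord psumr_eq0 => [/allP/(_ (Ordinal k9)
        (mem_index_enum _))/eqP//|].
      by move=> i _; apply: nn.
    by move/eqP; rewrite mulf_eq0 (negbTE lk) gt_eqF // tight_dir // lu.
  have [_ l1 _] := lp; move: l1; rewrite sum_boundary l9 addr0 big_nat big1 => [/eqP|k /andP[_]].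
    by rewrite eq_sym oner_eq0.
  exact: lz.
move=> C C0 ex ey [k0 k09 Ck0].
have E : \sum_(0 <= k < 9) C k * (u (latpt k) - u (latpt 9)) =
    \sum_(0 <= k < 9) C k * (u (latpt k) - (dot c (pt (latpt k)) + b)).
  apply/eqP; rewrite -subr_eq0 -sumrB; apply/eqP.
  transitivity (c 0 0 * \sum_(0 <= k < 9) C k * dx k + c 0 1 * \sum_(0 <= k < 9) C k * dy k).
    rewrite !mulr_sumr -big_split; apply: eq_big_nat => k /andP[_ k9] /=.
    by rewrite dot_pt 1?ltnW // center_tight; ring.
  by rewrite ex ey !mulr0 addr0.
rewrite E lt_neqAle; apply/andP; split; last by apply: sumr_ge0 => k _; rewrite mulr_ge0.
apply/negP => /eqP/esym S0.
have Cgap k : (k < 9)%N -> C k != 0 -> u (latpt k) = dot c (pt (latpt k)) + b.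
  move=> k9 Ck; apply/eqP; rewrite -subr_eq0.
  move/eqP: S0; rewrite big_mkord psumr_eq0 => [|i _]; last by rewrite mulr_ge0.
  by move=> /allP/(_ (Ordinal k9) (mem_index_enum _)); rewrite /= mulf_eq0 (negbTE Ck).
have S1 : \sum_(0 <= k < 9) C k * (c' 0 0 * dx k + c' 0 1 * dy k) = 0.
  transitivity (c' 0 0 * \sum_(0 <= k < 9) C k * dx k + c' 0 1 * \sum_(0 <= k < 9) C k * dy k).
    by rewrite !mulr_sumr -big_split; apply: eq_bigr => k _ /=; ring.
  by rewrite ex ey !mulr0 addr0.
move/eqP: S1; rewrite big_mkord psumr_eq0 => [|i _].
  move=> /allP/(_ (Ordinal k09) (mem_index_enum _)); rewrite /= mulf_eq0 (negbTE Ck0) /=.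
  by rewrite gt_eqF // tight_dir // Cgap.
have [->|/Cgap tk] := eqVneq (C i) 0; first by rewrite mul0r.
by apply: mulr_ge0 => //; apply/ltW/tight_dir => //; apply: tk.
Qed.

Hypothesis hw : interior w.

Lemma LC_center : LC u center = u (latpt 9).
Proof.
apply/eqP; rewrite eq_le -{1}pt_center LC_pt_le /=.
have [|l [lp <- _]] := @LC_attained _ u center.
  by exists (fun x => (x == latpt 9)%:R); rewrite -pt_center; apply: combines_pt.
have cE : cost u l = u (latpt 9) + \sum_(0 <= k < 9) l (latpt k) * (u (latpt k) - u (latpt 9)).
  have [_ l1 _] := lp.
  rewrite -[X in X + _]mul1r -l1 mulr_suml /cost !sum_boundary addrAC; congr (_ + _).
  by rewrite -big_split; apply: eq_bigr => k _ /=; ring.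
rewrite cE lerDl.
have dirs (c : 'rV[R]_2) : \sum_(0 <= k < 9) l (latpt k) * (c 0 0 * dx k + c 0 1 * dy k) = 0.
  by rewrite -(combines_dir c lp) subrr.
have [[k k9 lk]|N] := pselect (exists2 k, (k < 9)%N & l (latpt k) != 0).
  apply: ltW; apply: (hw (c := fun k => l (latpt k))).
  - by move=> j; case: lp.
  - rewrite -[RHS](dirs (vec 1 0)); apply: eq_bigr => j _.
    by rewrite (vecE _ _).1 (vecE _ _).2 mul1r mul0r addr0.
  - rewrite -[RHS](dirs (vec 0 1)); apply: eq_bigr => j _.
    by rewrite (vecE _ _).1 (vecE _ _).2 mul1r mul0r add0r.
  - by exists k.
rewrite big_nat big1 // => k /andP[_ k9].
have [->|lk] := eqVneq (l (latpt k)) 0; first by rewrite mul0r.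
by case: N; exists k.
Qed.

(** The contact set of the affine function with slope -V through the lifted
    point (1,1): the candidate for the cell dual to the point V = [v]. *)
Definition cellv v : set 'rV[R]_2 :=
  contact u (- vec v.1 v.2) (u (latpt 9) + v.1 + v.2).

Lemma cellv_gap v k : (k < 10)%N ->
  u (latpt k) - (dot (- vec v.1 v.2) (pt (latpt k)) + (u (latpt 9) + v.1 + v.2)) =
  slack w k v.1 v.2.
Proof.
move=> k10; rewrite dot_pt // dotE ![(- _ : 'rV[R]_2) _ _]mxE !(vecE _ _).1 !(vecE _ _).2 /slack.
by ring.
Qed.

Lemma slack9 v : slack w 9 v.1 v.2 = 0.
Proof. by rewrite /slack dx9 dy9 subrr !mul0r !addr0. Qed.

Lemma below_feasible v : feasible w v.1 v.2 <->
  below u (- vec v.1 v.2) (u (latpt 9) + v.1 + v.2).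
Proof.
split=> [fv x|bv k k9]; last by rewrite -cellv_gap ?subr_ge0 1?ltnW //; apply: bv.
have [k k10 ->] := latpt_surj x; rewrite -subr_ge0 cellv_gap //.
have [k9|k9] := ltnP k 9; first exact: fv.
by have -> : k = 9%N by [lia|]; rewrite slack9.
Qed.

Lemma cellv_mark v k : (k < 10)%N ->
  u (latpt k) = dot (- vec v.1 v.2) (pt (latpt k)) + (u (latpt 9) + v.1 + v.2) <->
  tight w k v.1 v.2.
Proof.
move=> k10; rewrite /tight -cellv_gap //; split; first by move=> <-; rewrite subrr.
by move/eqP; rewrite subr_eq0 => /eqP.
Qed.

Lemma cellvP v p : feasible w v.1 v.2 -> cellv v p <->
  exists2 l, combines l p & forall k, (k < 9)%N -> l (latpt k) != 0 -> tight w k v.1 v.2.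
Proof.
move=> /below_feasible bv; split=> [/(contactP p bv).1[l lp lu]|[l lp lt]].
  by exists l => // k k9 /lu /cellv_mark; apply; apply: ltnW.
apply/(contactP p bv); exists l => // x lx; have [k k10 xE] := latpt_surj x.
rewrite xE; apply/cellv_mark => //; have [k9|k9] := ltnP k 9.
  by apply: lt => //; rewrite -xE.
by have -> : k = 9%N by [lia|]; exact: slack9.
Qed.

Lemma cellv_pt v k : feasible w v.1 v.2 -> (k < 10)%N -> tight w k v.1 v.2 ->
  cellv v (pt (latpt k)).
Proof.
by move=> /below_feasible bv k10 tk; apply: contact_pt => //; apply/cellv_mark.
Qed.

Lemma cellv_center v : feasible w v.1 v.2 -> cellv v center.
Proof. by move=> fv; rewrite -pt_center; apply: cellv_pt => //; exact: slack9. Qed.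

Lemma cellv_marking v x : feasible w v.1 v.2 ->
  marking u (cellv v) x <-> exists k, [/\ (k < 10)%N, x = latpt k & tight w k v.1 v.2].
Proof.
move=> /below_feasible bv; rewrite /cellv.
have [k k10 ->] := latpt_surj x.
split=> [/(contact_marking _ bv) /cellv_mark tk|[j [j10 -> tj]]].
  by exists k; split=> //; apply: tk.
by apply/(contact_marking _ bv)/cellv_mark.
Qed.

(** The slope of the affine function touching along the cell gives the dual
    vertex. *)
Lemma cell_center Q : cell u Q -> Q center ->
  exists2 v, feasible w v.1 v.2 & Q = cellv v.
Proof.
move=> cQ Qc; have [c [b [cb QE]]] := cell_contact cQ.
have bE : b = u (latpt 9) + - c 0 0 + - c 0 1.
  move: Qc; rewrite QE => -[_]; rewrite LC_center dotE !(vecE _ _).1 !(vecE _ _).2 => E.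
  by rewrite E; ring.
have cE : c = - vec (- c 0 0) (- c 0 1).
  by apply: row2P; rewrite !mxE opprK.
exists (- c 0 0, - c 0 1); last by rewrite /cellv /= -bE -cE.
by apply/below_feasible; rewrite /= -bE -cE.
Qed.

Lemma cellv_cell v i j : feasible w v.1 v.2 -> (i < 9)%N -> (j < 9)%N ->
  tight w i v.1 v.2 -> tight w j v.1 v.2 -> 0 < dirdet R i j -> cell u (cellv v).
Proof.
move=> fv i9 j9 ti tj dij; apply: contact_cell; first exact/below_feasible.
exists center, (pt (latpt i)), (pt (latpt j)); split.
- exact: cellv_center.
- by apply: cellv_pt => //; apply: ltnW.
- by apply: cellv_pt => //; apply: ltnW.
apply/noncollinearE; rewrite !pt_latpt 1?ltnW // !(vecE _ _).1 !(vecE _ _).2.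
rewrite ![1 + _]addrC !addrK; apply: lt0r_neq0; exact: dij.
Qed.

(** If all tight directions were parallel, the cell would be contained in a
    line through (1,1). *)
Lemma cell_two_tight v : feasible w v.1 v.2 -> two_dimensional (cellv v) ->
  exists i j, [/\ (i < 9)%N, (j < 9)%N, tight w i v.1 v.2, tight w j v.1 v.2 & 0 < dirdet R i j].
Proof.
move=> fv [p [q [r [cp cq cr /noncollinearE nc]]]]; apply: contrapT => N.
have par i j : (i < 9)%N -> (j < 9)%N -> tight w i v.1 v.2 -> tight w j v.1 v.2 -> dirdet R i j = 0.
  move=> i9 j9 ti tj; apply/eqP; rewrite eq_le !leNgt; apply/andP; split; apply/negP => h.
    by apply: N; exists i, j.
  by apply: N; exists j, i; split=> //; rewrite /dirdet in h *; lra.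
have line c x : cellv v x -> (forall j, (j < 9)%N -> tight w j v.1 v.2 -> c 0 0 * dx j +
  c 0 1 * dy j = 0) ->
    dot c x - dot c center = 0.
  move=> /(cellvP x fv)[l lx lt] H; rewrite (combines_dir c lx) big_nat big1 // => k /andP[_ k9].
  by have [->|/lt tk] := eqVneq (l (latpt k)) 0; rewrite ?mul0r // H ?mulr0 //; apply: tk.
have [[i [i9 ti]]|none] := pselect (exists i, (i < 9)%N /\ tight w i v.1 v.2).
  pose c := vec (- dy i) (dx i) : 'rV[R]_2.
  have H j : (j < 9)%N -> tight w j v.1 v.2 -> c 0 0 * dx j + c 0 1 * dy j = 0.
    by move=> j9 tj; have := par _ _ i9 j9 ti tj; rewrite /c (vecE _ _).1 (vecE _ _).2
      /dirdet => <-; ring.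
  have := (line c _ cp H, line c _ cq H, line c _ cr H).
  rewrite !dotE /c !(vecE _ _).1 !(vecE _ _).2 => -[[hp hq] hr].
  have d0 := dir_neq0 R i9.
  case/eqP: nc; apply: (mulfI (lt0r_neq0 d0)); rewrite mulr0.
  set a0 := q 0 0 - p 0 0; set a1 := q 0 1 - p 0 1.
  set b0 := r 0 0 - p 0 0; set b1 := r 0 1 - p 0 1.
  have ha : dx i * a1 = dy i * a0 by rewrite /a0 /a1; lra.
  have hb : dx i * b1 = dy i * b0 by rewrite /b0 /b1; lra.
  have z1 : a0 * (dx i * b1) - b0 * (dx i * a1) = 0 by rewrite ha hb; ring.
  have z2 : dy i * a0 * b1 - a1 * (dy i * b0) = 0 by rewrite -ha -hb; ring.
  transitivity (dx i * (a0 * (dx i * b1) - b0 * (dx i * a1)) +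
    dy i * (dy i * a0 * b1 - a1 * (dy i * b0))); last by rewrite z1 z2 !mulr0 addr0.
  move: (dx i) (dy i) a0 a1 b0 b1 {z1 z2 ha hb d0 H hp hq hr c ti} => x y a0 a1 b0 b1.
  by ring.
have all_center x : cellv v x -> x = center.
  move=> cx; apply: row2P; apply: subr0_eq.
    have := line (vec 1 0) _ cx; rewrite !dotE !(vecE _ _).1 !(vecE _ _).2 !mul1r !mul0r !addr0.
    by apply=> j j9 tj; case: none; exists j.
  have := line (vec 0 1) _ cx; rewrite !dotE !(vecE _ _).1 !(vecE _ _).2 !mul1r !mul0r !add0r.
  by apply=> j j9 tj; case: none; exists j.
by case/eqP: nc; rewrite (all_center _ cp) (all_center _ cq) !subrr !mul0r subrr.
Qed.

End FanCells.

(** * Edges emanating from (1,1) *)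

(** A direction strictly on the left of d_k is not on the right of d_(k+1),
    and symmetrically for d_(k-1). *)
Lemma det_next_finite : all9 (fun k => all9 (fun j =>
  (Z.ltb 0 (zdet k j) ==> Z.leb 0 (zdet (cyc_next k) j)) &&
  (Z.ltb 0 (zdet j k) ==> Z.leb 0 (zdet j (cyc_prev k))))).
Proof. by vm_compute. Qed.

Section Spokes.
Variables (R : realType) (u : A3 -> R).
Implicit Types (p q c : 'rV[R]_2) (v : R * R) (Q : set 'rV[R]_2).
Local Notation pt := (@pt R).
Local Notation w := (fun k => u (latpt k)).
Local Notation dx := (dirx R).
Local Notation dy := (diry R).
Local Notation det := (dirdet R).
Local Notation center := (vec 1 1 : 'rV[R]_2).
Local Notation cellv := (cellv u).
Hypothesis hw : interior w.

Lemma det_next k : (k < 9)%N -> det k (cyc_next k) = 1.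
Proof. by move=> k9; rewrite -zdetE; have /Z.eqb_eq -> := all9P zdet_next k9. Qed.

Lemma det_opp i j : det i j = - det j i.
Proof. by rewrite /dirdet; ring. Qed.

Lemma Zltb_det i j : 0 < det i j -> Z.ltb 0 (zdet i j).
Proof. by rewrite -zdetE ltr0z => h; lia. Qed.

Lemma pairing_inj k v v' : (k < 9)%N -> pairing k v = pairing k v' ->
  pairing (cyc_next k) v = pairing (cyc_next k) v' -> v = v'.
Proof.
move=> k9; have := det_next k9; rewrite /pairing /dirdet.
case: v v' => [x y] [x' y'] /= d1 e1 e2.
set a := dirx R k in d1 e1; set b := diry R k in d1 e1.
set a' := dirx R (cyc_next k) in d1 e2; set b' := diry R (cyc_next k) in d1 e2.
congr pair.
  rewrite -[x]mul1r -[x']mul1r -d1.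
  transitivity (b' * (a * x + b * y) - b * (a' * x + b' * y)); first by ring.
  by rewrite e1 e2; ring.
rewrite -[y]mul1r -[y']mul1r -d1.
transitivity (a * (a' * x + b' * y) - a' * (a * x + b * y)); first by ring.
by rewrite e1 e2; ring.
Qed.

(** The form d_k is a nonnegative combination of d_i and d_j, and both slacks
    vanish at [v]. *)
Lemma tight_min i j k v v' : feasible w v'.1 v'.2 -> (i < 9)%N -> (j < 9)%N ->
  tight w i v.1 v.2 -> tight w j v.1 v.2 -> 0 < det i j -> 0 <= det k j -> 0 <= det i k ->
  pairing k v <= pairing k v'.
Proof.
move=> fv' i9 j9 ti tj dij kj ik.
rewrite -subr_ge0 -(pmulr_rge0 _ dij) (cone_pairing _ _ ti tj).
by rewrite addr_ge0 // mulr_ge0 // fv'.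
Qed.

(** Two opposite directions are a relation between boundary points, so the sum
    of their slacks is positive. *)
Lemma opposite_not_tight j k v : (j < 9)%N -> (k < 9)%N -> tight w j v.1 v.2 ->
  tight w k v.1 v.2 -> det k j = 0 -> j = k.
Proof.
move=> j9 k9 tj tk d0; have n0 := dir_neq0 R k9.
pose t := (dx j * dx k + dy j * dy k) / (dx k ^+ 2 + dy k ^+ 2).
have djk : dx k * dy j = dy k * dx j by apply: subr0_eq.
have ex : dx j = t * dx k.
  apply: (mulIf (lt0r_neq0 n0)); rewrite /t mulrAC divfK ?lt0r_neq0 //.
  apply: subr0_eq; transitivity (dy k * (dy k * dx j - dx k * dy j)); first by ring.
  by rewrite djk subrr mulr0.
have ey : dy j = t * dy k.
  apply: (mulIf (lt0r_neq0 n0)); rewrite /t mulrAC divfK ?lt0r_neq0 //.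
  apply: subr0_eq; transitivity (dx k * (dx k * dy j - dy k * dx j)); first by ring.
  by rewrite djk subrr mulr0.
have [t0|t0] := leP 0 t; first exact: same_ray ex ey.
have := @interior3 R w hw k k j (- t) 0 1 v.1 v.2 k9 k9 j9.
rewrite tj tk !mulr0 !addr0 ltxx oppr_ge0 ltW // => /(_ isT (lexx _) ltr01) H.
have : false by apply: H; rewrite ?ex ?ey; ring.
by [].
Qed.

Lemma hull2_dir k p : (k < 9)%N -> convex_hull [set center; pt (latpt k)] p ->
  exists2 t, 0 <= t & forall c, dot c p - dot c center = t * (c 0 0 * dx k + c 0 1 * dy k).
Proof.
move=> k9 /(@hull_combines _ _ (fun x => x = latpt 9 \/ x = latpt k))[q|l lp lz].
  by case=> ->; [exists (latpt 9); [left|rewrite pt_center]|exists (latpt k); [right|]].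
exists (l (latpt k)); first by case: lp.
move=> c; rewrite (combines_dir c lp) (bigD1_seq k) ?mem_index_iota ?iota_uniq //=.
rewrite big_seq_cond big1 ?addr0 // => j /andP[]; rewrite mem_index_iota => /andP[_ j9] jk.
rewrite lz ?mul0r // => -[] E.
  by move: (j9); rewrite (@latpt_inj j 9 (ltnW j9) isT E).
by move: jk; rewrite (latpt_inj (ltnW j9) (ltnW k9) E) eqxx.
Qed.

(** The linear form exposing the edge vanishes on d_k and is positive on the
    other tight directions, which therefore all lie on one side of d_k; the
    sign of [tau] tells on which. *)
Lemma edge_side v k : feasible w v.1 v.2 -> two_dimensional (cellv v) -> (k < 9)%N ->
  is_edge (cellv v) center (pt (latpt k)) ->
  tight w k v.1 v.2 /\
  exists2 tau : R, tau != 0 & forall j, (j < 9)%N -> tight w j v.1 v.2 -> j != k ->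
    0 < tau * det k j.
Proof.
move=> fv dim2 k9 [_ [c fE]]; have k10 : (k < 10)%N by apply: ltnW.
set H := convex_hull _ in fE.
have Hc : H center.
  apply: (@combines_hull _ _ (fun x => (x == latpt 9)%:R)).
    by rewrite -pt_center; apply: combines_pt.
  by move=> x; rewrite pnatr_eq0 eqb0 negbK => /eqP->; left; exact: pt_center.
have Hk : H (pt (latpt k)).
  apply: (@combines_hull _ _ (fun x => (x == latpt k)%:R)); first exact: combines_pt.
  by move=> x; rewrite pnatr_eq0 eqb0 negbK => /eqP->; right.
have face p : H p <-> cellv v p /\ forall q, cellv v q -> dot c p <= dot c q.
  by rewrite fE.
have [Cc minc] := (face _).1 Hc; have [Ck mink] := (face _).1 Hk.
have ck0 : c 0 0 * dx k + c 0 1 * dy k = 0.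
  have : dot c (pt (latpt k)) = dot c center by apply/eqP; rewrite eq_le mink // minc.
  by rewrite dot_pt // => /eqP; rewrite -subr_eq0 addrAC subrr add0r => /eqP.
have cj j : (j < 9)%N -> tight w j v.1 v.2 -> 0 <= c 0 0 * dx j + c 0 1 * dy j.
  move=> j9 tj; have := minc _ (cellv_pt fv (ltnW j9) tj).
  by rewrite dot_pt 1?ltnW // lerDl.
have cj0 j : (j < 9)%N -> tight w j v.1 v.2 -> c 0 0 * dx j + c 0 1 * dy j = 0 -> j = k.
  move=> j9 tj z; have Hj : H (pt (latpt j)).
    apply/face; split; first by apply: cellv_pt => //; apply: ltnW.
    by move=> q; rewrite dot_pt 1?ltnW // z addr0; apply: minc.
  have [t t0 tE] := hull2_dir k9 Hj.
  apply: (@same_ray R j k t) => //.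
    have := tE (vec 1 0); rewrite dot_pt 1?ltnW // (vecE _ _).1 (vecE _ _).2.
    by rewrite !mul1r !mul0r !addr0 addrAC subrr add0r.
  have := tE (vec 0 1); rewrite dot_pt 1?ltnW // (vecE _ _).1 (vecE _ _).2.
  by rewrite !mul1r !mul0r !add0r addrAC subrr add0r.
have tk : tight w k v.1 v.2.
  have [l lp lt] := (cellvP (pt (latpt k)) fv).1 Ck.
  have [lk|lk] := eqVneq (l (latpt k)) 0; last exact: lt.
  have lz j : (j < 9)%N -> l (latpt j) = 0.
    move=> j9; apply/eqP; apply: contraT => lj.
    have := combines_dir c lp; rewrite dot_pt // ck0 addr0 subrr => /esym/eqP.
    rewrite big_mkord psumr_eq0 => [|i _].
      move=> /allP/(_ (Ordinal j9) (mem_index_enum _)); rewrite /= mulf_eq0 (negbTE lj) /=.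
      move=> /eqP /(cj0 _ j9 (lt _ j9 lj)) jk.
      by rewrite jk lk eqxx in lj.
    have [->|li] := eqVneq (l (latpt i)) 0; first by rewrite mul0r.
    by apply: mulr_ge0; [case: lp|apply: cj => //; apply: lt].
  exfalso; apply: (@pt_center_neq R _ k9).
  by apply: row2P; apply: subr0_eq;
    [have := combines_dir (vec 1 0) lp|have := combines_dir (vec 0 1) lp];
    rewrite big_nat big1 => [|i /andP[_ /lz ->]]; rewrite ?mul0r // !dotE !mxE /= ?mul1r
      ?mul0r ?addr0 ?add0r.
split=> //.
pose tau := c 0 1 * dx k - c 0 0 * dy k; have n0 := dir_neq0 R k9.
have tauE j : tau * det k j = (dx k ^+ 2 + dy k ^+ 2) * (c 0 0 * dx j + c 0 1 * dy j).
  transitivity ((dx k ^+ 2 + dy k ^+ 2) * (c 0 0 * dx j + c 0 1 * dy j) -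
     (c 0 0 * dx k + c 0 1 * dy k) * (dx k * dx j + dy k * dy j)).
    by rewrite /tau /dirdet; ring.
  by rewrite ck0 mul0r subr0.
have pos j : (j < 9)%N -> tight w j v.1 v.2 -> j != k -> 0 < tau * det k j.
  move=> j9 tj jk; rewrite tauE pmulr_rgt0 // lt_neqAle cj // andbT eq_sym.
  by apply: contra jk => /eqP /(cj0 _ j9 tj) ->.
exists tau => //.
have [i [j [i9 j9 ti tj dij]]] := cell_two_tight fv dim2.
have [ik|ik] := eqVneq i k.
  have jk : j != k by apply: contraTneq dij => ->; rewrite ik /dirdet mulrC subrr ltxx.
  by apply: contraTneq (pos _ j9 tj jk) => ->; rewrite mul0r ltxx.
by apply: contraTneq (pos _ i9 ti ik) => ->; rewrite mul0r ltxx.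
Qed.

(** Conversely, tau det(d_k, .) is a linear form exposing the edge. *)
Lemma side_edge v k (tau : R) : feasible w v.1 v.2 -> (k < 9)%N -> tight w k v.1 v.2 ->
  (forall j, (j < 9)%N -> tight w j v.1 v.2 -> j != k -> 0 < tau * det k j) ->
  is_edge (cellv v) center (pt (latpt k)).
Proof.
move=> fv k9 tk pos; have k10 : (k < 10)%N by apply: ltnW.
split; first by move=> E; apply: (@pt_center_neq R _ k9).
pose c : 'rV[R]_2 := vec (- tau * dy k) (tau * dx k); exists c.
have cdir j : c 0 0 * dx j + c 0 1 * dy j = tau * det k j.
  by rewrite /c (vecE _ _).1 (vecE _ _).2 /dirdet; ring.
have dkk : det k k = 0 by rewrite /dirdet mulrC subrr.
have Cmin q : cellv v q -> dot c center <= dot c q.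
  move=> /(cellvP q fv)[l lq lt]; rewrite -subr_ge0 (combines_dir c lq) big_nat.
  apply: sumr_ge0 => j /andP[_ j9]; rewrite cdir.
  have [->|lj] := eqVneq (l (latpt j)) 0; first by rewrite mul0r.
  apply: mulr_ge0; first by case: lq.
  have [->|jk] := eqVneq j k; first by rewrite dkk mulr0.
  by apply/ltW/pos => //; apply: lt.
apply/seteqP; split=> p.
  move=> Hp; have [t t0 tE] := hull2_dir k9 Hp; split.
    apply: (contact_convex ((below_feasible u v).1 fv)).
    have [n [l [s [l0 l1 sS ->]]]] := Hp; exists n, l, s; split=> // i.
    by case: (sS i) => ->; [exact: cellv_center|apply: cellv_pt].
  move=> q /Cmin; apply: le_trans.
  by rewrite -subr_le0 tE cdir dkk !mulr0.
case=> /(cellvP p fv)[l lp lt] /(_ _ (cellv_center fv)) le_pc.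
apply: (combines_hull lp) => x lx; have [j j10 xE] := latpt_surj x; rewrite {x}xE in lx *.
have [j9|j9] := ltnP j 9; last by left; have -> : j = 9%N by [lia|]; exact: pt_center.
have [->|jk] := eqVneq j k; first by right.
exfalso; move: le_pc; rewrite -subr_le0 (combines_dir c lp) leNgt => /negP; apply.
have nn i : (i < 9)%N -> 0 <= l (latpt i) * (c 0 0 * dx i + c 0 1 * dy i).
  move=> i9; rewrite cdir; have [->|li] := eqVneq (l (latpt i)) 0; first by rewrite mul0r.
  apply: mulr_ge0; first by case: lp.
  have [->|ik] := eqVneq i k; first by rewrite dkk mulr0.
  by apply/ltW/pos => //; apply: lt.
rewrite (bigD1_seq j) ?mem_index_iota ?iota_uniq //= ltr_wpDr //.
  rewrite big_seq_cond; apply: sumr_ge0 => i /andP[]; rewrite mem_index_iota => /andP[_ i9] _.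
  exact: nn.
rewrite cdir mulr_gt0 ?pos //; last exact: lt.
by rewrite lt_def lx; case: lp => l0 _ _; exact: l0.
Qed.

Variable V : nat -> R * R.
Hypothesis hV : forall k, (k < 9)%N -> fan_spec w k (V k).

Lemma fan_cell k : (k < 9)%N -> cell u (cellv (V k)).
Proof.
move=> k9; have [fv [i [j [i9 j9 /straddlesP -/(_ R)[dij _ _] ti tj]]]] := hV k9.
exact: cellv_cell ti tj dij.
Qed.

Lemma fan_cone k : (k < 9)%N -> exists i j, [/\ (i < 9)%N, (j < 9)%N,
  tight w i (V k).1 (V k).2, tight w j (V k).1 (V k).2 &
  [/\ 0 <= det i k, 0 < det k j, 0 < det i (cyc_next k) & 0 <= det (cyc_next k) j]].
Proof.
move=> k9; have [fv [i [j [i9 j9 ij ti tj]]]] := hV k9.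
have := all9P (all9P (all9P straddles_cone k9) i9) j9; rewrite ij.
case/and4P => /(Zleb_real R) + /(Zltb_real R) + /(Zltb_real R) + /(Zleb_real R).
by rewrite !zdetE; exists i, j.
Qed.

(** In a cell at an edge in direction d_k all other tight directions lie on
    one side. If it is the left one, the dual vertex minimizes both d_k and
    d_(k+1), hence is V_k; if it is the right one, it minimizes d_(k-1) and
    d_k, hence is V_(k-1). If these two vertices coincided, there would be
    tight directions on both sides. *)
Lemma spoke_cells Q k : (k < 9)%N -> cell u Q -> is_edge Q center (pt (latpt k)) ->
  edge_len V k != 0 /\ (Q = cellv (V k) \/ Q = cellv (V (cyc_prev k))).
Proof.
move=> k9 cQ eQ; have [p9 nE] := prevP k9.
have Qc : Q center.
  have [_ [c fE]] := eQ; have : convex_hull [set center; pt (latpt k)] center.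
    apply: (@combines_hull _ _ (fun x => (x == latpt 9)%:R)).
      by rewrite -pt_center; apply: combines_pt.
    by move=> x; rewrite pnatr_eq0 eqb0 negbK => /eqP->; left; exact: pt_center.
  by rewrite fE => -[].
have [v fv QE] := cell_center hw cQ Qc; rewrite {Q}QE in cQ eQ Qc *.
have [dim2 _ _] := cQ.
have [tk [tau tau0 pos]] := edge_side fv dim2 k9 eQ.
have [j [j9 tj jk]] : exists j, [/\ (j < 9)%N, tight w j v.1 v.2 & j != k].
  have [i [j [i9 j9 ti tj dij]]] := cell_two_tight fv dim2.
  have [ik|ik] := eqVneq i k; last by exists i.
  exists j; split=> //; apply: contraTneq dij => ->.
  by rewrite ik /dirdet mulrC subrr ltxx.
have fk := (hV k9).1; have fp := (hV p9).1.
have same_V : edge_len V k = 0 -> V k = V (cyc_prev k).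
  move=> L0; have [e1 e2] := edge_vec hV k9; rewrite L0 oppr0 !mul0r in e1 e2.
  by rewrite [V k]surjective_pairing [V (cyc_prev k)]surjective_pairing (subr0_eq e1) (subr0_eq e2).
have [tpos|tneg] : 0 < tau \/ tau < 0 by apply/orP; rewrite orbC -neq_lt.
- have left i : (i < 9)%N -> tight w i v.1 v.2 -> i != k -> 0 < det k i.
    by move=> i9 ti ik; have := pos _ i9 ti ik; rewrite pmulr_rgt0.
  have dkj := left _ j9 tj jk.
  have nj : 0 <= det (cyc_next k) j.
    have := all9P (all9P det_next_finite k9) j9; rewrite Zltb_det //= => /andP[/Zleb_real + _].
    by move/(_ R); rewrite zdetE.
  have dkk : det k k = 0 by rewrite /dirdet mulrC subrr.
  have vE : v = V k.
    have [m1 m2] := fan_min k9 (hV k9) fv.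
    apply: (pairing_inj k9); apply/eqP; rewrite eq_le.
      by rewrite m1 andbT (tight_min fk k9 j9 tk tj dkj) ?dkk // ltW.
    by rewrite m2 andbT (tight_min fk k9 j9 tk tj dkj) // det_next.
  split; last by left; rewrite vE.
  apply/eqP => /same_V E.
  have [i [j' [i9 _ ti _ [_ _ + _]]]] := fan_cone p9; rewrite nE => dik.
  rewrite -E -vE in ti.
  have ik : i != k by apply: contraTneq dik => ->; rewrite dkk ltxx.
  by have := left _ i9 ti ik; rewrite det_opp oppr_gt0 ltNge ltW.
- have right i : (i < 9)%N -> tight w i v.1 v.2 -> i != k -> 0 < det i k.
    by move=> i9 ti ik; have := pos _ i9 ti ik; rewrite nmulr_rgt0 // det_opp oppr_lt0.
  have djk := right _ j9 tj jk.
  have nj : 0 <= det j (cyc_prev k).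
    have := all9P (all9P det_next_finite k9) j9; rewrite (Zltb_det djk) => /andP[_ /Zleb_real].
    by move/(_ R); rewrite zdetE.
  have dkk : det k k = 0 by rewrite /dirdet mulrC subrr.
  have vE : v = V (cyc_prev k).
    have [m1 m2] := fan_min p9 (hV p9) fv.
    apply: (pairing_inj p9); apply/eqP; rewrite eq_le.
      rewrite m1 andbT (tight_min fp j9 k9 tj tk djk) //.
      by rewrite -{2}nE det_next.
    by rewrite m2 andbT nE (tight_min fp j9 k9 tj tk djk) ?dkk // ltW.
  split; last by right; rewrite vE.
  apply/eqP => /same_V E.
  have [i [j' [_ j'9 _ tj' [_ dkj' _ _]]]] := fan_cone k9.
  rewrite E -vE in tj'.
  have jk' : j' != k by apply: contraTneq dkj' => ->; rewrite dkk ltxx.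
  by have := right _ j'9 tj' jk'; rewrite det_opp oppr_gt0 ltNge ltW.
Qed.

(** Along a side of positive length the slack of d_j changes by a multiple of
    det(d_k, d_j), so its nonnegativity at one end and vanishing at the other
    fix the sign of this determinant. *)
Lemma edge_spokes k : (k < 9)%N -> edge_len V k != 0 ->
  is_edge (cellv (V k)) center (pt (latpt k)) /\
  is_edge (cellv (V (cyc_prev k))) center (pt (latpt k)).
Proof.
move=> k9 ek; have [p9 nE] := prevP k9.
have L0 : 0 < edge_len V k by rewrite lt_neqAle eq_sym ek (edge_len_ge0 hV).
have [tk tp] := edge_tight hV k9 ek; have [e1 e2] := edge_vec hV k9.
have shift j : slack w j (V k).1 (V k).2 - slack w j (V (cyc_prev k)).1 (V (cyc_prev k)).2 =
    - (edge_len V k * det k j).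
  transitivity (dx j * ((V k).1 - (V (cyc_prev k)).1) + dy j * ((V k).2 - (V (cyc_prev k)).2)).
    by rewrite /slack; ring.
  by rewrite e1 e2 /dirdet; ring.
split.
- apply: (@side_edge _ _ 1) => //; first exact: (hV k9).1.
  move=> j j9 tj jk; rewrite mul1r lt_neqAle; apply/andP; split.
    by apply: contra jk => /eqP d0; apply/eqP; apply: opposite_not_tight tj tk (esym d0).
  rewrite -(pmulr_rge0 _ L0) -[_ * _]opprK -shift tj sub0r opprK.
  exact: (hV p9).1.
- apply: (@side_edge _ _ (-1)) => //; first exact: (hV p9).1.
  move=> j j9 tj jk; rewrite mulN1r oppr_gt0 lt_neqAle; apply/andP; split.
    by apply: contra jk => /eqP d0; apply/eqP; apply: opposite_not_tight tj tp d0.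
  rewrite -(pmulr_rle0 _ L0) -oppr_ge0 -shift tj subr0.
  exact: (hV k9).1.
Qed.

End Spokes.

(** * The length of the cycle *)

Section CycleLength.
Variables (R : realType) (u : A3 -> R).
Implicit Types (p q c : 'rV[R]_2) (v : R * R) (Q : set 'rV[R]_2).
Local Notation pt := (@pt R).
Local Notation w := (fun k => u (latpt k)).
Local Notation dx := (dirx R).
Local Notation dy := (diry R).
Local Notation det := (dirdet R).
Local Notation center := (vec 1 1 : 'rV[R]_2).
Local Notation cellv := (cellv u).
Hypothesis hw : interior w.
Variable V : nat -> R * R.
Hypothesis hV : forall k, (k < 9)%N -> fan_spec w k (V k).

Lemma slack_potential v k : (k < 10)%N ->
  u (latpt k) + dot (pt (latpt k)) (vec v.1 v.2) =
  u (latpt 9) + v.1 + v.2 + slack w k v.1 v.2.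
Proof.
move=> k10; rewrite pt_latpt // dotE !(vecE _ _).1 !(vecE _ _).2 /slack.
by ring.
Qed.

Lemma feasible_attains v k : feasible w v.1 v.2 -> (k < 10)%N ->
  tight w k v.1 v.2 -> attains_min u (vec v.1 v.2) (latpt k).
Proof.
move=> fv k10 tk x; have [j j10 ->] := latpt_surj x.
rewrite !slack_potential // tk lerD2l.
have [j9|j9] := ltnP j 9; first exact: fv.
by have -> : j = 9%N by [lia|]; rewrite slack9.
Qed.

(** Two independent tight constraints determine the point. *)
Lemma dual_vertex_fan k W : (k < 9)%N ->
  dual_vertex u (cellv (V k)) W <-> W = vec (V k).1 (V k).2.
Proof.
move=> k9; have fk := (hV k9).1.
have [_ [i [j [i9 j9 ij ti tj]]]] := hV k9.
have [dij _ _] := straddlesP R ij.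
have markP l : (l < 10)%N -> tight w l (V k).1 (V k).2 -> marking u (cellv (V k)) (latpt l).
  by move=> l10 tl; apply/cellv_marking => //; exists l.
split.
  case=> _ att; pose v := (W 0 0, W 0 1).
  have WE : W = vec v.1 v.2 by apply: row2P; rewrite !mxE.
  have tight_v l : (l < 10)%N -> tight w l (V k).1 (V k).2 -> tight w l v.1 v.2.
    move=> l10 tl; have := att _ (markP l l10 tl) (latpt 9).
    have := att _ (markP 9%N isT (slack9 u (V k))) (latpt l).
    rewrite WE !slack_potential // slack9 addr0 lerDl gerDl => h1 h2.
    by apply/eqP; rewrite eq_le h1 h2.
  have tiv := tight_v i (ltnW i9) ti; have tjv := tight_v j (ltnW j9) tj.
  have same l : pairing l v = pairing l (V k).
    apply/esym/subr0_eq/(mulfI (lt0r_neq0 dij)).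
    by rewrite mulr0 (cone_pairing l (V k) tiv tjv) ti tj !mulr0 addr0.
  by rewrite WE (pairing_inj k9 (same k) (same (cyc_next k))).
move=> ->; split.
  exists (latpt 9), (latpt i); split.
  - by move=> /(@latpt_inj 9 i isT (ltnW i9)) E; rewrite -E in i9.
  - by apply: feasible_attains => //; apply: slack9.
  - by apply: feasible_attains => //; apply: ltnW.
by move=> x /cellv_marking[] // l [l10 -> tl]; apply: feasible_attains.
Qed.

Lemma enormZ (x y t : R) : enorm (vec (t * x) (t * y)) = `|t| * enorm (vec x y).
Proof.
rewrite /enorm !dotE !(vecE _ _).1 !(vecE _ _).2.
have -> : t * x * (t * x) + t * y * (t * y) = t ^+ 2 * (x * x + y * y) by ring.
by rewrite sqrtrM ?sqr_ge0 // sqrtr_sqr.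
Qed.

(** The side is the direction d_k turned by a right angle, scaled by the
    lattice length. *)
Lemma edge_norm k : (k < 9)%N ->
  enorm (vec (V k).1 (V k).2 - vec (V (cyc_prev k)).1 (V (cyc_prev k)).2) /
  enorm (pt (latpt k) - center) = edge_len V k.
Proof.
move=> k9; have [e1 e2] := edge_vec hV k9.
have -> : vec (V k).1 (V k).2 - vec (V (cyc_prev k)).1 (V (cyc_prev k)).2 =
    vec (edge_len V k * dy k) (edge_len V k * - dx k).
  by apply: row2P; rewrite !mxE /= ?e1 ?e2 ?mulrN ?mulNr.
have -> : pt (latpt k) - center = vec (dx k) (dy k).
  by rewrite pt_latpt 1?ltnW //; apply: row2P; rewrite !mxE /= addrAC subrr add0r.
have -> : enorm (vec (dx k) (dy k)) = enorm (vec (dy k) (- dx k)).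
  by rewrite /enorm !dotE !(vecE _ _).1 !(vecE _ _).2 mulrNN addrC.
rewrite enormZ ger0_norm ?(edge_len_ge0 hV) // mulfK // /enorm sqrtr_eq0 -ltNge.
rewrite dotE !(vecE _ _).1 !(vecE _ _).2 mulrNN addrC -!expr2.
exact: dir_neq0.
Qed.

Lemma enormN p : enorm (- p) = enorm p.
Proof. by rewrite /enorm !dotE !mxE !mulrNN. Qed.

Lemma fan_cells_distinct k : (k < 9)%N -> edge_len V k != 0 ->
  cellv (V k) <> cellv (V (cyc_prev k)).
Proof.
move=> k9 ek E; have [p9 _] := prevP k9.
have d1 := (dual_vertex_fan (vec (V k).1 (V k).2) k9).2 erefl.
rewrite E in d1; have := (dual_vertex_fan _ p9).1 d1 => VE.
case/eqP: ek; rewrite -(edge_norm k9) VE subrr.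
by rewrite /enorm dotE !mxE !mul0r addr0 sqrtr0 mul0r.
Qed.

(** The cells at the edge are those dual to V_(k-1) and V_k, in one order or
    the other, so the length does not depend on the choice of cells. *)
Lemma dual_length_fan k : (k < 9)%N -> edge_len V k != 0 ->
  dual_length u (latpt k) = edge_len V k.
Proof.
move=> k9 ek; have [p9 _] := prevP k9.
have [es ep] := edge_spokes hw hV k9 ek.
apply: xget_subset1 => [|l1 l2].
  exists (cellv (V (cyc_prev k))), (cellv (V k)),
    (vec (V (cyc_prev k)).1 (V (cyc_prev k)).2), (vec (V k).1 (V k).2).
  split; last by rewrite edge_norm.
  - split; [exact: fan_cell|exact: fan_cell|].
    by move=> E; apply: (fan_cells_distinct k9 ek).
  - by split.
  - by split; apply/dual_vertex_fan.
have all_eq l : (exists Q Q' W W', [/\ [/\ cell u Q, cell u Q' & Q <> Q'],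
    is_edge Q center (pt (latpt k)) /\ is_edge Q' center (pt (latpt k)),
    dual_vertex u Q W /\ dual_vertex u Q' W'
    & l = enorm (W' - W) / enorm (pt (latpt k) - center)]) -> l = edge_len V k.
  case=> Q [Q' [W [W' [[cQ cQ' ne] [eQ eQ'] [dW dW'] ->]]]].
  have [_ HQ] := spoke_cells hw hV k9 cQ eQ.
  have [_ HQ'] := spoke_cells hw hV k9 cQ' eQ'.
  case: HQ dW ne => -> /dual_vertex_fan -/(_ _)-> // ne;
    case: HQ' dW' ne => -> /dual_vertex_fan -/(_ _) -> // ne.
  - by rewrite -enormN opprB edge_norm.
  - by rewrite edge_norm.
by move=> /all_eq -> /all_eq ->.
Qed.

Lemma cycle_length_fan : has_cycle u -> cycle_length u =
  - pairing 0 (V 0%N) - pairing 3 (V 3%N) - pairing 6 (V 6%N).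
Proof.
move=> cyc; rewrite /cycle_length asboolT // -(perimeter hV) sum_lattice.
rewrite big_mkcond big_nat_recr //=.
have -> : `[< spoke u (latpt 9) >] = false.
  apply/asboolPn => -[Q [_ [ne _]]]; apply: ne; exact: esym (pt_center R).
rewrite addr0; apply: eq_big_nat => k /andP[_ k9].
case: asboolP => [[Q [cQ eQ]]|N].
  by apply: dual_length_fan => //; have [] := spoke_cells hw hV k9 cQ eQ.
apply/esym/eqP; apply: contra_notT N => ek.
by exists (cellv (V k)); split; [exact: fan_cell|have [] := edge_spokes hw hV k9 ek].
Qed.

(** A cell of a triangulation has three marked points; two minimal terms would
    give three marked boundary points besides (1,1). *)
Lemma triangulation_node (c : nat) t t' : is_triangulation u -> c \in [:: 0; 3; 6]%N ->
  t \in node c -> t' \in node c ->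
  weight w t.1 = 4 * u (latpt 9) - pairing c (V c) ->
  weight w t'.1 = 4 * u (latpt 9) - pairing c (V c) -> t = t'.
Proof.
move=> tri cP tc t'c Et Et'; apply/eqP; apply: contraT => tt'.
have c9 : (c < 9)%N by move: c cP {tc t'c Et Et'}; apply/allP.
have fc := (hV c9).1.
have [s [us ss st]] := corner_unique cP tc t'c tt' fc Et Et'.
have [w1 [w2 [w3 [_ _ mE]]]] := tri _ (fan_cell hV c9).
have sub : {subset [seq latpt k | k <- 9%N :: s] <= [:: w1; w2; w3]}.
  move=> x /mapP[k ks ->].
  have [k10 tk] : (k < 10)%N /\ tight w k (V c).1 (V c).2.
    move: ks; rewrite inE => /predU1P[->|/st[k9 tk]]; last by split=> //; apply: ltnW.
    by split=> //; apply: slack9.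
  have : marking u (cellv (V c)) (latpt k) by apply/cellv_marking => //; exists k.
  by rewrite mE !inE => -[[->|->]|->]; rewrite eqxx ?orbT.
have small k : k \in 9%N :: s -> (k < 10)%N.
  by rewrite inE => /predU1P[->//|/st[/ltnW]].
have uq : uniq [seq latpt k | k <- 9%N :: s].
  rewrite map_inj_in_uniq /=; first by rewrite us andbT; apply/negP => /st[].
  by move=> k l /small k10 /small l10; apply: latpt_inj.
by have := uniq_leq_size uq sub; rewrite size_map /= ltnS leqNgt ss.
Qed.

End CycleLength.

Section UniqueMinimum.
Variables (R : realFieldType) (K : idomainType) (v : K -> R).
Hypothesis vP : is_valuation v.
Variables (x : seq K) (u : nat -> R).
Hypothesis sx : size x = 10%N.
Hypothesis xu : forall k, (k < 10)%N -> val_eq v x`_k (u k).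

(** A minimum of weights attained by a single term cannot be affected by
    cancellation. *)
Lemma val_evalp_unique (p : spoly) t0 : reduced p -> t0 \in p ->
  (forall t, t \in p -> weight u t0.1 <= weight u t.1) ->
  (forall t, t \in p -> weight u t.1 = weight u t0.1 -> t = t0) ->
  val_eq v (evalp x p) (weight u t0.1).
Proof.
case/and3P => /map_uniq up _ cp t0p le0 eq0.
have -> : evalp x p = (int_of_Z t0.2)%:~R * evalm x t0.1 + evalp x (rem t0 p).
  by rewrite -evalp_cons; apply: perm_big; apply: perm_to_rem.
apply: val_eqD => //.
  apply: (val_term vP sx xu); apply: contra (allP cp _ t0p) => /eqP E.
  by apply/Z.eqb_eq; apply: (can_inj int_of_ZK).
apply: (val_evalp_gt vP sx xu); apply/allP => t.
rewrite mem_rem_uniq // inE => /andP[tt0 tp]; rewrite lt_neqAle le0 // andbT.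
by apply: contra tt0 => /eqP E; apply/eqP; apply: eq0.
Qed.

End UniqueMinimum.

Lemma node_reduced c : c \in [:: 0; 3; 6]%N -> reduced (node c).
Proof.
have /and3P[r0 r3 r6] := nodes_reduced.
by rewrite !inE => /or3P[] /eqP->.
Qed.

Theorem theorem4p1 (R : realType) (A D : {mpoly rat[#|A3|]}) (u : A3 -> R)
    (hAD : is_j_fraction (puiseux R[i]) A D) (hu : has_cycle u) :
  - (gval u A - gval u D) = cycle_length u /\
  (is_triangulation u ->
   forall (a : A3 -> puiseux R[i]) (j : puiseux R[i]),
     smooth_cubic a ->
     (forall w, a w != 0 /\ ratr (pval (a w)) = u w) ->
     is_j_invariant a j ->
     j != 0 /\ gval u A - gval u D = ratr (pval j)).
Proof.
have hw := has_cycle_interior hu; set w := fun k => u (latpt k) in hw.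
have [V hV] := fan_vertices hw.
pose r c : R := 4 * w 9%N - pairing c (V c).
have fV c : c \in [:: 0; 3; 6]%N -> feasible w (V c).1 (V c).2.
  by move=> cP; apply: (hV c _).1; move: c cP; apply/allP.
have rle c : c \in [:: 0; 3; 6]%N -> all (fun t => r c <= weight w t.1) (node c).
  by move=> cP; apply/allP => t tc; apply: corner_le => //; apply: fV.
(* The valuation of S^3 - T^2 is needed twice, generically and at [a]. *)
have disc_val (K : idomainType) (v : K -> R) (x : seq K) : is_valuation v ->
    size x = 10%N -> (forall k, (k < 10)%N -> val_eq v x`_k (w k)) ->
    (forall c, c \in [:: 0; 3; 6]%N -> val_eq v (evalp x (node c)) (r c)) ->
    val_eq v (evalp x cubic_disc) (r 0%N + r 3 + r 6).
  move=> vP sx xw nv.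
  exact: (val_disc vP sx xw hw (rle 0%N isT) (rle 3 isT) (rle 6 isT)
    (nv 0%N isT) (nv 3 isT) (nv 6 isT)).
have gV := gval_valuation u.
have gdiff : gval u A - gval u D = 3 * (4 * w 9%N) - (r 0%N + r 3 + r 6).
  apply: (gval_j_fraction hAD).
    exact: (val_aronholdS gV size_generic (gval_generic u) hw).
  apply: (disc_val _ _ _ gV size_generic (gval_generic u)) => c cP.
  have [t tc tE] := corner_attained hV cP; rewrite /r -tE.
  apply: gval_evalp => //; first exact: node_reduced.
  by rewrite tE; exact: rle.
split.
  by rewrite gdiff (cycle_length_fan hw hV hu) /r; ring.
move=> tri a j _ ha ja.
have pV := rpval_valuation (@pchar_complex R) R.
have aw k : (k < 10)%N -> val_eq (@rpval _ R) (coefs a)`_k (w k).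
  by move=> k10; rewrite coefsE //; have [] := ha (latpt k).
have Sv := val_aronholdS pV (size_coefs a) aw hw.
have Dv : val_eq (@rpval _ R) (evalp (coefs a) cubic_disc) (r 0%N + r 3 + r 6).
  apply: (disc_val _ _ _ pV (size_coefs a) aw) => c cP.
  have [t tc tE] := corner_attained hV cP; rewrite /r -tE.
  apply: (val_evalp_unique pV (size_coefs a) aw (node_reduced cP) tc).
    by move=> t' t'c; rewrite tE; apply: (allP (rle c cP)).
  move=> t' t'c E.
  exact: (triangulation_node hV tri cP t'c tc (etrans E tE) tE).
have [_ jE] := j_invariant_disc (@pchar_puiseux R) ja.
have rhs := val_eqM pV (val_nat pV (n := 1728) isT) (val_eqX pV 3 Sv).
rewrite -jE in rhs.
have j0 : j != 0 by case: rhs; rewrite mulf_eq0 negb_or => /andP[].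
split=> //; rewrite gdiff -[ratr _]/(rpval R j).
have [_] := rhs; rewrite (valM pV) //; last by case: Dv.
by case: Dv => _ -> E; move: (rpval R j) E; clear; move=> *; lra.
Qed.
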